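(* Let $\Sigma$ be a compact oriented surface with nonempty boundary and negative Euler characteristic, $\Gamma=\pi_1(\Sigma)$, and let $\rho:\Gamma\to\mathrm{Sp}(2n,\mathbf R)$ be a maximal representation such that the image of each peripheral element is Shilov hyperbolic. Then for every peripheral element $\gamma\in\Gamma$ $$\ell_{\mathbb B}(\gamma)=\sum_{\alpha\in\mathcal O_\Sigma(\gamma)}\log\mathbb B(\gamma^-,\delta_\alpha^-,\gamma^+,\delta_\alpha^+).$$
   Context: **Lagrangians.** $\mathrm{Sp}(2n,\mathbf R)$ preserves the symplectic form with matrix $\begin{pmatrix}0&\mathrm{Id}_n\\-\mathrm{Id}_n&0\end{pmatrix}$ in the standard basis $e_1,\dots,e_{2n}$. $\mathcal L(\mathbf R^{2n})$ is the set of Lagrangian subspaces; a real symmetric matrix $X$ is identified with the Lagrangian spanned by the columns of $\begin{pmatrix}X\\ \mathrm{Id}_n\end{pmatrix}$, and $l_\infty=\langle e_1,\dots,e_n\rangle$. A triple of pairwise transverse real Lagrangians is *maximal* if it is in the $\mathrm{Sp}(2n,\mathbf R)$-orbit of $(l_\infty,0,\mathrm{Id})$. For $l_1$ transverse to $l_2$ and $l_3$ transverse to $l_4$, $R(l_1,l_2,l_3,l_4)=p_{l_1}^{\parallel l_2}\circ p_{l_4}^{\parallel l_3}|_{l_1}\in\mathrm{End}(l_1)$, where $p_l^{\parallel l'}$ is the projection onto $l$ parallel to $l'$. **Maximal representations.** Fix a complete finite-area hyperbolization of (the interior of) $\Sigma$, giving an action of $\Gamma$ on $\mathbb S^1=\partial\mathbb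 H^2$. $\rho$ is *maximal* if there is a $\rho$-equivariant right-continuous map $\mathbb S^1\to\mathcal L(\mathbf R^{2n})$ sending positively oriented triples to maximal triples (equivalently, $\rho$ maximizes the Toledo invariant). $g\in\mathrm{Sp}(2n,\mathbf R)$ is *Shilov hyperbolic* if it is conjugate to $\begin{pmatrix}A&0\\0&{}^tA^{-1}\end{pmatrix}$ with all eigenvalues of $A$ of absolute value $>1$; it then fixes two transverse Lagrangians, the attractive one $\Lambda^+_g$ (on which it acts expandingly) and the repulsive one $\Lambda^-_g$. **Boundary map.** Let $\partial\Gamma$ be the Gromov boundary of $\Gamma$, identified with the limit set in $\partial\mathbb H^2$ of the holonomy of a hyperbolic structure on $\Sigma$ with geodesic boundary; for $\gamma\ne 1$, $\gamma^+$ and $\gamma^-$ are its attractive and repulsive fixed points. Under the hypotheses of the claim there is a continuous $\rho$-equivariant map $\phi:\partial\Gamma\to\mathcal L(\mathbf R^{2n})$ sending positively oriented triples to maximal triples, with $\phi(\gamma^\pm)=\Lambda^\pm_{\rho(\gamma)}$. **The cross-ratio $\mathbb B$.** For $x,y,z,t\in\partial\Gamma$ with $x\ne t$ and $y\ne z$, $\mathbb B(x,y,z,t)=\det R(\phi(x),\phi(t),\phi(y),\phi(z))$. The period of $\gamma\neq 1$ is $\ell_{\mathbb B}(\gamma)=\log|\mathbb B(\gamma^-,\gamma\cdot y,\gamma^+,y)|$, for any $y\in\partial\Gamma\setminus\{\gamma^\pm\}$. **Index set.** ''Peripheral element'' means primitive peripheral element of $\Gamma$, oriented so that the surface lies to the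 right of the boundary (one for each boundary component of the universal cover $\widetilde\Sigma$). With this convention, for distinct peripheral $\gamma,\delta$ the tuple $(\gamma^-,\delta^+,\delta^-,\gamma^+)$ is positively oriented. $\mathcal O_\Sigma(\gamma)$ is the set of orthotubes associated to $\gamma$; it is in bijection with the set of peripheral elements $\delta\ne\gamma$ modulo conjugation by $\langle\gamma\rangle$, and $\delta_\alpha$ denotes (a representative of) the peripheral element corresponding to $\alpha$. *)

(* Defs.v *)
From HB Require Import structures.
From mathcomp Require Import all_boot all_order all_algebra.
From mathcomp Require Import all_classical all_reals all_analysis.
From mathcomp Require Import complex.

Set Implicit Arguments.
Unset Strict Implicit.
Unset Printing Implicit Defensive.

Import Order.TTheory GRing.Theory Num.Theory.
Import numFieldNormedType.Exports.

Local Open Scope classical_set_scope.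
Local Open Scope ring_scope.

(* The circle at infinity is the real projective line, [None] being the point
   at infinity.                                                               *)
Notation bdH R := (one_point_compactification R).

Section HyperbolicPlane.
Variable R : realType.

(* A point (x, y) of the upper half-plane stands for the complex number
   x + i y.                                                                   *)
Definition upper : set (R * R) := [set z | 0 < z.2].

Definition mob (g : 'M[R]_2) (z : R * R) : R * R :=
  let w : R[i] := Complex z.1 z.2 in
  let w' := (real_complex R (g 0 0) * w + real_complex R (g 0 1)) /
            (real_complex R (g 1 0) * w + real_complex R (g 1 1)) in
  (complex.Re w', complex.Im w').

Definition infty : bdH R := None.
Definition fin (a : R) : bdH R := Some a.

Definition bmob (g : 'M[R]_2) (x : bdH R) : bdH R :=
  match x with
  | None => if g 1 0 == 0 then None else Some (g 0 0 / g 1 0)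
  | Some a => if g 1 0 * a + g 1 1 == 0 then None
              else Some ((g 0 0 * a + g 0 1) / (g 1 0 * a + g 1 1))
  end.

(* Positively oriented triples of pairwise distinct points: the cyclic order
   induced by the increasing order of the reals, which is the orientation of
   the boundary of the upper half-plane (counterclockwise in the disc).       *)
Definition ltbd (x y : bdH R) : bool :=
  match x, y with
  | Some a, Some b => a < b
  | Some _, None => true
  | None, _ => false
  end.

Definition positive3 (x y z : bdH R) : Prop :=
  [|| ltbd x y && ltbd y z, ltbd y z && ltbd z x | ltbd z x && ltbd x y].

(* The oriented geodesics are the images under SL(2,R) of the imaginary axis
   oriented from 0 to infinity: [geodesic g] runs from [bmob g (fin 0)] to
   [bmob g infty], and [right_side g] is the closed half-plane to its right.  *)
Definition geodesic (g : 'M[R]_2) : set (R * R) :=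
  mob g @` [set z | upper z /\ z.1 = 0].

Definition right_side (g : 'M[R]_2) : set (R * R) :=
  mob g @` [set z | upper z /\ 0 <= z.1].

(* Homogeneous coordinates. For a hyperbolic element of SL(2,R) the attractive
   (resp. repulsive) fixed point is the eigenline whose eigenvalue has modulus
   > 1 (resp. < 1).                                                           *)
Definition hcoord (x : bdH R) : 'cV[R]_2 :=
  match x with
  | None => \col_i (if i == 0 then 1 else 0)
  | Some a => \col_i (if i == 0 then a else 1)
  end.

Definition attractive (g : 'M[R]_2) : bdH R :=
  xget infty [set x | exists2 l : R, 1 < `|l| & g *m hcoord x = l *: hcoord x].

Definition repulsive (g : 'M[R]_2) : bdH R :=
  xget infty [set x | exists2 l : R, `|l| < 1 & g *m hcoord x = l *: hcoord x].

(* A homomorphism to PSL(2,R), given by a lift of each value to SL(2,R).      *)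
Definition psl_hom (G : groupType) (h : G -> 'M[R]_2) : Prop :=
  (forall a, \det (h a) = 1) /\
  (forall a b, h (a * b)%g = h a *m h b \/ h (a * b)%g = - (h a *m h b)).

End HyperbolicPlane.

Section Surface.
Variables (R : realType) (G : groupType).

(* An oriented boundary component of a region [C] lying to its right.         *)
Definition boundary_geodesic (C : set (R * R)) (g : 'M[R]_2) : Prop :=
  [/\ \det g = 1, geodesic g `<=` C & C `<=` right_side g].

(* A compact oriented surface with nonempty boundary, with a hyperbolic
   structure with geodesic boundary; [G] is the fundamental group. By
   uniformization every compact oriented surface with nonempty boundary and
   negative Euler characteristic carries such a structure, and conversely
   Gauss-Bonnet makes the Euler characteristic negative.
   The universal cover of the surface is the closed region [ucov] of the
   hyperbolic plane; it is bounded by complete geodesics, hence it is the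
   intersection of the half-planes they bound and is convex. [G] is the group of
   deck transformations, acting through the holonomy [hol], and the surface
   is the quotient.                                                           *)
Record surface := Surface {
  hol : G -> 'M[R]_2 ;
  ucov : set (R * R) ;
  hol_psl : psl_hom hol ;
  ucov_upper : ucov `<=` @upper R ;
  ucov_closed : closure ucov `&` @upper R `<=` ucov ;
  ucov_interior : interior ucov !=set0 ;
  ucov_boundary : forall z, ucov z -> ~ interior ucov z ->
    exists2 g, boundary_geodesic ucov g & geodesic g z ;
  ucov_boundary_neq0 : exists g, boundary_geodesic ucov g ;
  ucov_invariant : forall a z, ucov z -> ucov (mob (hol a) z) ;
  hol_free : forall a z, ucov z -> mob (hol a) z = z -> a = 1%g ;
  hol_proper : forall K : set (R * R), compact K -> K `<=` ucov ->
    finite_set [set a | (mob (hol a) @` K) `&` K !=set0] ;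
  hol_cocompact : exists K : set (R * R), [/\ compact K, K `<=` ucov &
    forall z, ucov z -> exists a, K (mob (hol a) z)] }.

Variable S : surface.

(* A complete finite-area hyperbolic structure on the interior of the
   surface: the developing map [dev] is an equivariant orientation-preserving
   diffeomorphism from the universal cover of the interior onto the hyperbolic
   plane (completeness is its surjectivity), and some measurable set meeting
   every orbit has finite area for dx dy / y^2.                               *)
Record finite_area_structure := FiniteAreaStructure {
  cusped_hol : G -> 'M[R]_2 ;
  dev : R * R -> R * R ;
  cusped_psl : psl_hom cusped_hol ;
  dev_bij : set_bij (interior (ucov S)) (@upper R) dev ;
  dev_equivariant : forall a z, interior (ucov S) z ->
    dev (mob (hol S a) z) = mob (cusped_hol a) (dev z) ;
  dev_differentiable : forall z, interior (ucov S) z -> differentiable dev z ;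
  dev_C1 : forall v z, interior (ucov S) z ->
    {for z, continuous (fun w => 'D_v dev w)} ;
  dev_oriented : forall z, interior (ucov S) z ->
    let dx := 'D_(1, 0) dev z in let dy := 'D_(0, 1) dev z in
    0 < dx.1 * dy.2 - dx.2 * dy.1 ;
  cusped_area : exists F : set (R * R),
    [/\ measurable F, F `<=` @upper R,
        (forall w, upper w -> exists a, F (mob (cusped_hol a) w)) &
        (\int[((@lebesgue_measure R) \x (@lebesgue_measure R))%E]_(z in F)
           ((z.2 ^- 2)%:E) < +oo)%E] }.

Definition fixp (a : G) : bdH R := attractive (hol S a).
Definition fixm (a : G) : bdH R := repulsive (hol S a).

(* The boundary of [G], as the limit set of the holonomy. The half-planes whose
   boundary arc contains x form a basis of neighbourhoods of x in the closed
   disc.                                                                      *)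
Definition limit_set : set (bdH R) :=
  [set x | exists2 z, upper z &
     forall g, \det g = 1 -> positive3 (bmob g (fin 0)) x (bmob g (infty R)) ->
     exists a, right_side g (mob (hol S a) z)].

Definition primitive (a : G) : Prop :=
  forall (b : G) (k : nat), a = (b ^+ k)%g -> k = 1%N.

(* Primitive, and translating along a boundary component of the universal
   cover in the direction for which the surface lies to the right.            *)
Definition peripheral (a : G) : Prop :=
  primitive a /\
  exists g, [/\ boundary_geodesic (ucov S) g,
    fixm a = bmob g (fin 0) & fixp a = bmob g (infty R)].

(* The orthotubes associated to [a], through their bijection with the classes
   of peripheral elements other than [a] under conjugation by the powers of
   [a].                                                                       *)
Definition power_class (a b : G) : set G :=
  [set c | exists k : nat, c = (b ^ (a ^+ k))%g \/ c = (b ^ (a ^- k))%g].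

Definition orthotubes (a : G) : set (set G) :=
  [set C | exists b, [/\ peripheral b, b <> a & C = power_class a b]].

End Surface.

Section Lagrangians.
Variables (R : realType) (n : nat).

Local Notation V := 'cV[R]_(n + n).

Definition Jmx : 'M[R]_(n + n) := block_mx 0 1%:M (- 1%:M) 0.

Definition symplectic (g : 'M[R]_(n + n)) : Prop := g^T *m Jmx *m g = Jmx.

Definition lagrangian (U : {vspace V}) : Prop :=
  \dim U = n /\ (forall u v, u \in U -> v \in U -> u^T *m Jmx *m v = 0).

Definition colspan (M : 'M[R]_(n + n, n)) : {vspace V} :=
  limg (linfun (mulmx M : 'cV[R]_n -> V)).

Definition act (g : 'M[R]_(n + n)) (U : {vspace V}) : {vspace V} :=
  (linfun (mulmx g : V -> V) @: U)%VS.

Definition lag_infty : {vspace V} := colspan (col_mx 1%:M 0).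
Definition lag_mx (X : 'M[R]_n) : {vspace V} := colspan (col_mx X 1%:M).

Definition maximal3 (l1 l2 l3 : {vspace V}) : Prop :=
  exists2 g, symplectic g &
  [/\ l1 = act g lag_infty, l2 = act g (lag_mx 0) & l3 = act g (lag_mx 1%:M)].

(* The topology of the Grassmannian of n-planes: the quotient topology from
   the space of frames, i.e. of injective (n + n) x n matrices.               *)
Definition lag_nbhs (l : {vspace V}) (P : set {vspace V}) : Prop :=
  exists2 M : 'M[R]_(n + n, n), colspan M = l & nbhs M [set M' | P (colspan M')].

(* Eigenvalues are complex eigenvalues.                                       *)
Definition expanding (A : 'M[R]_n) : Prop :=
  forall l : R[i], eigenvalue (map_mx (real_complex R) A) l -> 1 < `|l|.

(* [g] is Shilov hyperbolic with attractive Lagrangian [lp] and repulsive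
   Lagrangian [lm].                                                           *)
Definition shilov_pair (g : 'M[R]_(n + n)) (lp lm : {vspace V}) : Prop :=
  exists s (A : 'M[R]_n),
    [/\ symplectic s, A \in unitmx /\ expanding A,
        g = s *m block_mx A 0 0 (invmx A^T) *m invmx s,
        lp = act s lag_infty & lm = act s (lag_mx 0)].

Definition shilov_hyperbolic (g : 'M[R]_(n + n)) : Prop :=
  exists lp lm, shilov_pair g lp lm.

(* Determinant of the endomorphism of [U] induced by [f], when [f] maps [U]
   to itself.                                                                 *)
Definition det_on (U : {vspace V}) (f : 'End(V)) : R :=
  \det (\matrix_(i < \dim U, j < \dim U)
          coord (vbasis U) j (f (vbasis U)`_i)).

Definition Rmap (l1 l2 l3 l4 : {vspace V}) : 'End(V) :=
  (daddv_pi l1 l2 \o daddv_pi l4 l3)%VF.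

Definition detR (l1 l2 l3 l4 : {vspace V}) : R :=
  det_on l1 (Rmap l1 l2 l3 l4).

Definition cross_ratio (phi : bdH R -> {vspace V}) (x y z t : bdH R) : R :=
  detR (phi x) (phi t) (phi y) (phi z).

Section Representation.
Variables (G : groupType) (S : surface R G) (X : finite_area_structure S).
Variable rho : G -> 'M[R]_(n + n).

Definition sp_hom : Prop :=
  (forall a, symplectic (rho a)) /\
  (forall a b, rho (a * b)%g = rho a *m rho b).

Definition right_continuous (xi : bdH R -> {vspace V}) : Prop :=
  forall x P, lag_nbhs (xi x) P ->
  exists2 y, y <> x & forall z, positive3 x z y -> P (xi z).

Definition maximal_rep : Prop :=
  sp_hom /\
  exists xi : bdH R -> {vspace V},
    [/\ forall x, lagrangian (xi x),
        forall a x, xi (bmob (cusped_hol X a) x) = act (rho a) (xi x),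
        right_continuous xi &
        forall x y z, positive3 x y z -> maximal3 (xi x) (xi y) (xi z)].

(* Only the values of [phi] on the limit set matter.                          *)
Definition boundary_map (phi : bdH R -> {vspace V}) : Prop :=
  [/\ forall x, limit_set S x -> lagrangian (phi x),
      forall x, limit_set S x -> forall P, lag_nbhs (phi x) P ->
        \forall y \near within (limit_set S) (nbhs x), P (phi y),
      forall a x, limit_set S x ->
        phi (bmob (hol S a) x) = act (rho a) (phi x),
      forall x y z, limit_set S x -> limit_set S y -> limit_set S z ->
        positive3 x y z -> maximal3 (phi x) (phi y) (phi z) &
      forall a, a <> 1%g ->
        shilov_pair (rho a) (phi (fixp S a)) (phi (fixm S a))].

(* The argument of the logarithm in the period of [a], computed at [y].       *)
Definition period_arg (phi : bdH R -> {vspace V}) (a : G) (y : bdH R) : R :=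
  cross_ratio phi (fixm S a) (bmob (hol S a) y) (fixp S a) y.

Definition period (phi : bdH R -> {vspace V}) (a : G) (y : bdH R) : R :=
  ln `|period_arg phi a y|.

End Representation.

End Lagrangians.

(* [s] is the unconditional sum of the family [f] over [D]: the limit of the
   finite partial sums along the finite subsets of [D] ordered by inclusion.  *)
Definition has_sum (R : realType) (I : choiceType) (D : set I) (f : I -> R)
    (s : R) : Prop :=
  forall e : R, 0 < e -> exists A0 : set I,
    [/\ finite_set A0, A0 `<=` D &
        forall A : set I, finite_set A -> A0 `<=` A -> A `<=` D ->
          `|\sum_(i \in A) f i - s| < e].

(* Main.v *)
(* In the chart sending [fixm c] to 0 and [fixp c] to infinity the limit set
   lies in the half-line, and phi becomes an increasing map X from it to the
   positive definite matrices, with B(al) = det X(v) / det X(u) for the gap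
   ]u, v[ of the limit set corresponding to al. The identity thus says that the
   increments of F = ln det X over the gaps in a fundamental interval of c add
   up to the increment of F over the interval, i.e. that the image of the limit
   set under F is negligible.
   This follows from a porosity estimate: there is k > 0 such that every interval
   [x, z] with end points in the limit set contains a gap over which F grows by
   at least k (F z - F x); iterating, what the gaps miss is at most
   (1 - k)^m (F z - F x). By monotonicity of X, the estimate reduces to a bound
   tr ((X v - X u)^-1 (X z - X x)) <= C. The left-hand side depends only on the
   five Lagrangians, hence is invariant under the group, which acts cocompactly
   on triples of distinct limit points; so it is enough to bound it locally
   uniformly in the triple (x, z, infinity), where continuity of phi suffices. *)
Require Import Defs.
From HB Require Import structures.
From mathcomp Require Import all_boot all_order all_algebra.
From mathcomp Require Import all_classical all_reals all_analysis.
From mathcomp Require Import complex ring lra.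

Set Implicit Arguments.
Unset Strict Implicit.
Unset Printing Implicit Defensive.

Import Order.TTheory GRing.Theory Num.Theory.
Import numFieldNormedType.Exports.

Local Open Scope classical_set_scope.
Local Open Scope ring_scope.

(** * The action on the half-plane and its boundary *)

Section Moebius.
Variable R : realType.
Implicit Types (g h : 'M[R]_2) (z w : R * R) (x y : bdH R) (X Y Z : 'cV[R]_2).

(** The surface is known only as a region with a group acting on it, and cocompactness must supply
    three facts. Every boundary geodesic is the axis of a group element: among its translates
    through a compact set two are close, and close boundary geodesics coincide. No half-plane lies
    in the universal cover, so every interval with end points in the limit set contains a gap.
    Triples of limit points are compact modulo the group: a triple is the image of (0, 1, infinity)
    under a matrix h, convexity puts h(i) in the universal cover, and once h(i) is moved into a
    compact set all entries of h are bounded. The passage from matrices to F rests on n - tr (Y^-1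
    X) <= ln det Y - ln det X <= tr (X^-1 Y) - n. The increment over the interval is bounded above
    by a trace weighted by (X x)^-1, the one over the gap below by a trace weighted by (X v)^-1.
    Exchanging the weights costs a factor controlled by the matrices at the two ends of the
    fundamental interval, so k depends on that interval. *)

Lemma mulmx2E m n (A : 'M[R]_(m, 2)) (B : 'M[R]_(2, n)) i j :
  (A *m B) i j = A i 0 * B 0 j + A i 1 * B 1 j.
Proof.
rewrite mxE big_ord_recl big_ord1; congr (_ + A i _ * B _ j); exact: val_inj.
Qed.

Lemma det2E g : \det g = g 0 0 * g 1 1 - g 0 1 * g 1 0.
Proof.
rewrite (expand_det_row _ 0) big_ord_recl big_ord1 /cofactor !det_mx11 !mxE /=.
rewrite expr0 expr1 mul1r mulN1r mulrN.
by congr (_ * g _ _ - g _ _ * g _ _); exact: val_inj.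
Qed.

Lemma det1E g : \det g = 1 -> g 0 0 * g 1 1 = 1 + g 0 1 * g 1 0.
Proof. by rewrite det2E => <-; rewrite subrK. Qed.

Lemma ord2P (P : 'I_2 -> Prop) : P 0 -> P 1 -> forall i, P i.
Proof.
move=> P0 P1 [[|[|//]] lti]; first by rewrite (_ : Ordinal _ = 0) //; exact: val_inj.
by rewrite (_ : Ordinal _ = 1) //; exact: val_inj.
Qed.

Definition mx2 (a b c d : R) : 'M[R]_2 :=
  \matrix_(i, j) if i == 0 then if j == 0 then a else b
                 else if j == 0 then c else d.

Lemma mx2E (a b c d : R) : ((mx2 a b c d 0 0 = a) * (mx2 a b c d 0 1 = b) *
  (mx2 a b c d 1 0 = c) * (mx2 a b c d 1 1 = d))%type.
Proof. by rewrite !mxE. Qed.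

Lemma mx2P g h : g 0 0 = h 0 0 -> g 0 1 = h 0 1 -> g 1 0 = h 1 0 ->
  g 1 1 = h 1 1 -> g = h.
Proof. by move=> *; apply/matrixP; apply: ord2P; apply: ord2P. Qed.

Lemma cV2P X Y : X 0 0 = Y 0 0 -> X 1 0 = Y 1 0 -> X = Y.
Proof. by move=> e0 e1; apply/matrixP; apply: ord2P => j; rewrite ord1. Qed.

(** The adjugate, which is the inverse when the determinant is 1; its entries are polynomial, so
    identities between entries stay within reach of [ring]. *)
Definition inv2 g : 'M[R]_2 := mx2 (g 1 1) (- g 0 1) (- g 1 0) (g 0 0).

Lemma det_inv2 g : \det (inv2 g) = \det g.
Proof. by rewrite !det2E !mx2E; ring. Qed.

Lemma mulmxV2 g : \det g = 1 -> g *m inv2 g = 1%:M.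
Proof.
move=> /det1E dg.
by apply: mx2P; rewrite mulmx2E !mx2E ?mxE //=; ring: dg.
Qed.

Lemma mulVmx2 g : \det g = 1 -> inv2 g *m g = 1%:M.
Proof.
move=> /det1E dg.
by apply: mx2P; rewrite mulmx2E !mx2E ?mxE //=; ring: dg.
Qed.

(* The half-plane to the right of [g] is [side g >= 0]: this is the real part of
   [g^-1 z] up to a positive factor, and it is affine in the Klein coordinates
   [(x, x^2 + y^2)]. *)
Definition side g z := - (g 1 0 * g 1 1) * (z.1 ^+ 2 + z.2 ^+ 2) +
  (g 0 0 * g 1 1 + g 0 1 * g 1 0) * z.1 - g 0 0 * g 0 1.

(** The squared modulus of the denominator of the transformation: imaginary parts are divided by
    it. *)
Definition mobN g z := (g 1 0 * z.1 + g 1 1) ^+ 2 + (g 1 0 * z.2) ^+ 2.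

Lemma mobE g z : mob g z =
  (((g 0 0 * z.1 + g 0 1) * (g 1 0 * z.1 + g 1 1) + g 0 0 * g 1 0 * z.2 ^+ 2)
     / mobN g z, \det g * z.2 / mobN g z).
Proof.
rewrite /mob /mobN det2E; case: z => x y /=.
simpc.
set a := g 0 0; set b := g 0 1; set c := g 1 0; set d := g 1 1.
by congr pair; ring.
Qed.

Lemma mobN_gt0 g z : \det g = 1 -> upper z -> 0 < mobN g z.
Proof.
rewrite /mobN /upper/= det2E => dg z0.
have [c0|c0] := eqVneq (g 1 0) 0.
  rewrite c0 !mul0r expr0n /= addr0 add0r exprn_even_gt0 //=.
  by apply: contra_eq_neq dg => ->; rewrite c0 !mulr0 subrr eq_sym oner_neq0.
rewrite ltr_wpDl ?sqr_ge0 // exprn_even_gt0 //= mulf_neq0 //; lra.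
Qed.

Lemma mob_upper g z : \det g = 1 -> upper z -> upper (mob g z).
Proof.
move=> dg z0; rewrite /upper mobE /= dg mul1r divr_gt0 //; exact: mobN_gt0.
Qed.

Lemma pairP z w : z.1 = w.1 -> z.2 = w.2 -> z = w.
Proof. by case: z w => [? ?] [? ?] /= -> ->. Qed.

Lemma mobM g h z : \det g = 1 -> \det h = 1 -> upper z ->
  mob (g *m h) z = mob g (mob h z).
Proof.
move=> dg dh z0.
have N1 := lt0r_neq0 (mobN_gt0 dh z0).
have N2 := lt0r_neq0 (mobN_gt0 dg (mob_upper dh z0)).
have dgh : \det (g *m h) = 1 by rewrite det_mulmx dg dh mulr1.
have N3 := lt0r_neq0 (mobN_gt0 dgh z0).
have NN : mobN (g *m h) z = mobN g (mob h z) * mobN h z.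
  rewrite /mobN !mobE /= dh !mulmx2E; move: N1 (det1E dh).
  rewrite /mobN => N1 dh'; field: dh'; exact: N1.
have cross (a b c d : R) : c != 0 -> a = b * c -> a / (d * c) = b / d.
  by move=> c0 ->; rewrite invfM mulrCA mulfK // mulrC.
rewrite [mob (g *m h) z]mobE [mob g _]mobE NN dgh dg.
congr pair; apply: (cross) => //.
  rewrite !mobE /= dh !mulmx2E; move: N1 (det1E dh); rewrite /mobN => N1 dh'.
  field: dh'; exact: N1.
by rewrite !mul1r mobE /= dh mul1r divfK.
Qed.

Lemma mob1 z : mob 1%:M z = z.
Proof.
rewrite mobE /mobN det1 !mxE /=; apply: pairP => /=; by field.
Qed.

Lemma mob_opp g z : mob (- g) z = mob g z.
Proof.
rewrite !mobE /mobN !det2E !mxE; apply: pairP => /=; congr (_ / _); ring.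
Qed.

Lemma mobVK g z : \det g = 1 -> upper z -> mob g (mob (inv2 g) z) = z.
Proof. by move=> dg z0; rewrite -mobM ?det_inv2 ?mulmxV2 ?mob1. Qed.

Lemma side_mob g h z : \det h = 1 -> upper z ->
  side g (mob h z) = side (inv2 h *m g) z / mobN h z.
Proof.
move=> dh z0; have N0 := lt0r_neq0 (mobN_gt0 dh z0).
rewrite /side !mobE /= dh !mulmx2E !mx2E; move: N0 (det1E dh); rewrite /mobN.
move=> N0 dh'; field: dh'; exact: N0.
Qed.

Lemma side1 z : side 1%:M z = z.1.
Proof. by rewrite /side !mxE /=; ring. Qed.

Lemma side_mob_id g z : \det g = 1 -> upper z -> side g (mob g z) = z.1 / mobN g z.
Proof. by move=> dg z0; rewrite side_mob // mulVmx2 // side1. Qed.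

Lemma right_sideP g z : \det g = 1 ->
  right_side g z <-> upper z /\ 0 <= side g z.
Proof.
move=> dg; split=> [[w [w0 w1] <-]|[z0 s0]].
  split; first exact: mob_upper.
  by rewrite side_mob_id // divr_ge0 // ltW // mobN_gt0.
have u0 : upper (mob (inv2 g) z) by apply: mob_upper; rewrite ?det_inv2.
exists (mob (inv2 g) z); last exact: mobVK.
split=> //; move: s0; rewrite -{1}(mobVK dg z0) side_mob_id //.
by rewrite pmulr_lge0 // invr_gt0 mobN_gt0.
Qed.

Lemma geodesicP g z : \det g = 1 -> geodesic g z <-> upper z /\ side g z = 0.
Proof.
move=> dg; split=> [[w [w0 w1] <-]|[z0 s0]].
  by split; [exact: mob_upper|rewrite side_mob_id // w1 mul0r].
have u0 : upper (mob (inv2 g) z) by apply: mob_upper; rewrite ?det_inv2.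
exists (mob (inv2 g) z); last exact: mobVK.
split=> //; move/eqP: s0; rewrite -{1}(mobVK dg z0) side_mob_id //.
by rewrite mulf_eq0 invr_eq0 (gt_eqF (mobN_gt0 _ _)) // orbF => /eqP.
Qed.

Definition area X Y := X 0 0 * Y 1 0 - X 1 0 * Y 0 0.

Lemma areaZ a b X Y : area (a *: X) (b *: Y) = a * b * area X Y.
Proof. by rewrite /area !mxE; ring. Qed.

Lemma areaM g X Y : area (g *m X) (g *m Y) = \det g * area X Y.
Proof. by rewrite /area !mulmx2E det2E; ring. Qed.

Lemma hcoordE x : ((hcoord x 0 0 = if x is Some a then a else 1) *
  (hcoord x 1 0 = if x is Some a then 1 else 0))%type.
Proof. by case: x => [a|]; rewrite !mxE. Qed.

Lemma hcoord_neq0 x : hcoord x != 0.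
Proof.
apply/eqP => /matrixP e; have:= e 0 0; have := e 1 0; rewrite !hcoordE !mxE.
by case: x {e} => [a /eqP|_ /eqP]; rewrite oner_eq0.
Qed.

Lemma area_hcoord x y : area (hcoord x) (hcoord y) = 0 -> x = y.
Proof.
rewrite /area !hcoordE; case: x y => [a|] [b|] /eqP.
- by rewrite mulr1 mul1r subr_eq0 => /eqP ->.
- by rewrite mulr0 mul1r sub0r oppr_eq0 oner_eq0.
- by rewrite mulr1 mul0r subr0 oner_eq0.
- by [].
Qed.

Definition rep x X := exists2 a : R, a != 0 & X = a *: hcoord x.

Lemma rep_hcoord x : rep x (hcoord x).
Proof. by exists 1; rewrite ?oner_neq0 ?scale1r. Qed.

Lemma rep_inj x y X : rep x X -> rep y X -> x = y.
Proof.
move=> [a a0 ->] [b b0 e]; apply: area_hcoord; apply/eqP.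
have := areaZ 1 a (hcoord x) (hcoord x); rewrite mul1r scale1r.
rewrite {2}/area (mulrC (hcoord x 1 0)) subrr mulr0 => /eqP.
rewrite e -[X in area X _]scale1r areaZ mul1r mulf_eq0 (negbTE b0) /=.
by [].
Qed.

Lemma repZ x X a : a != 0 -> rep x X -> rep x (a *: X).
Proof.
by move=> a0 [b b0 ->]; exists (a * b); rewrite ?mulf_neq0 // scalerA.
Qed.

Lemma rep_bmob g x X : \det g = 1 -> rep x X -> rep (bmob g x) (g *m X).
Proof.
move=> /det1E dg [c c0 ->]; rewrite -scalemxAr; apply: repZ => //.
case: x => [a|] /=; case: eqP => [e|/eqP e].
- exists (g 0 0 * a + g 0 1).
    apply: contra_eq_neq dg => e'; rewrite -subr_eq0 opprD addrA.
    rewrite (_ : _ - _ = - 1) ?oppr_eq0 ?oner_neq0 //.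
    have -> : g 0 1 = - (g 0 0 * a) by apply/eqP; rewrite -addr_eq0 addrC e'.
    have -> : g 1 1 = - (g 1 0 * a) by apply/eqP; rewrite -addr_eq0 addrC e.
    by ring.
  by apply: cV2P; rewrite !mulmx2E !mxE /= !mulr1 // mulr0.
- exists (g 1 0 * a + g 1 1) => //.
  by apply: cV2P; rewrite !mulmx2E !mxE /= !mulr1 // [RHS]mulrC divfK.
- exists (g 0 0).
    by apply: contra_eq_neq dg => ->; rewrite e mul0r mulr0 addr0 eq_sym oner_neq0.
  by apply: cV2P; rewrite !mulmx2E !mxE /= ?e !mulr1 ?mulr0 ?addr0.
- exists (g 1 0) => //.
  by apply: cV2P; rewrite !mulmx2E !mxE /= !mulr1 !mulr0 ?addr0 // [RHS]mulrC divfK.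
Qed.

Lemma rep_bmob0 g : \det g = 1 -> rep (bmob g (fin 0)) (col 1 g).
Proof.
move=> dg; have := rep_bmob dg (rep_hcoord (fin 0)); congr rep.
by apply: cV2P; rewrite !mulmx2E !mxE /= mulr0 add0r mulr1.
Qed.

Lemma rep_bmoby g : \det g = 1 -> rep (bmob g (infty R)) (col 0 g).
Proof.
move=> dg; have := rep_bmob dg (rep_hcoord (infty R)); congr rep.
by apply: cV2P; rewrite !mulmx2E !mxE /= mulr0 addr0 mulr1.
Qed.

Lemma bmobM g h x : \det g = 1 -> \det h = 1 ->
  bmob (g *m h) x = bmob g (bmob h x).
Proof.
move=> dg dh; apply: (@rep_inj _ _ (g *m h *m hcoord x)).
  by apply: rep_bmob; [rewrite det_mulmx dg dh mulr1|exact: rep_hcoord].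
by rewrite -mulmxA; apply: rep_bmob => //; apply: rep_bmob => //; exact: rep_hcoord.
Qed.

Lemma bmob1 x : bmob 1%:M x = x.
Proof.
apply: (@rep_inj _ _ (1%:M *m hcoord x)).
  by apply: rep_bmob; [rewrite det1|exact: rep_hcoord].
by rewrite mul1mx; exact: rep_hcoord.
Qed.

Lemma bmob_opp g x : bmob (- g) x = bmob g x.
Proof.
case: x => [a|] /=; rewrite !mxE.
  by rewrite !mulNr -!opprD oppr_eq0 invrN mulrNN.
by rewrite oppr_eq0 invrN mulrNN.
Qed.

Lemma bmobK g x : \det g = 1 -> bmob (inv2 g) (bmob g x) = x.
Proof. by move=> dg; rewrite -bmobM ?det_inv2 // mulVmx2 // bmob1. Qed.

Lemma bmobVK g x : \det g = 1 -> bmob g (bmob (inv2 g) x) = x.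
Proof. by move=> dg; rewrite -bmobM ?det_inv2 // mulmxV2 // bmob1. Qed.

Lemma positive3_hcoord x1 x2 x3 : positive3 x1 x2 x3 <->
  0 < area (hcoord x1) (hcoord x2) * area (hcoord x2) (hcoord x3) *
      area (hcoord x3) (hcoord x1).
Proof.
rewrite /positive3 /area !hcoordE.
case: x1 x2 x3 => [a|] [b|] [c|] /=; rewrite ?mulr1 ?mul1r ?mulr0 ?mul0r ?subr0 ?sub0r.
all: rewrite ?andbF ?andbT ?orbF ?orFb ?oppr0 ?mulr0 ?mul0r ?mulr1 ?mul1r ?ltxx //.
all: rewrite ?mulrN1 ?mulN1r ?opprK ?opprB ?subr_gt0 //.
rewrite -(subr_lt0 b a) -(subr_lt0 c b) -(subr_lt0 a c).
have : a - b + (b - c) + (c - a) = 0 by ring.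
move: (a - b) (b - c) (c - a) => u v w e.
rewrite -mulrA.
case: (ltgtP u 0) => hu; case: (ltgtP v 0) => hv; case: (ltgtP w 0) => hw //=;
  rewrite ?hu ?hv ?hw ?mul0r ?mulr0 ?ltxx //; try (by split=> // h; lra);
  first [rewrite (pmulr_rgt0 _ hu)|rewrite (nmulr_rgt0 _ hu)];
  first [rewrite (pmulr_rgt0 _ hv)|rewrite (nmulr_rgt0 _ hv)
        |rewrite (pmulr_rlt0 _ hv)|rewrite (nmulr_rlt0 _ hv)];
  split=> // h; lra.
Qed.

(** Each vector occurs in two of the three factors, so rescaling multiplies the product by a
    square. *)
Lemma positive3_rep x1 x2 x3 X1 X2 X3 : rep x1 X1 -> rep x2 X2 -> rep x3 X3 ->
  positive3 x1 x2 x3 <-> 0 < area X1 X2 * area X2 X3 * area X3 X1.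
Proof.
move=> [a a0 ->] [b b0 ->] [c c0 ->]; rewrite positive3_hcoord !areaZ.
set u := area _ _; set v := area _ _; set w := area _ _.
have -> : a * b * u * (b * c * v) * (c * a * w) =
  (a * b * c) ^+ 2 * (u * v * w) by ring.
by rewrite [X in _ <-> is_true X]pmulr_rgt0 // exprn_even_gt0 //= !mulf_neq0.
Qed.

Lemma positive3_bmob g x1 x2 x3 : \det g = 1 ->
  positive3 (bmob g x1) (bmob g x2) (bmob g x3) <-> positive3 x1 x2 x3.
Proof.
move=> dg; rewrite positive3_hcoord.
have r x := rep_bmob dg (rep_hcoord x).
by rewrite -(positive3_rep (rep_hcoord _) (rep_hcoord _) (rep_hcoord _))
  (positive3_rep (r x1) (r x2) (r x3)) !areaM dg !mul1r positive3_hcoord.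
Qed.

Lemma positive3_rot x1 x2 x3 : positive3 x1 x2 x3 -> positive3 x2 x3 x1.
Proof. by rewrite !positive3_hcoord -mulrA mulrC. Qed.

Lemma positive3_neq x1 x2 x3 : positive3 x1 x2 x3 -> x1 <> x2.
Proof.
by rewrite positive3_hcoord => + e; rewrite e /area [X in X - _]mulrC subrr !mul0r ltxx.
Qed.

(** In homogeneous coordinates the middle point is a combination of the outer two, and the two
    terms, divided by a common [s], are the columns of [h]. Determinant 1 prescribes [s ^+ 2], and
    positive orientation says exactly that this prescribed value is positive. *)
Lemma positive3_exists x1 x2 x3 : positive3 x1 x2 x3 ->
  exists h, [/\ \det h = 1, bmob h (fin 0) = x1, bmob h (fin 1) = x2 &
                bmob h (infty R) = x3].
Proof.
rewrite positive3_hcoord; set X := hcoord x1; set Z := hcoord x2; set Q := hcoord x3.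
move=> p; have q0 : area Q X != 0 by apply: contraTneq p => ->; rewrite mulr0 ltxx.
set al := area Z X / area Q X; set be := area Q Z / area Q X.
have eZ : Z = al *: Q + be *: X.
  by apply: cV2P; rewrite !mxE /al /be /area; field; exact: q0.
have p' : 0 < al * be * area Q X.
  have -> : al * be * area Q X = (area X Z * area Z Q * area Q X) / area Q X ^+ 2.
    by rewrite /al /be /area; field; exact: q0.
  by rewrite divr_gt0 // exprn_even_gt0.
set s := Num.sqrt (al * be * area Q X).
have s0 : s != 0 by rewrite gt_eqF // sqrtr_gt0.
have s2 : s ^+ 2 = al * be * area Q X by rewrite sqr_sqrtr // ltW.
have al0 : al != 0 by apply: contraTneq p' => ->; rewrite !mul0r ltxx.
have be0 : be != 0 by apply: contraTneq p' => ->; rewrite mulr0 !mul0r ltxx.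
pose h := mx2 (al / s * Q 0 0) (be / s * X 0 0) (al / s * Q 1 0) (be / s * X 1 0).
have dh : \det h = 1.
  rewrite det2E !mx2E -[RHS](mulVf (expf_neq0 2 s0)) {2}s2 /area.
  by field; exact: s0.
have cZ : h *m hcoord (fin 1) = s^-1 *: Z.
  rewrite eZ; apply: cV2P; rewrite !mulmx2E !mx2E !mxE /=; ring.
have c0 : col 1 h = (be / s) *: X by apply: cV2P; rewrite mxE mx2E !mxE.
have cy : col 0 h = (al / s) *: Q by apply: cV2P; rewrite mxE mx2E !mxE.
exists h; split=> //.
- apply: (rep_inj (rep_bmob0 dh)); rewrite c0; apply: repZ; last exact: rep_hcoord.
  by rewrite mulf_neq0 // invr_neq0.
- apply: (rep_inj (rep_bmob dh (rep_hcoord _))); rewrite cZ; apply: repZ.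
    by rewrite invr_neq0.
  exact: rep_hcoord.
- apply: (rep_inj (rep_bmoby dh)); rewrite cy; apply: repZ; last exact: rep_hcoord.
  by rewrite mulf_neq0 // invr_neq0.
Qed.

(** This is 2 (cosh d - 1) for the hyperbolic distance d. *)
Definition cosh_dist z w := ((z.1 - w.1) ^+ 2 + (z.2 - w.2) ^+ 2) / (z.2 * w.2).

Lemma cosh_dist_mob g z w : \det g = 1 -> upper z -> upper w ->
  cosh_dist (mob g z) (mob g w) = cosh_dist z w.
Proof.
move=> dg z0 w0.
have := lt0r_neq0 (mobN_gt0 dg z0); have := lt0r_neq0 (mobN_gt0 dg w0).
have := lt0r_neq0 z0; have := lt0r_neq0 w0; move: (det1E dg).
rewrite /cosh_dist !mobE /= dg /mobN => dg' w1 z1 nw nz.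
by field: dg'; rewrite w1 z1 nw nz.
Qed.

End Moebius.

(** * Convexity of the universal cover *)

Section Convexity.
Variables (R : realType) (G : groupType) (S : surface R G).
Implicit Types (g h : 'M[R]_2) (z w : R * R) (x y : bdH R) (X Y Z : 'cV[R]_2)
  (a b : G) (C : set (R * R)).

Lemma hol_mob_mul a b z : upper z ->
  mob (hol S (a * b)%g) z = mob (hol S a) (mob (hol S b) z).
Proof.
have [dS mS] := hol_psl S; move=> z0.
by case: (mS a b) => ->; rewrite ?mob_opp mobM.
Qed.

Lemma hol_bmob_mul a b x :
  bmob (hol S (a * b)%g) x = bmob (hol S a) (bmob (hol S b) x).
Proof.
have [dS mS] := hol_psl S.
by case: (mS a b) => ->; rewrite ?bmob_opp bmobM.
Qed.

Lemma det_hol a : \det (hol S a) = 1.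
Proof. by have [dS _] := hol_psl S. Qed.

Lemma hol1 : hol S 1%g = 1%:M \/ hol S 1%g = - 1%:M.
Proof.
have [_ /(_ 1%g 1%g)] := hol_psl S; rewrite mulg1.
have d1 := det_hol 1%g; move: d1 => /[dup] d1.
move=> /(@mulVmx2 _ _) v1 [e|e]; [left|right].
  by rewrite -v1 [X in inv2 _ *m X]e mulmxA v1 mul1mx.
by rewrite -v1 [X in inv2 _ *m X]e mulmxN mulmxA v1 mul1mx opprK.
Qed.

Lemma hol1_mob z : mob (hol S 1%g) z = z.
Proof. by case: hol1 => ->; rewrite ?mob_opp mob1. Qed.

Lemma hol1_bmob x : bmob (hol S 1%g) x = x.
Proof. by case: hol1 => ->; rewrite ?bmob_opp bmob1. Qed.

Lemma hol_mobVK a z : upper z -> mob (hol S a) (mob (hol S a^-1%g) z) = z.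
Proof. by move=> z0; rewrite -hol_mob_mul // mulgV hol1_mob. Qed.

Lemma hol_bmobK a x : bmob (hol S a^-1%g) (bmob (hol S a) x) = x.
Proof. by rewrite -hol_bmob_mul // mulVg hol1_bmob. Qed.

Lemma side_mulmx g h z : \det h = 1 -> upper z ->
  side (h *m g) (mob h z) = side g z / mobN h z.
Proof. by move=> dh z0; rewrite side_mob // mulmxA mulVmx2 // mul1mx. Qed.

Lemma boundary_geodesicP C g : \det g = 1 -> C `<=` @upper R ->
  boundary_geodesic C g <->
  (forall z, upper z -> side g z = 0 -> C z) /\ (forall z, C z -> 0 <= side g z).
Proof.
move=> dg Cu; split=> [[_ gC Cr]|[gC Cr]].
  split=> [z z0 s0|z Cz]; first by apply: gC; apply/geodesicP.
  by have /(right_sideP _ dg)[] := Cr _ Cz.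
split=> // z; first by move=> /(geodesicP _ dg)[]; exact: gC.
by move=> Cz; apply/right_sideP => //; split; [exact: Cu|exact: Cr].
Qed.

Lemma boundary_geodesic_hol a g : boundary_geodesic (ucov S) g ->
  boundary_geodesic (ucov S) (hol S a *m g).
Proof.
move=> bg; have [dg _ _] := bg; have da := det_hol a.
move: bg => /(boundary_geodesicP dg (@ucov_upper _ _ S))[gC Cr].
apply/boundary_geodesicP; first by rewrite det_mulmx dg da mulr1.
  exact: ucov_upper.
split=> z zz.
  have u0 : upper (mob (hol S a^-1%g) z) by apply: mob_upper => //; exact: det_hol.
  rewrite -(hol_mobVK a zz) side_mulmx // => /eqP.
  rewrite mulf_eq0 invr_eq0 (gt_eqF (mobN_gt0 _ _)) // orbF => /eqP s0.
  by apply: ucov_invariant; apply: gC.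
have z0 := ucov_upper zz.
have u0 : upper (mob (hol S a^-1%g) z) by apply: mob_upper => //; exact: det_hol.
rewrite -(hol_mobVK a z0) side_mulmx // divr_ge0 ?(ltW (mobN_gt0 _ _)) //.
by apply: Cr; exact: ucov_invariant.
Qed.

(** If [side g] vanished at an interior point, a small step against its gradient would make it
    negative, so both partial derivatives vanish there. The vertical one gives [g 1 0 * g 1 1 = 0],
    and then the horizontal one contradicts determinant 1. *)
Lemma interior_side_gt0 C g z : \det g = 1 -> upper z -> interior C z ->
  (forall w, C w -> 0 <= side g w) -> 0 < side g z.
Proof.
move=> dg z0 /nbhs_ballP[e /= e0 eC] Cs.
rewrite lt_def (Cs z) ?andbT; last by apply: eC; exact: ballxx.
apply/negP => /eqP s0.
have key (v1 v2 D : R) : (v1, v2) = (1, 0) \/ (v1, v2) = (0, 1) ->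
    (forall t, side g (z.1 + t * v1, z.2 + t * v2) =
       t * D - g 1 0 * g 1 1 * t ^+ 2) -> D = 0.
  move=> v01 sE; apply/eqP; apply/negP => /negP D0.
  pose al := `|g 1 0 * g 1 1|.
  (* The second bound keeps the step inside the ball, the first keeps the quadratic term below the
     linear one. *)
  pose s := Num.min ((1 + al)^-1) (e / (2 * `|D|)).
  have al0 : 0 <= al by exact: normr_ge0.
  have D0' : 0 < `|D| by rewrite normr_gt0.
  have s0' : 0 < s.
    by rewrite lt_min invr_gt0 ltr_wpDr //= divr_gt0 // mulr_gt0.
  have sD : `|s * D| < e.
    rewrite normrM (gtr0_norm s0').
    apply: (@le_lt_trans _ _ (e / (2 * `|D|) * `|D|)).
      by rewrite ler_pM2r // ge_min lexx orbT.
    rewrite invfM mulrA divfK ?normr_eq0 //.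
    by rewrite ltr_pdivrMr // mulr_natr mulr2n ltrDl.
  have : 0 <= side g (z.1 + (- (s * D)) * v1, z.2 + (- (s * D)) * v2).
    apply: Cs; apply: eC; split => /=; rewrite -ball_normE /= opprD addrA subrr.
      rewrite sub0r normrN; case: v01 => -[-> _]; rewrite ?mulr1 ?mulr0 ?normr0 //.
      by rewrite normrN.
    rewrite sub0r normrN; case: v01 => -[_ ->]; rewrite ?mulr1 ?mulr0 ?normr0 //.
    by rewrite normrN.
  rewrite sE; apply/negP; rewrite -ltNge.
  have s1 : s * (1 + al) <= 1.
    by rewrite -ler_pdivlMr ?ltr_wpDr // div1r ge_min lexx.
  have D2 : 0 < D ^+ 2 by rewrite exprn_even_gt0.
  have a1 : - al <= g 1 0 * g 1 1 by rewrite lerNl ler_normr lexx orbT.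
  have : 0 < s * D ^+ 2 by exact: mulr_gt0.
  set q := s * _ => q0.
  have -> : - (s * D) * D - g 1 0 * g 1 1 * (- (s * D)) ^+ 2 =
    - q - g 1 0 * g 1 1 * s * q by rewrite /q; ring.
  have : 0 < q * (1 + g 1 0 * g 1 1 * s) by apply: mulr_gt0 => //; nra.
  lra.
have e2 := key 0 1 (- (2 * (g 1 0 * g 1 1) * z.2)) (or_intror erefl).
have e1 := key 1 0 (- (2 * (g 1 0 * g 1 1) * z.1) + (g 0 0 * g 1 1 + g 0 1 * g 1 0))
  (or_introl erefl).
have {}e2 : - (2 * (g 1 0 * g 1 1) * z.2) = 0.
  by apply: e2 => t; rewrite -[LHS]subr0 -[X in _ - X]s0 /side /=; ring.
have {}e1 : - (2 * (g 1 0 * g 1 1) * z.1) + (g 0 0 * g 1 1 + g 0 1 * g 1 0) = 0.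
  by apply: e1 => t; rewrite -[LHS]subr0 -[X in _ - X]s0 /side /=; ring.
have c0 : g 1 0 * g 1 1 = 0.
  move/eqP: e2; rewrite oppr_eq0 mulf_eq0 (gt_eqF z0) orbF mulf_eq0 pnatr_eq0 /=.
  by move/eqP.
move: e1; rewrite c0 mulr0 mul0r oppr0 add0r => e1.
have := det1E dg => d1.
have : g 0 0 * g 1 1 * (g 0 1 * g 1 0) = 0 by rewrite mulrACA (mulrC (g 1 1)) c0 mulr0.
by rewrite d1 in e1 * => ?; nra.
Qed.

(* A Euclidean segment in Klein coordinates. *)
Definition klein_seg z w (t : R) : R * R :=
  let x := (1 - t) * z.1 + t * w.1 in
  (x, Num.sqrt ((1 - t) * (z.1 ^+ 2 + z.2 ^+ 2) + t * (w.1 ^+ 2 + w.2 ^+ 2) - x ^+ 2)).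

Lemma klein_seg_gt0 z w t : upper z -> upper w -> 0 <= t <= 1 ->
  0 < (1 - t) * (z.1 ^+ 2 + z.2 ^+ 2) + t * (w.1 ^+ 2 + w.2 ^+ 2) -
    ((1 - t) * z.1 + t * w.1) ^+ 2.
Proof.
rewrite /upper /= => z0 w0 /andP[t0 t1].
have -> : (1 - t) * (z.1 ^+ 2 + z.2 ^+ 2) + t * (w.1 ^+ 2 + w.2 ^+ 2) -
    ((1 - t) * z.1 + t * w.1) ^+ 2 = (1 - t) * t * (z.1 - w.1) ^+ 2 +
    ((1 - t) * z.2 ^+ 2 + t * w.2 ^+ 2) by ring.
have h1 : 0 <= (1 - t) * t * (z.1 - w.1) ^+ 2.
  by rewrite mulr_ge0 ?sqr_ge0 // mulr_ge0 // subr_ge0.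
have h2 : 0 < z.2 ^+ 2 by rewrite exprn_gt0.
have h3 : 0 < w.2 ^+ 2 by rewrite exprn_gt0.
rewrite ltr_wpDl //.
have [t00|t00] := eqVneq t 0; first by rewrite t00 subr0 mul1r mul0r addr0.
apply: ltr_wpDl; first by rewrite mulr_ge0 ?subr_ge0 // ltW.
by rewrite mulr_gt0 // lt_neqAle eq_sym t00.
Qed.

Lemma side_klein_seg g z w t : upper z -> upper w -> 0 <= t <= 1 ->
  side g (klein_seg z w t) = (1 - t) * side g z + t * side g w.
Proof.
move=> z0 w0 t01; rewrite /side /klein_seg /= sqr_sqrtr; first by ring.
exact/ltW/klein_seg_gt0.
Qed.

Lemma klein_seg0 z w : upper z -> klein_seg z w 0 = z.
Proof.
move=> z0; rewrite /klein_seg subr0 !mul1r !mul0r !addr0 addrC addKr.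
by rewrite sqrtr_sqr gtr0_norm //; case: z z0.
Qed.

Lemma klein_seg1 z w : upper w -> klein_seg z w 1 = w.
Proof.
move=> w0; rewrite /klein_seg subrr !mul1r !mul0r !add0r addrC addKr.
by rewrite sqrtr_sqr gtr0_norm //; case: w w0.
Qed.

Lemma klein_seg_continuous z w : continuous (klein_seg z w).
Proof.
move=> t; have cl (a b : R) : (fun t => (1 - t) * a + t * b) @ t --> (1 - t) * a + t * b.
  apply: cvgD; (apply: cvgM; last exact: cvg_cst); last exact: cvg_id.
  by apply: cvgB; [exact: cvg_cst|exact: cvg_id].
pose f1 t := (1 - t) * z.1 + t * w.1.
pose f2 t := Num.sqrt ((1 - t) * (z.1 ^+ 2 + z.2 ^+ 2) +
  t * (w.1 ^+ 2 + w.2 ^+ 2) - f1 t ^+ 2).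
apply: (@cvg_pair R R R (nbhs t) (nbhs (f1 t)) (nbhs (f2 t)) _ _ _ f1 f2).
  exact: cl.
pose q t := (1 - t) * (z.1 ^+ 2 + z.2 ^+ 2) + t * (w.1 ^+ 2 + w.2 ^+ 2) - f1 t ^+ 2.
have cq : q @ t --> q t.
  by apply: cvgB; [exact: cl|apply: cvgM; exact: cl].
apply: (@cvg_comp _ _ _ q Num.sqrt (nbhs t) (nbhs (q t)) (nbhs (f2 t))) => //.
exact: sqrt_continuous.
Qed.

(** On the Klein segment from an interior point to [w], the parameters staying in the region form a
    closed set of [0, 1] that is not everything, so by connectedness the segment meets the frontier
    before reaching [w]. The side function of the boundary geodesic there is affine along the
    segment, positive at the start and zero at the frontier point, hence negative at [w]. *)
Lemma ucov_separation w : upper w -> ~ ucov S w ->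
  exists2 g, boundary_geodesic (ucov S) g & side g w < 0.
Proof.
move=> w0 nw; have [z iz] := ucov_interior S.
have Cz : ucov S z by exact: interior_subset.
have z0 := ucov_upper Cz.
suff [t [t01 Ct nt]] : exists t, [/\ 0 <= t <= 1, ucov S (klein_seg z w t) &
    ~ interior (ucov S) (klein_seg z w t)].
  have [g bg gt] := ucov_boundary Ct nt; exists g => //.
  have [dg _ _] := bg; move: gt => /(geodesicP _ dg)[_].
  rewrite side_klein_seg //.
  have /(boundary_geodesicP dg (@ucov_upper _ _ S))[_ Cs] := bg.
  have := interior_side_gt0 dg z0 iz Cs.
  have : t != 1 by apply: contra_notN nw => /eqP e; rewrite -(klein_seg1 z w0) -e.
  case/andP: t01 => t0 t1 tn1; have {t1 tn1} t1 : t < 1 by rewrite lt_neqAle tn1.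
  nra.
apply: contrapT => nt; apply: nw; rewrite -(klein_seg1 z w0).
have ks := @klein_seg_continuous z w.
have c01 (t : R) : `[0, 1]%classic t -> 0 <= t <= 1 by rewrite /= in_itv.
pose A : set R := [set t | 0 <= t <= 1 /\ ucov S (klein_seg z w t)].
suff e : A = `[0, 1]%classic.
  have : `[0, 1]%classic (1 : R) by rewrite /= in_itv /= ler01 lexx.
  by rewrite -e => -[].
apply: segment_connected.
- by exists 0; split; [rewrite lexx ler01|rewrite klein_seg0].
- exists (klein_seg z w @^-1` interior (ucov S)).
    by apply: open_comp => [? _|]; [exact: ks|exact: open_interior].
  apply/seteqP; split=> t /= [t01 Ct].
    split; first by rewrite /= in_itv.
    by apply: contrapT => ni; apply: nt; exists t.
  by split; [exact: c01|exact: interior_subset].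
- exists (klein_seg z w @^-1` closure (ucov S)).
    by apply: closed_comp => [? _|]; [exact: ks|exact: closed_closure].
  apply/seteqP; split=> t /= [t01 Ct].
    by split; [rewrite /= in_itv|exact: subset_closure].
  have {}t01 := c01 t t01; split=> //; apply: ucov_closed; split=> //.
  by rewrite /upper /= sqrtr_gt0 klein_seg_gt0.
Qed.
End Convexity.

(** * The limit set *)

Arguments mob : simpl never.

Section LimitSet.
Variables (R : realType) (G : groupType) (S : surface R G).
Implicit Types (g h : 'M[R]_2) (z w : R * R) (x y : bdH R) (X Y Z : 'cV[R]_2)
  (a b : G).

(* [half_disc u e] bounds the half-disc of centre [u] and radius [e]. *)
Definition half_disc (u e : R) : 'M[R]_2 :=
  mx2 ((u + e) / (2 * e)) (u - e) (2 * e)^-1 1.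

Lemma det_half_disc (u e : R) : 0 < e -> \det (half_disc u e) = 1.
Proof. by move=> e0; rewrite det2E !mx2E; field; rewrite gt_eqF. Qed.

Lemma side_half_disc (u e : R) z : 0 < e -> 0 <= side (half_disc u e) z ->
  (z.1 - u) ^+ 2 + z.2 ^+ 2 <= e ^+ 2.
Proof.
move=> e0 s0.
have E : 2 * e * side (half_disc u e) z = e ^+ 2 - ((z.1 - u) ^+ 2 + z.2 ^+ 2).
  by rewrite /side !mx2E; field; rewrite gt_eqF.
by rewrite -subr_ge0 -E mulr_ge0 // mulr_ge0 // ltW.
Qed.

Lemma positive3_half_disc (u e : R) : 0 < e -> positive3
  (bmob (half_disc u e) (fin 0)) (fin u) (bmob (half_disc u e) (infty R)).
Proof.
move=> e0; have d := det_half_disc u e0.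
apply/(positive3_rep (rep_bmob0 d) (rep_hcoord _) (rep_bmoby d)).
rewrite /area !mxE /= (_ : _ * _ = e / 2); first by rewrite divr_gt0.
by field; rewrite gt_eqF.
Qed.

Lemma positive3_0y x : positive3 (fin 0) x (infty R) <->
  exists2 u, 0 < u & x = fin u.
Proof.
rewrite /positive3; case: x => [u|] /=; rewrite ?andbF ?andbT ?orbF; last first.
  by split => // -[].
by split=> [u0|[v v0 [->]]//]; exists u.
Qed.

Lemma bmob_chart g x : \det g = 1 ->
  positive3 (bmob g (fin 0)) x (bmob g (infty R)) ->
  exists2 u, 0 < u & x = bmob g (fin u).
Proof.
move=> dg; rewrite -{1}(bmobVK x dg) positive3_bmob // => /positive3_0y[u u0 e].
by exists u => //; rewrite -e bmobVK.
Qed.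

(** At [cosh_dist] equal to E, a point of height v can be displaced horizontally by at most (2 + E)
    / 2 times v, by completing the square. The half-disc has height e and stays at distance e (3 +
    E) from the axis, which is more. *)
Lemma half_disc_escape (E e u p v p' v' : R) : 0 <= E -> 0 < e ->
  u = e * (4 + E) -> 0 < v -> (p - p') ^+ 2 + (v - v') ^+ 2 = E * (v * v') ->
  (p - u) ^+ 2 + v ^+ 2 <= e ^+ 2 -> 0 <= p'.
Proof.
move=> E0 e0 ue v0 cE hd; rewrite leNgt; apply/negP => p'0.
have ve : v <= e.
  rewrite -(ler_pXn2r (n := 2)) ?nnegrE ?(ltW v0) ?(ltW e0) //.
  by apply: le_trans hd; rewrite lerDr sqr_ge0.
have pu : u - e <= p.
  have : `|p - u| <= e.
    rewrite -(ler_pXn2r (n := 2)) ?nnegrE ?(ltW e0) // real_normK ?num_real //.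
    by apply: le_trans hd; rewrite lerDl sqr_ge0.
  by rewrite ler_norml => /andP[+ _]; lra.
have h1 : (e * (3 + E)) ^+ 2 <= (p - p') ^+ 2.
  rewrite ler_pXn2r ?nnegrE //; first by nra.
    by rewrite mulr_ge0 ?ltW // ltr_wpDr.
  by nra.
have h2 : E * (v * v') - (v - v') ^+ 2 <= ((2 + E) / 2) ^+ 2 * v ^+ 2.
  have -> : E * (v * v') - (v - v') ^+ 2 = ((2 + E) / 2) ^+ 2 * v ^+ 2 -
      (((2 + E) / 2 * v - v') ^+ 2 + v ^+ 2) by field.
  by rewrite gerBl addr_ge0 ?sqr_ge0.
have h3 : ((2 + E) / 2) ^+ 2 * v ^+ 2 <= ((2 + E) / 2) ^+ 2 * e ^+ 2.
  apply: ler_wpM2l; first exact: sqr_ge0.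
  by rewrite ler_pXn2r ?nnegrE ?(ltW v0) ?(ltW e0).
have : ((2 + E) / 2) ^+ 2 < (3 + E) ^+ 2 by nra.
rewrite -(ltr_pM2r (exprn_gt0 2 e0)) => h4.
rewrite exprMn mulrC in h1.
lra.
Qed.

(** The definition of the limit set provides one base point; the orbit of another follows it at
    constant hyperbolic distance, so applying the definition to a smaller half-disc inside the given
    half-plane suffices. *)
Lemma limit_set_orbit x z g : limit_set S x -> upper z -> \det g = 1 ->
  positive3 (bmob g (fin 0)) x (bmob g (infty R)) ->
  exists a, right_side g (mob (hol S a) z).
Proof.
move=> [z1 uz1 Hx] uz dg /(bmob_chart dg)[u u0 ex].
pose E := cosh_dist z1 z.
have E0 : 0 <= E.
  by rewrite divr_ge0 ?addr_ge0 ?sqr_ge0 // ltW // mulr_gt0.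
pose e := u / (4 + E).
have e0 : 0 < e by rewrite divr_gt0 // ltr_wpDr.
have ue : u = e * (4 + E) by rewrite divfK // gt_eqF // ltr_wpDr.
have dk := det_half_disc u e0.
have dgk : \det (g *m half_disc u e) = 1 by rewrite det_mulmx dg dk mulr1.
have [|a] := Hx _ dgk.
  by rewrite !bmobM // ex positive3_bmob //; exact: positive3_half_disc.
move=> /(right_sideP _ dgk)[uw sw].
have uaz : upper (mob (hol S a) z) by apply: mob_upper => //; exact: det_hol.
exists a; apply/right_sideP => //; split=> //.
have dig : \det (inv2 g) = 1 by rewrite det_inv2.
pose w := mob (inv2 g) (mob (hol S a) z1).
pose w' := mob (inv2 g) (mob (hol S a) z).
have w0 : upper w by exact: mob_upper.
have w'0 : upper w' by exact: mob_upper.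
have ew : mob g w = mob (hol S a) z1 by rewrite mobVK.
have ew' : mob g w' = mob (hol S a) z by rewrite mobVK.
have cE : cosh_dist w w' = E.
  by rewrite cosh_dist_mob // cosh_dist_mob //; exact: det_hol.
have {}cE : (w.1 - w'.1) ^+ 2 + (w.2 - w'.2) ^+ 2 = E * (w.2 * w'.2).
  by rewrite -cE /cosh_dist divfK // mulf_neq0 // gt_eqF.
have hd : (w.1 - u) ^+ 2 + w.2 ^+ 2 <= e ^+ 2.
  apply: side_half_disc => //; move: sw; rewrite -ew side_mulmx //.
  by rewrite pmulr_lge0 // invr_gt0 mobN_gt0.
rewrite -ew' side_mob_id // divr_ge0 ?(ltW (mobN_gt0 _ _)) //.
exact: half_disc_escape cE hd.
Qed.

(** The inequality says that [g^-1 x] lies in [0, infinity]. If it were a negative number u, the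
    half-disc of radius |u| / 2 around u would contain a point of an orbit in the universal cover,
    although it lies to the left of the axis. *)
Lemma limit_set_side g x X : boundary_geodesic (ucov S) g -> limit_set S x ->
  rep x X -> 0 <= (inv2 g *m X) 0 0 * (inv2 g *m X) 1 0.
Proof.
move=> bg Lx rX; have [dg _ _] := bg.
have dig : \det (inv2 g) = 1 by rewrite det_inv2.
have [c c0 ->] := rep_bmob dig rX; rewrite !mxE mulrACA -expr2.
apply: mulr_ge0; first exact: sqr_ge0.
case e : (bmob (inv2 g) x) => [u|]; rewrite !mxE /= ?mulr0 // mulr1.
rewrite leNgt; apply/negP => u0.
have e0 : 0 < - u / 2 by rewrite divr_gt0 // oppr_gt0.
have dk := det_half_disc u e0.
have dgk : \det (g *m half_disc u (- u / 2)) = 1 by rewrite det_mulmx dg dk mulr1.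
have [z iz] := ucov_interior S; have Cz := interior_subset iz.
have z0 := ucov_upper Cz.
have [|a] := limit_set_orbit Lx z0 dgk.
  rewrite !bmobM // -(bmobVK x dg) e positive3_bmob //.
  exact: positive3_half_disc.
move=> /(right_sideP _ dgk)[uw sw].
have dgC := boundary_geodesicP dg (@ucov_upper _ _ S).
have [_ Cs] := iffLR dgC bg.
have := Cs _ (ucov_invariant a Cz).
pose w := mob (inv2 g) (mob (hol S a) z).
have w0 : upper w by exact: mob_upper.
have ew : mob g w = mob (hol S a) z by rewrite mobVK.
move: sw; rewrite -ew side_mulmx // side_mob_id //.
rewrite !pmulr_lge0 ?invr_gt0 ?mobN_gt0 // => /(side_half_disc e0).
have := sqr_ge0 w.2; nra.
Qed.

Lemma limit_set_hol a x : limit_set S x -> limit_set S (bmob (hol S a) x).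
Proof.
move=> [z z0 Lx]; exists z => // g dg p.
have dh := det_hol S a.
have dV : \det (inv2 (hol S a)) = 1 by rewrite det_inv2.
have dg' : \det (inv2 (hol S a) *m g) = 1 by rewrite det_mulmx dV dg mulr1.
have [|b] := Lx _ dg'.
  by rewrite -(positive3_bmob _ _ _ dh) !bmobM // !bmobVK.
move=> /(right_sideP _ dg')[u s]; exists (a * b)%g.
apply/right_sideP => //; rewrite hol_mob_mul //; split; first exact: mob_upper.
by rewrite side_mob // divr_ge0 // ltW // mobN_gt0.
Qed.

Lemma limit_set_closed x : ~ limit_set S x -> exists g, [/\ \det g = 1,
  positive3 (bmob g (fin 0)) x (bmob g (infty R)) &
  forall y, positive3 (bmob g (fin 0)) y (bmob g (infty R)) -> ~ limit_set S y].
Proof.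
have u01 : upper ((0, 1) : R * R) by rewrite /upper /=.
move=> nL; apply: contrapT => nex; apply: nL; exists (0, 1) => // g dg p.
apply: contrapT => na; apply: nex; exists g; split=> // y py Ly; apply: na.
exact: limit_set_orbit py.
Qed.

(** Convexity, at the one point where it is needed: the side function of a boundary geodesic at
    [h (i)] is, up to a positive factor, the sum of the two products that [limit_set_side] makes
    nonnegative at the end points. *)
Lemma ucov_geodesic h : \det h = 1 -> limit_set S (bmob h (fin 0)) ->
  limit_set S (bmob h (infty R)) -> ucov S (mob h (0, 1)).
Proof.
move=> dh L0 Ly; apply: contrapT => nC.
have u01 : upper ((0, 1) : R * R) by rewrite /upper /=.
have [|g bg] := ucov_separation _ nC; first exact: mob_upper.
rewrite side_mob // ltNge => /negP; apply; rewrite divr_ge0 ?(ltW (mobN_gt0 _ _)) //.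
have := limit_set_side bg L0 (rep_bmob0 dh).
have := limit_set_side bg Ly (rep_bmoby dh).
rewrite /side !mulmx2E !mx2E !mxE /=; lra.
Qed.

End LimitSet.

(** * Translations along boundary geodesics *)

Section Axis.
Variables (R : realType) (G : groupType) (S : surface R G).
Implicit Types (g h : 'M[R]_2) (z w : R * R) (x y : bdH R) (X Y Z : 'cV[R]_2)
  (a b : G) (C : set (R * R)) (T U t : R).

Definition diag2 t : 'M[R]_2 := mx2 t 0 0 t^-1.

Lemma det_diag2 t : t != 0 -> \det (diag2 t) = 1.
Proof. by move=> t0; rewrite det2E !mx2E mulfV // mulr0 subr0. Qed.

Lemma diag2M t T : diag2 t *m diag2 T = diag2 (t * T).
Proof.
by apply: mx2P; rewrite mulmx2E !mx2E ?mul0r ?mulr0 ?addr0 ?add0r ?invfM.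
Qed.

Lemma side_diag2 g t z : t != 0 -> side (g *m diag2 t) z = side g z.
Proof.
by move=> t0; rewrite /side !mulmx2E !mx2E; field; rewrite t0.
Qed.

Lemma boundary_geodesic_diag2 C g t : t != 0 -> C `<=` @upper R ->
  boundary_geodesic C g -> boundary_geodesic C (g *m diag2 t).
Proof.
move=> t0 Cu bg; have [dg _ _] := bg.
have [gC Cs] := iffLR (boundary_geodesicP dg Cu) bg.
apply/boundary_geodesicP => //; first by rewrite det_mulmx dg det_diag2 ?mulr1.
by split=> z; rewrite side_diag2 //; [exact: gC|exact: Cs].
Qed.

Lemma quadratic_ge0 (u v : R) : (forall t, 0 < t -> 0 <= u * t ^+ 2 + v) ->
  0 <= u /\ 0 <= v.
Proof.
move=> H; split; rewrite leNgt; apply/negP => n0.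
  have t0 : 0 < Num.max 1 (- (`|v| + 1) / u) by rewrite lt_max ltr01.
  have := H _ t0; set t := Num.max _ _; apply/negP; rewrite -ltNge.
  have t1 : 1 <= t by rewrite le_max lexx.
  have : - (`|v| + 1) / u <= t by rewrite le_max lexx orbT.
  rewrite ler_ndivrMr // => tu.
  have := ler_norm v; have := normr_ge0 v.
  have : u * t ^+ 2 <= u * t by rewrite ler_nM2l // expr2 ler_peMl // (le_trans ler01).
  lra.
pose t := Num.min 1 (- v / 2 / (`|u| + 1)).
have u1 : 0 < `|u| + 1 by rewrite ltr_wpDl.
have t0 : 0 < t by rewrite lt_min ltr01 /= divr_gt0 // divr_gt0 // oppr_gt0.
have := H _ t0; apply/negP; rewrite -ltNge.
have t1 : t <= 1 by rewrite ge_min lexx.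
have : t <= - v / 2 / (`|u| + 1) by rewrite ge_min lexx orbT.
rewrite ler_pdivlMr // => tv.
have := ler_norm u; have := normr_ge0 u; have : t ^+ 2 <= t by rewrite expr2 ler_piMl // ltW.
have := sqr_ge0 t.
have : `|u| * t ^+ 2 <= `|u| * t by rewrite ler_wpM2l // expr2 ler_piMl // ltW.
have : u * t ^+ 2 <= `|u| * t ^+ 2 by rewrite ler_wpM2r ?sqr_ge0 // ler_norm.
nra.
Qed.

(** At the point [h (i t)] the side function of [g] is a positive multiple of [u t^2 + v], where [u]
    and [v] are the two products of the conclusion. *)
Lemma boundary_geodesic_cols g h : boundary_geodesic (ucov S) g ->
  boundary_geodesic (ucov S) h ->
  0 <= (inv2 g *m h) 0 0 * (inv2 g *m h) 1 0 /\
  0 <= (inv2 g *m h) 1 1 * (inv2 g *m h) 0 1.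
Proof.
move=> bg bh; have [dg _ _] := bg; have [dh _ _] := bh.
have uS := @ucov_upper _ _ S.
have [_ Cs] := iffLR (boundary_geodesicP dg uS) bg.
have [hC _] := iffLR (boundary_geodesicP dh uS) bh.
apply: quadratic_ge0 => t t0.
have u : upper ((0, t) : R * R) by [].
have /Cs : ucov S (mob h (0, t)).
  by apply: hC; [exact: mob_upper|rewrite side_mob_id // mul0r].
rewrite side_mob // pmulr_lge0 ?invr_gt0 ?mobN_gt0 //.
congr (is_true (0 <= _)); rewrite /side !mulmx2E !mx2E /=; ring.
Qed.

(** The diagonal of [g^-1 h] is positive as soon as [h] is close to [g]. Each geodesic then lies to
    the right of the other, and exchanging them changes the sign of the off-diagonal entries, which
    must vanish. *)
Lemma boundary_geodesic_isolated g h : boundary_geodesic (ucov S) g ->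
  boundary_geodesic (ucov S) h -> 0 < (inv2 g *m h) 0 0 ->
  0 < (inv2 g *m h) 1 1 -> inv2 g *m h = diag2 ((inv2 g *m h) 0 0).
Proof.
move=> bg bh k0 k1; have [dg _ _] := bg; have [dh _ _] := bh.
have [] := boundary_geodesic_cols bg bh.
have [] := boundary_geodesic_cols bh bg.
have -> : inv2 h *m g = inv2 (inv2 g *m h).
  by apply: mx2P; rewrite ?(mulmx2E, mx2E); ring.
rewrite !mx2E; move: k0 k1.
have : \det (inv2 g *m h) = 1 by rewrite det_mulmx det_inv2 dg dh mulr1.
move: (inv2 g *m h) => k dk k0 k1.
rewrite mulrN mulrN !oppr_ge0 !(pmulr_rle0 _ k0) !(pmulr_rle0 _ k1).
rewrite (pmulr_rge0 _ k0) (pmulr_rge0 _ k1) => h1 h2 h3 h4.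
have e10 : k 1 0 = 0 by apply/eqP; rewrite eq_le h1 h3.
have e01 : k 0 1 = 0 by apply/eqP; rewrite eq_le h2 h4.
apply: mx2P; rewrite !mx2E //.
move: dk; rewrite det2E e01 mul0r subr0 => dk.
by rewrite -[RHS]mulr1 -dk mulKf // gt_eqF.
Qed.

Lemma compact_upper_bound C : compact C -> C `<=` @upper R -> exists2 M : R, 0 < M &
  forall z, C z -> [/\ `|z.1| < M, z.2 < M & 1 < M * z.2].
Proof.
move=> /compact_near_coveringP cC Cu.
have /cC : forall z, C z -> \forall z' \near z & M \near +oo,
    [/\ `|z'.1| < M, z'.2 < M & 1 < M * z'.2].
  move=> z /Cu z0; rewrite /upper /= in z0.
  exists (ball z (Num.min 1 (z.2 / 2)), [set M | `|z.1| + 1 + z.2 + 2 / z.2 < M]).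
    split=> /=; last by apply: nbhs_pinfty_gt; exact: num_real.
    by apply: nbhsx_ballx; rewrite lt_min ltr01 divr_gt0.
  move=> [z' M] [/= [b1 b2] lM].
  move: b1 b2; rewrite -ball_normE /= !lt_min => /andP[b1 _] /andP[b2 b3].
  have i0 : 0 < 2 / z.2 by rewrite divr_gt0.
  have := ler_distD z.1 z'.1 0; rewrite !subr0 distrC => n1.
  have n0 := normr_ge0 z.1.
  have /andP[b2l b2r] : -1 < z.2 - z'.2 < 1 by rewrite -ltr_norml.
  have /andP[b3l b3r] : - (z.2 / 2) < z.2 - z'.2 < z.2 / 2 by rewrite -ltr_norml.
  split; [lra|lra|].
  have -> : 1 = (2 / z.2) * (z.2 / 2) by field; rewrite gt_eqF.
  by apply: ltr_pM; [exact: ltW|lra|lra|lra].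
move=> CM; near (pinfty_nbhs R) => M.
have /= CM' : C `<=` (fun z => [/\ `|z.1| < M, z.2 < M & 1 < M * z.2]) by near: M.
by exists M => //; near: M; by apply: nbhs_pinfty_gt; exact: num_real.
Unshelve. all: by end_near. Qed.

(** The imaginary part of [h (i)] is the inverse of the squared norm N of the second row, which is
    therefore bounded. The first row follows from the identity: product of the squared norms of the
    rows = 1 + squared scalar product. *)
Lemma mob_bound C : compact C -> C `<=` @upper R -> exists2 M : R, 0 < M &
  forall h, \det h = 1 -> C (mob h (0, 1)) -> forall i j, `|h i j| <= M.
Proof.
move=> cC Cu; have [M M0 CM] := compact_upper_bound cC Cu.
exists (1 + M + M ^+ 3) => [|h dh /CM]; first by rewrite !addr_gt0 ?exprn_gt0.
have u : upper ((0, 1) : R * R) by rewrite /upper /=.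
have := mobN_gt0 dh u.
rewrite mobE /= dh /mobN /= !(mulr0, mulr1, add0r, expr1n) mul1r.
have dE := det1E dh.
set N := h 1 1 ^+ 2 + h 1 0 ^+ 2; set P := h 0 1 * h 1 1 + h 0 0 * h 1 0.
move=> N0 [x1 x2 x3].
have bnd t : t ^+ 2 <= M + M ^+ 3 -> `|t| <= 1 + M + M ^+ 3.
  rewrite -real_normK ?num_real // => tM.
  have := normr_ge0 t; have := sqr_ge0 (`|t| - 1); nra.
have NM : N < M by move: x3; rewrite ltr_pdivlMr // mul1r.
have M3 : 0 < M ^+ 3 by rewrite exprn_gt0.
have key : h 0 0 ^+ 2 + h 0 1 ^+ 2 = (P / N) ^+ 2 * N + N^-1.
  apply: (mulIf (lt0r_neq0 N0)); rewrite [RHS]mulrDl mulVf ?lt0r_neq0 //.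
  have -> : (P / N) ^+ 2 * N * N = P ^+ 2 by field; rewrite lt0r_neq0.
  by rewrite /P /N; ring: dE.
have top : h 0 0 ^+ 2 + h 0 1 ^+ 2 <= M + M ^+ 3.
  rewrite key addrC lerD ?(ltW x2) // (exprSr M 2) ler_pM ?sqr_ge0 ?(ltW N0) ?(ltW NM) //.
  by rewrite -real_normK ?num_real // ler_pXn2r ?nnegrE ?(ltW M0) ?(ltW x1).
move: top NM; rewrite /N => top NM.
have := sqr_ge0 (h 0 0); have := sqr_ge0 (h 0 1).
have := sqr_ge0 (h 1 0); have := sqr_ge0 (h 1 1).
by move=> ? ? ? ?; apply: ord2P; apply: ord2P; apply: bnd; lra.
Qed.

(** The sign accounts for [hol] taking values in PSL(2,R). In the coordinate given by [g] the
    element acts as multiplication by [T ^+ 2]. *)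
Definition translation g a T :=
  0 < T /\ (hol S a *m g = g *m diag2 T \/ hol S a *m g = - (g *m diag2 T)).

Lemma translation1 g : translation g 1%g 1.
Proof.
split=> //; have -> : diag2 1 = 1%:M by apply: mx2P; rewrite !mx2E !mxE ?invr1.
by rewrite mulmx1; case: (hol1 S) => ->; [left|right]; rewrite ?mulNmx mul1mx.
Qed.

Lemma translationM g a b T U : translation g a T -> translation g b U ->
  translation g (a * b)%g (T * U).
Proof.
move=> [T0 eT] [U0 eU]; split; first exact: mulr_gt0.
have [_ mS] := hol_psl S; rewrite -diag2M.
have : hol S a *m hol S b *m g = g *m (diag2 T *m diag2 U) \/
    hol S a *m hol S b *m g = - (g *m (diag2 T *m diag2 U)).
  rewrite -(mulmxA _ _ g) (mulmxA g).
  by case: eT eU => eT [->|->]; rewrite ?mulmxN mulmxA eT ?mulNmx ?opprK; [left|right|right|left].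
by case: (mS a b) => -> [] e; rewrite ?mulNmx e ?opprK; [left|right|right|left].
Qed.

Lemma mulmx2_inj k g (M N : 'M[R]_(2, k)) : \det g = 1 -> g *m M = g *m N -> M = N.
Proof.
by move=> dg e; rewrite -(mul1mx M) -(mulVmx2 dg) -mulmxA e mulmxA mulVmx2 ?mul1mx.
Qed.

Lemma translationV g a T : translation g a T -> translation g a^-1%g T^-1.
Proof.
move=> [T0 eT]; split; first by rewrite invr_gt0.
have [_ mS] := hol_psl S.
have tn0 : T != 0 by rewrite gt_eqF.
have dT : diag2 T *m diag2 T^-1 = 1%:M.
  by rewrite diag2M mulfV //; apply: mx2P; rewrite !mx2E !mxE ?invr1.
have V : hol S a *m (hol S a^-1%g *m g) = g \/
    hol S a *m (hol S a^-1%g *m g) = - g.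
  case: (mS a a^-1%g) (hol1 S); rewrite mulgV => -> [e|e]; rewrite mulmxA.
  - by left; rewrite e mul1mx.
  - by right; rewrite e mulNmx mul1mx.
  - by right; rewrite -[LHS]opprK -mulNmx e mul1mx.
  - by left; rewrite -[LHS]opprK -mulNmx e mulNmx mul1mx opprK.
have W : hol S a *m (g *m diag2 T^-1) = g \/ hol S a *m (g *m diag2 T^-1) = - g.
  case: eT => e; rewrite mulmxA e ?mulNmx -mulmxA dT mulmx1; by [left|right].
by case: V W => v [w|w]; [left|right|right|left]; apply: (mulmx2_inj (det_hol S a));
  rewrite ?mulmxN w v ?opprK.
Qed.

Lemma translationX g a T k : translation g a T -> translation g (a ^+ k)%g (T ^+ k).
Proof.
move=> tT; elim: k => [|k IH]; first by rewrite expg0 expr0; exact: translation1.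
by rewrite expgS exprS; exact: translationM.
Qed.

Lemma translation_uniq g a T U : \det g = 1 ->
  translation g a T -> translation g a U -> T = U.
Proof.
move=> dg [T0 eT] [U0 eU].
have : diag2 T = diag2 U \/ diag2 T = - diag2 U.
  case: eT eU => -> [e|e]; [left|right|right|left]; apply: (mulmx2_inj dg) => //.
  - by rewrite mulmxN.
  - by rewrite mulmxN -e opprK.
  - exact: oppr_inj.
case=> /matrixP/(_ 0 0); rewrite !mxE //= => e.
by move: T0; rewrite e oppr_gt0 => /lt_trans/(_ U0); rewrite ltxx.
Qed.

Lemma boundary_geodesic_ucov g t : boundary_geodesic (ucov S) g -> 0 < t ->
  ucov S (mob g (0, t)).
Proof.
move=> bg t0; have [dg _ _] := bg.
have [gC _] := iffLR (boundary_geodesicP dg (@ucov_upper _ _ S)) bg.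
by apply: gC; [exact: mob_upper|rewrite side_mob_id // mul0r].
Qed.

Lemma translation_mob g a T z : \det g = 1 -> translation g a T -> upper z ->
  mob (hol S a) (mob g z) = mob g (T ^+ 2 * z.1, T ^+ 2 * z.2).
Proof.
move=> dg [T0 eT] z0; have tn0 := lt0r_neq0 T0.
rewrite -mobM //; last exact: det_hol.
have -> : mob (hol S a *m g) z = mob (g *m diag2 T) z.
  by case: eT => -> //; rewrite mob_opp.
rewrite mobM ?det_diag2 //; congr mob; rewrite mobE det_diag2 // /mobN !mx2E.
apply: pairP => /=; field; rewrite ?tn0 //.
Qed.

Lemma translation_inj g a b T : boundary_geodesic (ucov S) g ->
  translation g a T -> translation g b T -> a = b.
Proof.
move=> bg ta tb; have [dg _ _] := bg.
have := translationM (translationV ta) tb; rewrite mulVf; last by case: ta => /lt0r_neq0.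
move=> t1; have u : upper ((0, 1) : R * R) by rewrite /upper /=.
have := translation_mob dg t1 u; rewrite expr1n !mul1r /= => e.
have {}e := hol_free (boundary_geodesic_ucov bg ltr01) e.
by apply: (mulgI a^-1%g); rewrite mulVg.
Qed.

(* Two translates of [g] by elements that bring distinct points [g (i 4^k)] back
   to a compact set, when close enough, are equal up to a reparametrization. *)
Lemma translation_exists g : boundary_geodesic (ucov S) g ->
  exists a T, 1 < T /\ translation g a T.
Proof.
move=> bg; have [dg _ _] := bg.
have [K [cK KC Kt]] := hol_cocompact S.
have [M M0 KM] := mob_bound cK (subset_trans KC (@ucov_upper _ _ S)).
have u : upper ((0, 1) : R * R) by rewrite /upper /=.
have p2 k : 0 < 2 ^+ k :> R by rewrite exprn_gt0.
pose gk k := g *m diag2 (2 ^+ k).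
have dgk k : \det (gk k) = 1 by rewrite det_mulmx dg det_diag2 ?mulr1 ?lt0r_neq0.
have bgk k : boundary_geodesic (ucov S) (gk k).
  by apply: boundary_geodesic_diag2; [exact: lt0r_neq0|exact: ucov_upper|].
have /choice[ak Kak] : forall k, exists a, K (mob (hol S a) (mob (gk k) (0, 1))).
  by move=> k; apply: Kt; exact: boundary_geodesic_ucov.
pose hk k := hol S (ak k) *m gk k.
have dhk k : \det (hk k) = 1 by rewrite det_mulmx dgk mulr1 det_hol.
have bhk k : boundary_geodesic (ucov S) (hk k) by exact: boundary_geodesic_hol.
have Mhk k i j : `|hk k i j| <= M.
  by apply: KM => //; rewrite mobM //; exact: det_hol.
(* Small enough for the diagonal entries of [m] to be within 1/4 of 1. *)
pose e := (16 * (M + 1))^-1.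
have e0 : 0 < e by rewrite invr_gt0 mulr_gt0 // addr_gt0.
have [k [l [kl close]]] : exists k l, (k < l)%N /\
    forall i j, `|hk k i j - hk l i j| < e + e.
  pose p k := ((hk k 0 0, hk k 0 1), (hk k 1 0, hk k 1 1)).
  pose I := `[- M, M]%classic : set R.
  have cI : compact ((I `*` I) `*` (I `*` I)).
    by apply: compact_setX; apply: compact_setX; exact: segment_compact.
  have [|q [_ cq]] := cI (p @ \oo) _ _.
    exists 0 => // k _; have b i j : I (hk k i j) by rewrite /I /= in_itv /= -ler_norml.
    by split; split; exact: b.
  have nq : nbhs q (ball q e) by exact: nbhsx_ballx.
  have fr k : exists2 l, (k < l)%N & ball q e (p l).
    have [|_ [[l kl <-] ql]] := cq (p @` [set l | (k < l)%N]) _ _ nq.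
      by exists k.+1 => // l /= kl; exists l.
    by exists l.
  have [k _ kq] := fr 0; have [l kl lq] := fr k.
  exists k, l; split=> //.
  case: kq lq => [[k1 k2] [k3 k4]] [[l1 l2] [l3 l4]].
  have tri (x y w : R) : ball x e y -> ball x e w -> `|y - w| < e + e.
    rewrite -ball_normE /= => h1 h2.
    by rewrite (le_lt_trans (ler_distD x _ _)) // ltrD // distrC.
  by apply: ord2P; apply: ord2P; apply: tri; eassumption.
have eM : (e + e) * M + (e + e) * M <= 4^-1.
  have -> : (e + e) * M + (e + e) * M = 4^-1 * (M / (M + 1)).
    by rewrite /e; field; rewrite gt_eqF // addr_gt0.
  by rewrite ler_piMr // ler_pdivrMr ?mul1r ?lerDl // addr_gt0.
have mb (x y : R) : `|x| < e + e -> `|y| <= M -> `|x * y| <= (e + e) * M.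
  by move=> hx hy; rewrite normrM ler_pM // ltW.
pose m := inv2 (hk l) *m hk k.
have dm : \det m = 1 by rewrite det_mulmx det_inv2 !dhk mulr1.
(* The bound 1/2 is what makes [T], which is at least twice [m 0 0] because k < l, exceed 1. *)
have m00 : 2^-1 < m 0 0.
  have -> : m 0 0 = 1 + (hk k 0 0 - hk l 0 0) * hk l 1 1 -
      (hk k 1 0 - hk l 1 0) * hk l 0 1.
    by rewrite /m mulmx2E !mx2E; have := det1E (dhk l) => dl; ring: dl.
  have := mb _ _ (close 0 0) (Mhk l 1 1); have := mb _ _ (close 1 0) (Mhk l 0 1).
  rewrite !ler_norml => /andP[? ?] /andP[? ?]; lra.
have m11 : 0 < m 1 1.
  have -> : m 1 1 = 1 + (hk k 1 1 - hk l 1 1) * hk l 0 0 -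
      (hk k 0 1 - hk l 0 1) * hk l 1 0.
    by rewrite /m mulmx2E !mx2E; have := det1E (dhk l) => dl; ring: dl.
  have := mb _ _ (close 1 1) (Mhk l 0 0); have := mb _ _ (close 0 1) (Mhk l 1 0).
  rewrite !ler_norml => /andP[? ?] /andP[? ?]; lra.
have m00' : 0 < m 0 0 by apply: lt_trans m00.
have em := boundary_geodesic_isolated (bhk l) (bhk k) m00' m11.
have ehk : hk k = hk l *m diag2 (m 0 0) by rewrite -em /m mulmxA mulmxV2 ?mul1mx.
pose t := m 0 0; pose T := 2 ^+ (l - k) * t.
have T1 : 1 < T.
  have : 2 <= 2 ^+ (l - k) :> R.
    by rewrite -[X in X <= _]expr1 ler_eXn2l ?ltr1n // subn_gt0.
  by rewrite /T /t; nra.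
have T0 : 0 < T by apply: lt_trans T1.
exists ((ak l)^-1 * ak k)%g, T; split=> //; split=> //.
have [_ mS] := hol_psl S.
have inj : hol S (ak l) *m (hol S ((ak l)^-1 * ak k)%g *m g) = hol S (ak l) *m (g *m diag2 T) \/
   hol S (ak l) *m (hol S ((ak l)^-1 * ak k)%g *m g) = - (hol S (ak l) *m (g *m diag2 T)).
  have -> : hol S (ak l) *m (g *m diag2 T) = hol S (ak k) *m g.
    have : hk k *m diag2 (2 ^+ k)^-1 = hol S (ak k) *m g.
      rewrite /hk /gk -!mulmxA diag2M mulfV ?lt0r_neq0 //; congr (_ *m _).
      have -> : diag2 1 = 1%:M by apply: mx2P; rewrite !mx2E !mxE ?invr1.
      by rewrite mulmx1.
    rewrite ehk /hk /gk -!mulmxA !diag2M => <-; do 2 congr (_ *m _).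
    congr diag2; rewrite /T -/t; apply: (mulIf (lt0r_neq0 (p2 k))).
    rewrite mulrA divfK ?lt0r_neq0 // mulrAC -exprD subnK //; exact: ltnW.
  have := mS (ak l) ((ak l)^-1 * ak k)%g; rewrite mulgA mulgV mul1g mulmxA.
  by case=> ->; [left|right; rewrite mulNmx opprK].
by case: inj => e'; [left|right]; apply: (mulmx2_inj (det_hol S (ak l)));
  rewrite ?mulmxN.
Qed.

End Axis.

(** * Peripheral elements *)

Arguments bmob : simpl never.

Section Peripheral.
Variables (R : realType) (G : groupType) (S : surface R G).
Implicit Types (g h : 'M[R]_2) (z w : R * R) (x y : bdH R) (X Y Z : 'cV[R]_2)
  (a b d : G) (C : set (R * R)) (T U t : R).

Lemma axis_compact g (M : R) : \det g = 1 ->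
  compact [set mob g (0, s) | s in `[1, M]%classic].
Proof.
move=> dg; apply: continuous_compact; last exact: segment_compact.
apply: continuous_in_subspaceT => s; rewrite inE /= in_itv /= => /andP[s1 _].
have u : upper ((0, s) : R * R) by rewrite /upper /= (lt_le_trans ltr01).
have N0 := lt0r_neq0 (mobN_gt0 dg u).
pose N (s : R) := mobN g (0, s).
pose f1 (s : R) := ((g 0 0 * 0 + g 0 1) * (g 1 0 * 0 + g 1 1) +
  g 0 0 * g 1 0 * s ^+ 2) * (N s)^-1.
pose f2 (s : R) := \det g * s * (N s)^-1.
rewrite (_ : (fun s => mob g (0, s)) = fun s => (f1 s, f2 s)); last first.
  by apply/funext => r; rewrite mobE.
have cs : (fun s : R => s) @ s --> s by exact: cvg_id.
have cst (r : R) : (fun=> r) @ s --> r by exact: cvg_cst.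
have cN : (fun s => (N s)^-1) @ s --> (N s)^-1.
  apply: cvgV => //; rewrite /N /mobN /=; apply: cvgD; first exact: cst.
  by rewrite expr2; apply: cvgM; apply: cvgM; (exact: cst || exact: cs).
apply: (@cvg_pair R R R (nbhs s) (nbhs (f1 s)) (nbhs (f2 s)) _ _ _ f1 f2).
  apply: cvgM; last exact: cN; apply: cvgD; first exact: cst.
  by apply: cvgM; [exact: cst|rewrite expr2; apply: cvgM; exact: cs].
by apply: cvgM; [apply: cvgM; [exact: cst|exact: cs]|exact: cN].
Qed.

Lemma seq_argmin (I : eqType) (f : I -> R) (s : seq I) i0 : i0 \in s ->
  exists2 i, i \in s & forall j, j \in s -> f i <= f j.
Proof.
elim: s i0 => [//|k s IH] i0 _.
have [->|[j js]] : s = [::] \/ exists j, j \in s.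
  by case: (s) => [|j s']; [left|right; exists j; rewrite mem_head].
  by exists k; rewrite ?mem_head // => j; rewrite inE => /eqP ->.
have [i is_ mi] := IH _ js; case: (leP (f k) (f i)) => ki.
  exists k; rewrite ?mem_head // => l; rewrite inE => /predU1P[->//|/mi].
  exact: le_trans.
exists i; rewrite ?inE ?is_ ?orbT // => l; rewrite inE => /predU1P[->|/mi //].
exact: ltW.
Qed.

(** A translation by at most [T0] sends [g (i)] into a compact segment of the axis, so properness
    leaves finitely many of them. *)
Lemma min_translation g : boundary_geodesic (ucov S) g ->
  exists d T, [/\ 1 < T, translation S g d T &
    forall b U, translation S g b U -> 1 < U -> T <= U].
Proof.
move=> bg; have [dg _ _] := bg.
have [a0 [T0 [T01 ta0]]] := translation_exists bg.
pose A := [set b | exists2 U, 1 < U <= T0 & translation S g b U].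
pose K := [set mob g (0, s) | s in `[1, T0 ^+ 2]%classic].
have T20 : 1 <= T0 ^+ 2 by rewrite exprn_ege1 // ltW.
have fA : finite_set A.
  have /sub_finite_set : A `<=` [set b | (mob (hol S b) @` K) `&` K !=set0].
    move=> b [U /andP[U1 UT] tb]; exists (mob g (0, U ^+ 2)).
    have UT2 : U ^+ 2 <= T0 ^+ 2.
      by rewrite ler_pXn2r ?nnegrE // (le_trans ler01) // ltW // (lt_le_trans U1).
    have U2 : 1 <= U ^+ 2 by rewrite exprn_ege1 // ltW.
    split; last by exists (U ^+ 2) => //=; rewrite in_itv /= U2 UT2.
    exists (mob g (0, 1)).
      by exists 1 => //=; rewrite in_itv /= lexx.
    by rewrite (translation_mob dg tb) /upper //= mulr0 mulr1.
  apply; apply: hol_proper; first exact: axis_compact.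
  move=> z [s /=]; rewrite in_itv /= => /andP[s1 _] <-.
  by apply: boundary_geodesic_ucov => //; exact: lt_le_trans s1.
have /finite_seqP[s As] := fA.
have aA : a0 \in s.
  by have : A a0 by [exists T0 => //; rewrite T01 lexx]; rewrite As.
pose len b := `|(inv2 g *m (hol S b *m g)) 0 0|.
have lenE b U : translation S g b U -> len b = U.
  move=> [U0 e]; have -> : len b = `|(inv2 g *m (g *m diag2 U)) 0 0|.
    by rewrite /len; case: e => ->; rewrite // mulmxN mxE normrN.
  by rewrite mulmxA mulVmx2 // mul1mx mx2E gtr0_norm.
have [d ds dmin] := seq_argmin len aA.
have [T /andP[T1 TT] td] : A d by rewrite As.
exists d, T; split=> // b U tb U1; have [UT|UT] := leP U T0; last first.
  by apply: le_trans TT _; exact: ltW.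
rewrite -(lenE _ _ tb) -(lenE _ _ td); apply: dmin.
by have : A b by [exists U => //; rewrite U1]; rewrite As.
Qed.

Lemma exprn_unbounded T U : 1 < T -> exists k, U < T ^+ k.
Proof.
move=> T1; have T0 : 0 < T - 1 by rewrite subr_gt0.
have bern k : 1 + k%:R * (T - 1) <= T ^+ k.
  elim: k => [|k IH]; first by rewrite mul0r addr0 expr0.
  rewrite exprS -natr1; apply: (@le_trans _ _ (T * (1 + k%:R * (T - 1)))).
    have : 0 <= k%:R * (T - 1) ^+ 2 :> R by rewrite mulr_ge0 ?sqr_ge0.
    rewrite -subr_ge0 => h; rewrite -subr_ge0; nra.
  by rewrite ler_pM2l // (lt_trans ltr01).
exists (Num.bound (U / (T - 1))).
apply: lt_le_trans (bern _).
have := archi_boundP; have [U0|U0] := leP 0 U.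
  move=> /(_ _ _ (divr_ge0 U0 (ltW T0))); rewrite ltr_pdivrMr //; lra.
by move=> _; apply: lt_trans U0 _; rewrite ltr_pwDl // mulr_ge0 // ltW.
Qed.

Lemma rep_chart h x : \det h = 1 -> rep x (h *m hcoord (bmob (inv2 h) x)).
Proof.
move=> dh; have := rep_bmob dh (rep_hcoord (bmob (inv2 h) x)).
by rewrite bmobVK.
Qed.

Lemma eigen_rep h x X (l : R) : rep x X ->
  (h *m hcoord x = l *: hcoord x) <-> (h *m X = l *: X).
Proof.
move=> [c c0 ->]; rewrite -scalemxAr scalerA (mulrC l) -scalerA; split=> [->//|].
exact: scalerI.
Qed.

(** The matrix diag (T, T^-1) has only the two coordinate eigenlines, so the choice operators
    defining [attractive] and [repulsive] have a single candidate. *)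
Lemma translation_fix g a T : \det g = 1 -> translation S g a T -> 1 < T ->
  fixp S a = bmob g (infty R) /\ fixm S a = bmob g (fin 0).
Proof.
move=> dg [T0 eT] T1.
have tn0 := lt0r_neq0 T0.
have [s [s1 eS]] : exists s : R, `|s| = 1 /\ hol S a *m g = s *: (g *m diag2 T).
  case: eT => ->; first by exists 1; rewrite normr1 scale1r.
  by exists (- 1); rewrite normrN1 scaleN1r.
have key Y (l : R) : hol S a *m (g *m Y) = l *: (g *m Y) ->
    s * (T * Y 0 0) = l * Y 0 0 /\ s * (T^-1 * Y 1 0) = l * Y 1 0.
  rewrite mulmxA eS -scalemxAl -mulmxA !scalemxAr => /(mulmx2_inj dg).
  move=> /matrixP e; have := e 0 0; have := e 1 0.
  rewrite !mulmx2E !mx2E ![(_ *: Y) _ _]mxE !mul0r add0r addr0.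
  by rewrite !(mulrCA s).
have inv_eig Y (l : R) : s * (T * Y 0 0) = l * Y 0 0 ->
    s * (T^-1 * Y 1 0) = l * Y 1 0 -> hol S a *m (g *m Y) = l *: (g *m Y).
  move=> e0 e1; rewrite mulmxA eS -scalemxAl -mulmxA !scalemxAr; congr (_ *m _).
  by apply: cV2P; rewrite !mulmx2E !mx2E ![(_ *: Y) _ _]mxE !mul0r ?add0r ?addr0
    mulrCA.
have Ti : T^-1 < 1 by rewrite invf_lt1.
have Ti0 : 0 < T^-1 by rewrite invr_gt0.
have ny x : rep (bmob g x) (g *m hcoord x) := rep_bmob dg (rep_hcoord x).
split; apply: xget_subset1 => /=.
- exists (s * T); first by rewrite normrM s1 mul1r gtr0_norm.
  apply/(eigen_rep _ _ (ny _)); apply: inv_eig; rewrite !hcoordE ?mulr0 //; ring.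
- move=> x1 x2 [l1 l11 e1] [l2 l21 e2].
  suff H x (l : R) : 1 < `|l| -> hol S a *m hcoord x = l *: hcoord x -> x = bmob g (infty R).
    by rewrite (H _ _ l11 e1) (H _ _ l21 e2).
  move=> l1' /(eigen_rep _ _ (rep_chart x dg)) /key[_].
  case ex: (bmob (inv2 g) x) => [u|]; last by rewrite -(bmobVK x dg) ex.
  rewrite !hcoordE !mulr1 => e; move: l1'.
  by rewrite -e normrM s1 mul1r gtr0_norm // ltNge (ltW Ti).
- exists (s * T^-1); first by rewrite normrM s1 mul1r gtr0_norm.
  apply/(eigen_rep _ _ (ny _)); apply: inv_eig; rewrite !hcoordE ?mulr0 //; ring.
- move=> x1 x2 [l1 l11 e1] [l2 l21 e2].
  suff H x (l : R) : `|l| < 1 -> hol S a *m hcoord x = l *: hcoord x -> x = bmob g (fin 0).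
    by rewrite (H _ _ l11 e1) (H _ _ l21 e2).
  move=> l1' /(eigen_rep _ _ (rep_chart x dg)) /key[+ _].
  have nsT : `|s * T| = T by rewrite normrM s1 mul1r gtr0_norm.
  case ex: (bmob (inv2 g) x) => [u|]; last first.
    by rewrite !hcoordE !mulr1 => e; move: l1'; rewrite -e nsT ltNge (ltW T1).
  rewrite !hcoordE mulrA => e; rewrite -(bmobVK x dg) ex; congr bmob; congr Some.
  have [//|u0] := eqVneq u 0; move: l1'.
  by rewrite -(mulIf u0 e) nsT ltNge (ltW T1).
Qed.

Lemma mulmx_hcoord_infty g : g *m hcoord (infty R) = col 0 g.
Proof. by apply: cV2P; rewrite mulmx2E !mxE /= mulr0 addr0 mulr1. Qed.

Lemma mulmx_hcoord0 g : g *m hcoord (fin 0) = col 1 g.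
Proof. by apply: cV2P; rewrite mulmx2E !mxE /= mulr0 add0r mulr1. Qed.

Lemma rep_exists X : X != 0 -> exists x, rep x X.
Proof.
move=> X0; have [e|x1] := eqVneq (X 1 0) 0.
  exists (infty R), (X 0 0); last by apply: cV2P; rewrite !mxE /= ?e !(mulr1, mulr0).
  by apply: contra_neq X0 => e0; apply: cV2P; rewrite ?e0 ?e !mxE.
exists (fin (X 0 0 / X 1 0)), (X 1 0) => //.
by apply: cV2P; rewrite !mxE /= ?mulr1 // mulrC divfK.
Qed.

(** By Cayley-Hamilton the columns of h - l are eigenvectors for l^-1. If both vanish, h is the
    scalar l, the trace gives l = l^-1, and [x] itself serves. *)
Lemma eigen_exists h x (l : R) : \det h = 1 -> h *m hcoord x = l *: hcoord x ->
  l != 0 /\ exists y, h *m hcoord y = l^-1 *: hcoord y.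
Proof.
move=> dh e; have dE := det1E dh; have X0 := hcoord_neq0 x.
have cX X : X != 0 -> h *m X = l *: X -> h 0 0 * h 1 1 - (h 0 0 + h 1 1) * l -
    h 0 1 * h 1 0 + l ^+ 2 = 0.
  move=> Xn0 /matrixP eX; have := eX 0 0; have := eX 1 0.
  rewrite !mulmx2E ![(_ *: X) _ _]mxE => e1 e0; apply/eqP.
  set D := _ + _; apply: contra_neqT Xn0 => D0; apply: cV2P; rewrite mxE;
    apply: (mulfI D0); rewrite mulr0.
    have -> : D * X 0 0 = (h 1 1 - l) * (h 0 0 * X 0 0 + h 0 1 * X 1 0 - l * X 0 0) -
      h 0 1 * (h 1 0 * X 0 0 + h 1 1 * X 1 0 - l * X 1 0) by rewrite /D; ring.
    by rewrite e0 e1 !subrr !mulr0 subr0.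
  have -> : D * X 1 0 = (h 0 0 - l) * (h 1 0 * X 0 0 + h 1 1 * X 1 0 - l * X 1 0) -
    h 1 0 * (h 0 0 * X 0 0 + h 0 1 * X 1 0 - l * X 0 0) by rewrite /D; ring.
  by rewrite e0 e1 !subrr !mulr0 subr0.
have {}cX := cX _ X0 e.
have l0 : l != 0 by apply: contra_eq_neq cX => ->; rewrite dE expr0n /= mulr0; lra.
have tr : h 0 0 + h 1 1 = l + l^-1 by apply: (mulIf l0); rewrite [RHS]mulrDl mulVf //; lra.
have eD : h 1 1 = l + l^-1 - h 0 0 by rewrite -tr; ring.
split=> //.
have suf Y : Y != 0 -> h *m Y = l^-1 *: Y ->
    exists y, h *m hcoord y = l^-1 *: hcoord y.
  move=> Y0 eY.
  by have [y ry] := rep_exists Y0; exists y; apply/(eigen_rep h _ ry).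
rewrite eD in dE.
have bc : h 0 1 * h 1 0 = h 0 0 * (l + l^-1 - h 0 0) - 1.
  by rewrite dE addrC addKr.
pose Y1 : 'cV[R]_2 := \col_i (if i == 0 then h 0 0 - l else h 1 0).
pose Y2 : 'cV[R]_2 := \col_i (if i == 0 then h 0 1 else h 1 1 - l).
have [y1|Y10] := eqVneq Y1 0; last first.
  apply: (suf Y1) => //; apply: cV2P; rewrite !mulmx2E !mxE /= ?eD ?(mulrC (h 1 0) (h 0 1)) ?bc; field; exact: l0.
have [y2|Y20] := eqVneq Y2 0; last first.
  apply: (suf Y2) => //; apply: cV2P; rewrite !mulmx2E !mxE /= ?eD ?(mulrC (h 1 0) (h 0 1)) ?bc; field; exact: l0.
exists x; rewrite e; congr (_ *: _).
move/matrixP: y1 => /(_ 0 0); rewrite !mxE /= => /eqP; rewrite subr_eq0 => /eqP h0.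
move/matrixP: y2 => /(_ 1 0); rewrite !mxE /= => /eqP; rewrite subr_eq0 => /eqP h1.
by move: eD; rewrite h0 h1; lra.
Qed.

Lemma diagonal_translation g a (l l' : R) : \det g = 1 ->
  hol S a *m col 0 g = l *: col 0 g -> hol S a *m col 1 g = l' *: col 1 g ->
  translation S g a `|l|.
Proof.
move=> dg e0 e1; have dh := det_hol S a.
have e : hol S a *m g = g *m mx2 l 0 0 l'.
  move/matrixP: e0 => e0; move/matrixP: e1 => e1.
  apply: mx2P; rewrite [RHS]mulmx2E !mx2E !mulr0 ?addr0 ?add0r.
  - by move: (e0 0 0); rewrite !mulmx2E !mxE [RHS]mulrC.
  - by move: (e1 0 0); rewrite !mulmx2E !mxE [RHS]mulrC.
  - by move: (e0 1 0); rewrite !mulmx2E !mxE [RHS]mulrC.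
  - by move: (e1 1 0); rewrite !mulmx2E !mxE [RHS]mulrC.
have ll : l * l' = 1.
  have := congr1 determinant e; rewrite !det_mulmx dg dh !mul1r det2E !mx2E.
  by rewrite mulr0 subr0.
have l0 : l != 0 by apply: contra_eq_neq ll => ->; rewrite mul0r eq_sym oner_neq0.
have el : l' = l^-1 by apply: (mulfI l0); rewrite ll mulfV.
split; first by rewrite normr_gt0.
rewrite e el; case: (ger0P l) => _; [by left|right].
by rewrite -mulmxN; congr (_ *m _); apply: mx2P; rewrite !mx2E !mxE /= ?invrN ?opprK ?oppr0.
Qed.

(** [fixp] and [fixm] take the default value infinity when there is no such eigenline. Each kind of
    eigenline exists if the other does, so without them both fixed points would be infinity, whereas
    the ends of [g] are distinct. *)
Lemma fix_translation g a : boundary_geodesic (ucov S) g ->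
  fixm S a = bmob g (fin 0) -> fixp S a = bmob g (infty R) ->
  exists2 T, 1 < T & translation S g a T.
Proof.
move=> bg em ep; have [dg _ _] := bg; have dh := det_hol S a.
have neq : bmob g (fin 0) <> bmob g (infty R).
  by move=> /(congr1 (bmob (inv2 g))); rewrite !bmobK.
pose h := hol S a.
pose P := [set x | exists2 l : R, 1 < `|l| & h *m hcoord x = l *: hcoord x].
pose Q := [set x | exists2 l : R, `|l| < 1 & h *m hcoord x = l *: hcoord x].
have PQ : P !=set0 -> Q !=set0.
  move=> [x [l l1 /(eigen_exists dh)[l0 [y ey]]]].
  by exists y, l^-1 => //; rewrite normfV invf_lt1 // normr_gt0.
have QP : Q !=set0 -> P !=set0.
  move=> [x [l l1 /(eigen_exists dh)[l0 [y ey]]]].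
  by exists y, l^-1 => //; rewrite normfV invf_gt1 // normr_gt0.
have P0 : P !=set0.
  apply: contrapT => nP; apply: neq; rewrite -em -ep /fixm /fixp /attractive /repulsive.
  by rewrite !xgetPN // => x Px; apply: nP; [|apply: QP]; exists x.
have [x0 Px] := P0; have [y0 Qy] := PQ P0.
have [l l1 e1] : P (bmob g (infty R)) by rewrite -ep; exact: (xgetI _ Px).
have [l' l1' e1'] : Q (bmob g (fin 0)) by rewrite -em; exact: (xgetI _ Qy).
exists `|l| => //; apply: (diagonal_translation dg (l' := l')).
  exact/(eigen_rep _ _ (rep_bmoby dg)).
exact/(eigen_rep _ _ (rep_bmob0 dg)).
Qed.

(** A root of [d] commutes with it, hence in the coordinate of [g] it commutes up to sign with diag
    (T, T^-1) and is diagonal. *)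
Lemma primitive_translation g d T b k : \det g = 1 -> translation S g d T -> 1 < T ->
  d = (b ^+ k)%g -> exists2 U, 1 < U & translation S g b U.
Proof.
move=> dg td T1 ed; have dh := det_hol S b.
pose M := inv2 g *m hol S b *m g.
have eM : hol S b *m g = g *m M by rewrite /M !mulmxA mulmxV2 // mul1mx.
clearbody M.
have [T0 eT] := td.
have [_ mS] := hol_psl S.
have cMD : M *m diag2 T = diag2 T *m M \/ M *m diag2 T = - (diag2 T *m M).
  have comm : hol S b *m (hol S d *m g) = hol S d *m (hol S b *m g) \/
      hol S b *m (hol S d *m g) = - (hol S d *m (hol S b *m g)).
    have : hol S b *m hol S d = hol S d *m hol S b \/
        hol S b *m hol S d = - (hol S d *m hol S b).
      have := mS d b; have -> : (d * b)%g = (b * d)%g.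
        by rewrite ed -expgSr -expgS.
      case: (mS b d) => -> [] e; [by left|by right|right|left].
        by rewrite -e opprK.
      exact: oppr_inj.
    by rewrite !mulmxA; case=> ->; [left|right]; rewrite ?mulNmx.
  have {}comm : g *m (M *m diag2 T) = g *m (diag2 T *m M) \/
      g *m (M *m diag2 T) = - (g *m (diag2 T *m M)).
    have eDM : g *m (diag2 T *m M) = g *m diag2 T *m M by rewrite mulmxA.
    have eMD : g *m (M *m diag2 T) = hol S b *m (g *m diag2 T).
      by rewrite mulmxA -eM mulmxA.
    move: comm; rewrite eDM eMD eM (mulmxA (hol S d)).
    case: eT => ->; rewrite ?mulmxN ?mulNmx // opprK => -[] e; [left|right].
      exact: oppr_inj.
    by rewrite -e opprK.
  by case: comm => e; [left|right]; apply: (mulmx2_inj dg); rewrite ?mulmxN.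
have Ti : T^-1 < T by rewrite (lt_trans _ T1) // invf_lt1.
have Ti0 : 0 < T^-1 by rewrite invr_gt0.
have z (u : R) : (u * T^-1 = T * u) \/ (u * T^-1 = - (T * u)) -> u = 0.
  move=> H; apply/eqP; apply: contraT => u0.
  have : T^-1 = T \/ T^-1 = - T.
    by case: H => e; [left|right]; apply: (mulfI u0); rewrite e ?mulrN mulrC.
  by case=> e; [move: Ti; rewrite e ltxx|move: Ti0; rewrite e oppr_gt0 ltNge (ltW T0)].
have {}cMD i j : (M *m diag2 T) i j = (diag2 T *m M) i j \/
    (M *m diag2 T) i j = - (diag2 T *m M) i j.
  by case: cMD => ->; [left|right; rewrite mxE].
have M01 : M 0 1 = 0.
  by apply: z; move: (cMD 0 1); rewrite !mulmx2E !mx2E !mulr0 !mul0r add0r addr0.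
have M10 : M 1 0 = 0.
  apply: z; move: (cMD 1 0); rewrite !mulmx2E !mx2E !mulr0 !mul0r addr0 add0r.
  by case=> e; [left|right]; rewrite mulrC [in RHS]mulrC e ?opprK.
have eb : hol S b *m g = g *m mx2 (M 0 0) 0 0 (M 1 1).
  by rewrite eM; congr (_ *m _); apply: mx2P; rewrite !mx2E.
have tb : translation S g b `|M 0 0|.
  apply: (diagonal_translation dg (l' := M 1 1)).
    move/matrixP: eb => eb; apply: cV2P; rewrite mulmx2E ![col _ _ _ _]mxE -mulmx2E eb.
      by rewrite mulmx2E !mx2E mulr0 addr0 !mxE [RHS]mulrC.
    by rewrite mulmx2E !mx2E mulr0 addr0 !mxE [RHS]mulrC.
  move/matrixP: eb => eb; apply: cV2P; rewrite mulmx2E ![col _ _ _ _]mxE -mulmx2E eb.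
    by rewrite mulmx2E !mx2E mulr0 add0r !mxE [RHS]mulrC.
  by rewrite mulmx2E !mx2E mulr0 add0r !mxE [RHS]mulrC.
exists `|M 0 0| => //.
have := translationX k tb; rewrite -ed => /(translation_uniq dg td) eU.
rewrite ltNge; apply/negP => U1; move: T1; rewrite eU ltNge => /negP; apply.
by rewrite exprn_ile1.
Qed.

Lemma peripheral_exists g : boundary_geodesic (ucov S) g ->
  exists d T, [/\ peripheral S d, 1 < T, translation S g d T,
    fixp S d = bmob g (infty R) & fixm S d = bmob g (fin 0)].
Proof.
move=> bg; have [dg _ _] := bg; have [d [T [T1 td mT]]] := min_translation bg.
have [ep em] := translation_fix dg td T1.
exists d, T; split=> //; split; last by exists g.
move=> b k e; have [U U1 tb] := primitive_translation dg td T1 e.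
have := translationX k tb; rewrite -e => /(translation_uniq dg td) eT.
have := mT _ _ tb U1; rewrite eT.
case: k {e} eT => [eT|[//|k] eT]; first by move: T1; rewrite eT expr0 ltxx.
by rewrite leNgt -[X in X < _]expr1 ltr_eXn2l.
Qed.

(** Both are the shortest translation [d]: if [T ^+ k <= U < T ^+ k.+1], then [c d^-k] translates by
    [U / T ^+ k], which minimality forces to be 1. So [c] is a power of [d], and primitivity makes
    the exponent 1. *)
Lemma peripheral_uniq g a b : boundary_geodesic (ucov S) g ->
  peripheral S a -> fixm S a = bmob g (fin 0) -> fixp S a = bmob g (infty R) ->
  peripheral S b -> fixm S b = bmob g (fin 0) -> fixp S b = bmob g (infty R) ->
  a = b.
Proof.
move=> bg; have [dg _ _] := bg; have [d [T [T1 td mT]]] := min_translation bg.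
have T0 : 0 < T := lt_trans ltr01 T1.
suff H c : peripheral S c -> fixm S c = bmob g (fin 0) ->
    fixp S c = bmob g (infty R) -> c = d.
  by move=> pa a1 a2 pb b1 b2; rewrite (H a) // (H b).
move=> [pc _] em ep; have [U U1 tc] := fix_translation bg em ep.
have [k kU] : exists k, T ^+ k <= U < T ^+ k.+1.
  have ex : exists k, U < T ^+ k := exprn_unbounded U T1.
  case: (ex_minnP ex) => -[|k] Uk mk.
    by move: Uk; rewrite expr0 ltNge (ltW U1).
  by exists k; rewrite Uk andbT leNgt; apply/negP => /mk; rewrite ltnn.
have tr := translationM tc (translationV (translationX k td)).
have := mT _ _ tr; have Tk : 0 < T ^+ k by rewrite exprn_gt0.
rewrite ltr_pdivlMr // mul1r ler_pdivlMr // -exprS.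
case/andP: kU; rewrite le_eqVlt => /orP[/eqP Uk _ _|Uk kU /(_ Uk)]; last first.
  by rewrite leNgt kU.
have e : c = (d ^+ k)%g.
  by apply: (translation_inj bg tc); rewrite -Uk; exact: translationX.
by rewrite e (pc _ _ e) expg1.
Qed.

Lemma peripheral_conj a d : peripheral S d ->
  [/\ peripheral S (a * d * a^-1)%g,
      fixp S (a * d * a^-1)%g = bmob (hol S a) (fixp S d) &
      fixm S (a * d * a^-1)%g = bmob (hol S a) (fixm S d)].
Proof.
move=> [pd [g [bg em ep]]]; have [dg _ _] := bg; have da := det_hol S a.
have [T T1 td] := fix_translation bg em ep.
have bag := boundary_geodesic_hol a bg; have [dag _ _] := bag.
have tr : translation S (hol S a *m g) (a * d * a^-1)%g T.
  have [_ mS] := hol_psl S.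
  have [T0 eT] := td; split=> //.
  have : hol S (a * d * a^-1)%g *m hol S a = hol S a *m hol S d \/
      hol S (a * d * a^-1)%g *m hol S a = - (hol S a *m hol S d).
    case: (mS (a * d * a^-1)%g a) (mS a d); rewrite mulgVK => -> [e|e];
      rewrite ?e ?opprK; [by left|by right| |].
    - by right; rewrite -e opprK.
    - by left; rewrite -[LHS]opprK e opprK.
  rewrite mulmxA -(mulmxA (hol S a)).
  by case: eT => e [] ->; rewrite ?mulNmx -mulmxA e ?mulmxN ?opprK;
    [left|right|right|left].
have [e1 e2] := translation_fix dag tr T1.
rewrite e1 e2 em ep !bmobM //; split=> //; split.
  move=> b k e; apply: (pd (a^-1 * b * a)%g).
  have -> : ((a^-1 * b * a) ^+ k)%g = (a^-1 * b ^+ k * a)%g.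
    elim: (k) => [|m IH]; first by rewrite !expg0 mulg1 mulVg.
    by rewrite expgSr IH expgSr -!mulgA mulVKg !mulgA.
  by rewrite -e !mulgA mulVg mul1g mulgVK.
by exists (hol S a *m g); rewrite e1 e2.
Qed.

(** Along the orbit of [g (i)] under powers of [d], the side function of [h] is up to positive
    factors [r T^(4k) + v], and r > 0 expresses that the end point lies in the open arc of [h].
    Negative powers serve for the end [g (0)]. *)
Lemma fix_limit_set g d T : boundary_geodesic (ucov S) g -> translation S g d T ->
  1 < T -> limit_set S (bmob g (fin 0)) /\ limit_set S (bmob g (infty R)).
Proof.
move=> bg td T1; have [dg _ _] := bg.
have T0 : 0 < T := lt_trans ltr01 T1.
have u : upper ((0, 1) : R * R) by rewrite /upper /=.
have ug : upper (mob g (0, 1)) by exact: mob_upper.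
have orb h b U : \det h = 1 -> translation S g b U ->
   0 <= (inv2 h *m g) 0 0 * (inv2 h *m g) 1 0 * (U ^+ 2) ^+ 2 +
     (inv2 h *m g) 0 1 * (inv2 h *m g) 1 1 ->
   right_side h (mob (hol S b) (mob g (0, 1))).
  move=> dh tb Hs; rewrite (translation_mob dg tb) // mulr0 mulr1.
  have U2 : upper ((0, U ^+ 2) : R * R) by rewrite /upper /= exprn_gt0 //; case: tb.
  apply/right_sideP => //; split; first exact: mob_upper.
  rewrite side_mob // divr_ge0 ?(ltW (mobN_gt0 _ _)) //.
  suff -> : side (inv2 g *m h) (0, U ^+ 2) =
      (inv2 h *m g) 0 0 * (inv2 h *m g) 1 0 * (U ^+ 2) ^+ 2 +
     (inv2 h *m g) 0 1 * (inv2 h *m g) 1 1 by [].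
  by rewrite /side ?(mulmx2E, mx2E) /=; ring.
have pow (r v : R) : 0 < r -> exists k, 0 <= r * ((T ^+ k) ^+ 2) ^+ 2 + v.
  move=> r0; have [k Hk] := exprn_unbounded (`|v| / r) T1; exists k.
  have Tk : 1 <= T ^+ k by rewrite exprn_ege1 // ltW.
  move: Hk; rewrite ltr_pdivrMr // => Hk.
  have : T ^+ k <= ((T ^+ k) ^+ 2) ^+ 2.
    by rewrite -exprM -[X in X <= _]expr1 ler_weXn2l.
  rewrite -(ler_pM2l r0) => H2.
  have := ler_norm (- v); rewrite normrN; lra.
have area_rep h x X : \det h = 1 -> rep x X ->
    positive3 (bmob h (fin 0)) x (bmob h (infty R)) ->
    0 < (inv2 h *m X) 0 0 * (inv2 h *m X) 1 0.
  move=> dh rX.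
  have -> := positive3_rep (rep_bmob0 dh) rX (rep_bmoby dh).
  have -> : area (col 1 h) X = - (inv2 h *m X) 0 0.
    by rewrite /area mulmx2E !mx2E !mxE; ring.
  have -> : area X (col 0 h) = - (inv2 h *m X) 1 0.
    by rewrite /area mulmx2E !mx2E !mxE; ring.
  have -> : area (col 0 h) (col 1 h) = 1.
    by rewrite /area !mxE (det1E dh); ring.
  by rewrite mulrNN mulr1.
split; exists (mob g (0, 1)) => // h dh p.
- have := area_rep _ _ _ dh (rep_bmob0 dg) p.
  set v := _ * _ => v0.
  have [k Hk] := pow v ((inv2 h *m g) 0 0 * (inv2 h *m g) 1 0) v0.
  exists (d ^+ k)^-1%g; apply: (orb h _ (T ^+ k)^-1) => //.
    exact: translationV (translationX k td).
  have Tk : 0 < T ^+ k by rewrite exprn_gt0.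
  have : 0 <= (((T ^+ k)^-1) ^+ 2) ^+ 2 by rewrite sqr_ge0.
  move: Hk => /[swap] i0 /(mulr_ge0 i0).
  congr (is_true (0 <= _)); rewrite /v !mulmx2E !mxE; field; exact: lt0r_neq0.
- have := area_rep _ _ _ dh (rep_bmoby dg) p.
  set v := _ * _ => v0.
  have [k Hk] := pow v ((inv2 h *m g) 0 1 * (inv2 h *m g) 1 1) v0.
  exists (d ^+ k)%g; apply: (orb h _ (T ^+ k)) => //.
    exact: translationX k td.
  by move: Hk; congr (is_true (0 <= _)); rewrite /v !mulmx2E !mxE; ring.
Qed.

End Peripheral.

(** * Gaps of the limit set *)

Section Gaps.
Variables (R : realType) (G : groupType) (S : surface R G).
Implicit Types (g h k m : 'M[R]_2) (w : R * R) (x y q : bdH R) (X Y Z : 'cV[R]_2)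
  (a b d : G) (C : set (R * R)).

Lemma peripheral_limit_set d : peripheral S d ->
  limit_set S (fixp S d) /\ limit_set S (fixm S d).
Proof.
move=> [_ [g [bg em ep]]]; have [T T1 td] := fix_translation bg em ep.
by rewrite em ep; have [] := fix_limit_set bg td T1.
Qed.

Lemma peripheral_gap d x : peripheral S d -> limit_set S x ->
  ~ positive3 (fixp S d) x (fixm S d).
Proof.
move=> [_ [g [bg -> ->]]] Lx; have [dg _ _] := bg.
have := limit_set_side bg Lx (rep_hcoord x).
have -> := positive3_rep (rep_bmoby dg) (rep_hcoord x) (rep_bmob0 dg).
set X := hcoord x.
have -> : area X (col 1 g) = (inv2 g *m X) 0 0.
  by rewrite /area mulmx2E !mx2E !mxE; ring.
have -> : area (col 0 g) X = (inv2 g *m X) 1 0.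
  by rewrite /area mulmx2E !mx2E !mxE; ring.
have -> : area (col 1 g) (col 0 g) = - 1.
  by rewrite /area !mxE [X in _ - X]mulrC (det1E dg); ring.
by rewrite mulrN1 oppr_gt0 mulrC => h1 /lt_le_trans /(_ h1); rewrite ltxx.
Qed.

Lemma side_touch m z : \det m = 1 -> upper z -> 0 < z.1 -> side m z = 0 ->
  ~ (forall w, upper w -> 0 <= w.1 -> 0 <= side m w).
Proof.
move=> dm z0 z1 s0 Hs; pose C : set (R * R) := [set w | upper w /\ 0 <= w.1].
have iz : interior C z.
  apply/nbhs_ballP; exists (Num.min z.1 z.2); first by rewrite /= lt_min z1 z0.
  move=> w [b1 b2]; move: b1 b2; rewrite -!ball_normE /= !lt_min.
  move=> /andP[b1 _] /andP[_ b2].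
  have := ler_norm (z.1 - w.1); have := ler_norm (z.2 - w.2).
  by move=> h1 h2; split; rewrite ?/upper /=; lra.
have := interior_side_gt0 dm z0 iz; rewrite s0 ltxx => H.
by suff : false by []; apply: H => w [w0 w1]; exact: Hs.
Qed.

(** The same completion of the square as in [half_disc_escape], at height 1. *)
Lemma cosh_dist_escape (E r u v : R) : 0 <= E -> r = E + 3 ->
  (r - u) ^+ 2 + (1 - v) ^+ 2 <= E * v -> 0 < u.
Proof.
move=> E0 -> cE; rewrite ltNge; apply/negP => n1.
have h1 : 0 <= (E + 3 - u) ^+ 2 - (E + 3) ^+ 2.
  rewrite subr_ge0 ler_pXn2r ?nnegrE //; lra.
have h2 := sqr_ge0 ((E + 2) / 2 - v).
have h3 : 0 < (E + 3) ^+ 2 - ((E + 2) / 2) ^+ 2 by nra.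
lra.
Qed.

(** A half-plane contains arbitrarily large hyperbolic balls, whereas cocompactness puts every point
    of the universal cover at bounded distance from a translate of a given boundary point. A
    boundary geodesic would thus enter the interior of a half-plane lying on one side of it. *)
Lemma right_side_not_ucov k : \det k = 1 -> exists2 w, right_side k w & ~ ucov S w.
Proof.
move=> dk; apply: contrapT => nw.
have rC w : upper w -> 0 <= w.1 -> ucov S (mob k w).
  move=> w0 w1; apply: contrapT => nC; apply: nw; exists (mob k w) => //.
  by exists w.
have [g bg] := ucov_boundary_neq0 S; have [dg _ _] := bg.
have [K [cK KC Kt]] := hol_cocompact S.
have [M M0 KM] := compact_upper_bound cK (subset_trans KC (@ucov_upper _ _ S)).
have u : upper ((0, 1) : R * R) by rewrite /upper /=.
pose p := mob g (0, 1).
have up : upper p by exact: mob_upper.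
pose E := ((M + `|p.1|) ^+ 2 + (M + `|p.2|) ^+ 2) * (M / p.2).
have KE z : K z -> cosh_dist z p <= E.
  move=> /KM[z1 z2 z3]; have z20 : 0 < z.2 by rewrite -(pmulr_rgt0 _ M0) (lt_trans ltr01).
  rewrite /cosh_dist ler_pM ?addr_ge0 ?sqr_ge0 ?invr_ge0 ?mulr_ge0 ?(ltW z20) ?(ltW up) //.
    have n (r s : R) : `|r| < M -> (r - s) ^+ 2 <= (M + `|s|) ^+ 2.
      move=> rM; rewrite -real_normK ?num_real // ler_pXn2r ?nnegrE ?addr_ge0 ?(ltW M0) //.
      by rewrite (le_trans (ler_normB _ _)) // lerD // ltW.
    by apply: lerD; apply: n => //; rewrite gtr0_norm.
  rewrite invfM ler_pM2r ?invr_gt0 // -[X in X <= _]mul1r ler_pdivrMr //; exact: ltW.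
have E0 : 0 <= E.
  by rewrite mulr_ge0 ?addr_ge0 ?sqr_ge0 // divr_ge0 ?(ltW M0) ?(ltW up).
pose r := E + 3.
have ur : upper ((r, 1) : R * R) by rewrite /upper /=.
have ukr : upper (mob k (r, 1)) by exact: mob_upper.
have [a Ka] : exists a, K (mob (hol S a) (mob k (r, 1))).
  by apply: Kt; apply: rC => //=; rewrite /r addr_ge0.
have dha := det_hol S a.
pose p' := mob (hol S a^-1%g) p.
have dV := det_hol S a^-1%g.
have up' : upper p' by exact: mob_upper.
have dik : \det (inv2 k) = 1 by rewrite det_inv2.
pose p'' := mob (inv2 k) p'.
have up'' : upper p'' by exact: mob_upper.
have : cosh_dist (r, 1) p'' <= E.
  rewrite -(cosh_dist_mob dk) // mobVK // -(cosh_dist_mob dha) // hol_mobVK //.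
  exact: KE.
rewrite {1}/cosh_dist mul1r ler_pdivrMr // => cE.
have p1 : 0 < p''.1 := cosh_dist_escape E0 erefl cE.
have bg' := boundary_geodesic_hol a^-1%g bg; have [dg' _ _] := bg'.
have [_ Cs] := iffLR (boundary_geodesicP dg' (@ucov_upper _ _ S)) bg'.
have dm : \det (inv2 k *m (hol S a^-1%g *m g)) = 1 by rewrite det_mulmx dik mul1r.
apply: (side_touch dm up'' p1).
  apply: (mulIf (invr_neq0 (lt0r_neq0 (mobN_gt0 dk up'')))).
  rewrite -side_mob // mobVK // mul0r side_mulmx // side_mob_id //.
  by rewrite !mul0r.
move=> w w0 w1; have := Cs _ (rC _ w0 w1).
by rewrite side_mob // pmulr_lge0 // invr_gt0 mobN_gt0.
Qed.

(** Here [m] is a geodesic with 0 and infinity in the closed arc to its right but a point [v] of the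
    right half-plane to its left. This forces [m 0 1 * m 1 0 < 0]; the conclusions locate the ends
    of [m] relative to 0, -1 and infinity. *)
Lemma crossing_entries m v : \det m = 1 -> upper v -> 0 <= v.1 -> side m v < 0 ->
  m 0 1 * m 0 0 <= 0 -> m 1 1 * m 1 0 <= 0 ->
  [/\ 0 < m 0 1 * (m 0 1 + m 1 1), 0 < m 1 0 * (m 0 0 + m 1 0) &
      0 < - ((m 0 1 + m 1 1) * (m 0 0 + m 1 0))].
Proof.
move=> /det1E dE; rewrite /upper /side /= => v0 v1 sm s1 s2.
move: (m 0 0) (m 0 1) (m 1 0) (m 1 1) dE sm s1 s2 => a b c d dE sm s1 s2.
have sS : a * d + b * c < 0.
  rewrite ltNge; apply/negP => sS; move: sm; apply/negP; rewrite -leNgt.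
  have h1 : 0 <= - (c * d) * (v.1 ^+ 2 + v.2 ^+ 2).
    by rewrite mulr_ge0 ?addr_ge0 ?sqr_ge0 // oppr_ge0 mulrC.
  have h2 : 0 <= (a * d + b * c) * v.1 by rewrite mulr_ge0.
  by rewrite mulrC in s1; lra.
have n01 : b * c < 0 by lra.
have b0 : b != 0 by apply: contraTneq n01 => ->; rewrite mul0r ltxx.
have c0 : c != 0 by apply: contraTneq n01 => ->; rewrite mulr0 ltxx.
have b2 : 0 < b ^+ 2 by rewrite exprn_even_gt0.
have c2 : 0 < c ^+ 2 by rewrite exprn_even_gt0.
have p01 : 0 <= b * d.
  have : 0 <= b * d * c ^+ 2.
    by rewrite (_ : _ * _ = (b * c) * (d * c)); [exact: mulr_le0 (ltW _) _|ring].
  by rewrite pmulr_lge0.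
have p10 : 0 <= a * c.
  have : 0 <= a * c * b ^+ 2.
    by rewrite (_ : _ * _ = (b * c) * (b * a)); [exact: mulr_le0 (ltW _) _|ring].
  by rewrite pmulr_lge0.
split; lra.
Qed.

(** Some point of the half-plane over the arc from [x] to [z] lies outside the universal cover, and
    a boundary geodesic separating it cuts out the gap. The gap may end at [x] or [z]; the
    conclusions are stated as open conditions, compared with [q], so that they persist when the
    triple is perturbed. That the gap lies between [x] and [z] is recovered later from its
    containing no limit point. *)
Lemma gap_exists x z q : limit_set S x -> limit_set S z -> limit_set S q ->
  positive3 x z q -> exists d, [/\ peripheral S d, positive3 x (fixm S d) q,
    positive3 q (fixp S d) z & positive3 (fixp S d) (fixm S d) q].
Proof.
move=> Lx Lz Lq /positive3_rot /positive3_exists[h [dh h0 h1 hy]].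
(* The rotation sends 0, infinity and -1 to [x], [z] and [q]: the right side of [k] is the
   half-plane over the arc from [x] to [z]. *)
pose k := h *m mx2 0 (-1) 1 0.
have dk : \det k = 1 by rewrite det_mulmx dh det2E !mx2E; ring.
have c1 : col 1 k = - col 0 h.
  by apply: cV2P; rewrite mxE mulmx2E !mx2E !mxE; ring.
have c0 : col 0 k = col 1 h.
  by apply: cV2P; rewrite mxE mulmx2E !mx2E !mxE; ring.
have rx : rep x (col 1 k).
  by rewrite c1 -scaleN1r; apply: repZ; rewrite ?oppr_eq0 ?oner_neq0 // -hy; exact: rep_bmoby.
have rz : rep z (col 0 k) by rewrite c0 -h0; exact: rep_bmob0.
have rq : rep q (col 0 k - col 1 k).
  rewrite c0 c1 opprK -h1; have := rep_bmob dh (rep_hcoord (fin 1)); congr rep.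
  by apply: cV2P; rewrite mulmx2E !mxE /= !mulr1 addrC.
have [w /(right_sideP _ dk)[w0 kw] nw] := right_side_not_ucov dk.
have [g bg gw] := ucov_separation w0 nw; have [dg _ _] := bg.
have [d [T [pd T1 td ep em]]] := peripheral_exists bg.
pose m := inv2 k *m g; have em' : g = k *m m by rewrite /m mulmxA mulmxV2 // mul1mx.
have dm : \det m = 1 by rewrite det_mulmx det_inv2 dk dg mulr1.
clearbody m.
have uk : upper (mob (inv2 k) w) by apply: mob_upper; rewrite ?det_inv2.
have w1 : 0 <= (mob (inv2 k) w).1.
  move: kw; rewrite -{1}(mobVK dk w0) side_mob_id // pmulr_lge0 //.
  by rewrite invr_gt0 mobN_gt0.
have sm : side m (mob (inv2 k) w) < 0.
  move: gw; rewrite -{1}(mobVK dk w0) em' side_mulmx // pmulr_llt0 //.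
  by rewrite invr_gt0 mobN_gt0.
have ik : inv2 g *m k = inv2 m.
  rewrite em'; have -> : inv2 (k *m m) = inv2 m *m inv2 k.
    by apply: mx2P; rewrite ?(mulmx2E, mx2E); ring.
  by rewrite -mulmxA mulVmx2 // mulmx1.
have colk j : inv2 g *m col j k = col j (inv2 m).
  by rewrite -ik; apply/matrixP => i l; rewrite !mxE; apply: eq_bigr => ? _; rewrite !mxE.
have := limit_set_side bg Lx rx; have := limit_set_side bg Lz rz.
rewrite !colk ![col _ _ _ _]mxE !mx2E mulrN mulNr !oppr_ge0 => s1 s2.
have [p1 p2 p3] := crossing_entries dm uk w1 sm s2 s1.
have rb : rep (bmob g (fin 0)) (k *m col 1 m).
  have := rep_bmob0 dg; congr rep; rewrite em'.
  by apply: cV2P; rewrite mxE !mulmx2E !mxE.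
have ra : rep (bmob g (infty R)) (k *m col 0 m).
  have := rep_bmoby dg; congr rep; rewrite em'.
  by apply: cV2P; rewrite mxE !mulmx2E !mxE.
have eX : col 1 k = k *m hcoord (fin 0) by rewrite mulmx_hcoord0.
have eZ : col 0 k = k *m hcoord (infty R) by rewrite mulmx_hcoord_infty.
rewrite eX eZ -mulmxBr in rx rz rq.
exists d; rewrite ep em; split=> //.
- apply/(positive3_rep rx rb rq); rewrite !areaM dk /area !mxE /=.
  by move: p1; congr (is_true (0 < _)); ring.
- apply/(positive3_rep rq ra rz); rewrite !areaM dk /area !mxE /=.
  by move: p2; congr (is_true (0 < _)); ring.
- apply/(positive3_rep ra rb rq); rewrite !areaM dk /area !mxE /=.
  have -> : m 0 0 * m 1 1 - m 1 0 * m 0 1 = 1 by rewrite (det1E dm); ring.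
  by move: p3; congr (is_true (0 < _)); ring.
Qed.

(** Homogeneous coordinates treat infinity like any other point. In both cases [e <= |c| / 2] keeps
    the relevant coordinate of [Y] away from 0. *)
Lemma nbhs_rep x X (U : set (bdH R)) : nbhs x U -> rep x X -> exists2 e : R, 0 < e &
  forall y Y, rep y Y -> (forall i, `|X i 0 - Y i 0| < e) -> U y.
Proof.
move=> Ux [c c0 ->]; have cn : 0 < `|c| by rewrite normr_gt0.
have cn2 : 0 < `|c| / 2 by rewrite divr_gt0.
case: x Ux => [u|] Ux.
  have /nbhs_ballP[r /= r0 rU] : nbhs u [set v | U (Some v)] by exact: Ux.
  pose e := Num.min (`|c| / 2) (r * (`|c| / 2) / (1 + `|u|)).
  have u1 : 0 < 1 + `|u| by rewrite ltr_pwDl.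
  have e0 : 0 < e by rewrite lt_min cn2 divr_gt0 // mulr_gt0.
  exists e => // y Y ry near.
  have := near 0; have := near 1; rewrite !mxE /= mulr1 => n1 n0.
  have e1 : e <= `|c| / 2 by rewrite ge_min lexx.
  have e2 : e * (1 + `|u|) <= r * (`|c| / 2) by rewrite -ler_pdivlMr // ge_min lexx orbT.
  have Y1 : `|c| / 2 < `|Y 1 0|.
    have := ler_distD (Y 1 0) c 0; rewrite !subr0; lra.
  have Yn : Y 1 0 != 0 by rewrite -normr_gt0; lra.
  have Y1p : 0 < `|Y 1 0| by rewrite normr_gt0.
  have -> : y = fin (Y 0 0 / Y 1 0).
    apply: (rep_inj ry); exists (Y 1 0) => //.
    by apply: cV2P; rewrite !mxE /= ?mulr1 // mulrC divfK.
  apply: rU; rewrite -ball_normE /=.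
  have -> : u - Y 0 0 / Y 1 0 = (u * (Y 1 0 - c) + (c * u - Y 0 0)) / Y 1 0.
    by field.
  rewrite normrM normfV ltr_pdivrMr //.
  have h1 : `|u * (Y 1 0 - c) + (c * u - Y 0 0)| < e * (1 + `|u|).
    apply: le_lt_trans (ler_normD _ _) _.
    rewrite [X in _ < X]mulrDr mulr1 addrC ltr_leD //.
    by rewrite normrM mulrC distrC ler_wpM2r // ltW.
  apply: (lt_le_trans h1); apply: (le_trans e2).
  by rewrite ler_pM2l // ltW.
have [K [cK _] KU] : filter_from (compact `&` closed)
    (fun K : set R => (Some @` (~` K)) `|` [set None]) U by exact: Ux.
have [B [Br BK]] := compact_bounded cK.
pose b := `|B| + 1.
have b0 : 0 < b by rewrite ltr_wpDl.
pose e := Num.min (`|c| / 2) (`|c| / 2 / b).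
have e0 : 0 < e by rewrite lt_min cn2 divr_gt0.
exists e => // y Y ry near.
have := near 0; have := near 1; rewrite ![(_ *: hcoord _) _ _]mxE !hcoordE mulr0 mulr1
  sub0r normrN => n1 n0.
have e1 : e <= `|c| / 2 by rewrite ge_min lexx.
have e2 : e * b <= `|c| / 2 by rewrite -ler_pdivlMr // ge_min lexx orbT.
have Y0 : `|c| / 2 < `|Y 0 0|.
  have := ler_distD (Y 0 0) c 0; rewrite !subr0; lra.
apply: KU; have [Y1|Yn] := eqVneq (Y 1 0) 0.
  right; apply: (rep_inj ry); exists (Y 0 0).
    by rewrite -normr_gt0; lra.
  by apply: cV2P; rewrite !mxE /= ?mulr1 ?mulr0.
left; exists (Y 0 0 / Y 1 0).
  have Y1p : 0 < `|Y 1 0| by rewrite normr_gt0.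
  have Bb : B < b by rewrite (le_lt_trans (ler_norm B)) // ltrDl.
  move=> /(BK _ Bb) /=; rewrite normrM normfV ler_pdivrMr //.
  apply/negP; rewrite -ltNge; apply: le_lt_trans Y0; apply: le_trans e2.
  by rewrite mulrC ler_pM2r // ltW.
apply: (rep_inj _ ry); exists (Y 1 0) => //.
by apply: cV2P; rewrite !mxE /= ?mulr1 // mulrC divfK.
Qed.

Definition mx4 (p : (R * R) * (R * R)) : 'M[R]_2 := mx2 p.1.1 p.1.2 p.2.1 p.2.2.

Lemma mx4_cvg p i j : (fun p => mx4 p i j) @ p --> mx4 p i j.
Proof.
have c1 : (fun p : (R * R) * (R * R) => p.1) @ p --> p.1 by exact: cvg_fst.
have c2 : (fun p : (R * R) * (R * R) => p.2) @ p --> p.2 by exact: cvg_snd.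
move: i j; apply: ord2P; apply: ord2P; rewrite mx2E.
- under eq_fun do rewrite mx2E.
  exact: (cvg_comp _ _ c1 cvg_fst).
- under eq_fun do rewrite mx2E.
  exact: (cvg_comp _ _ c1 cvg_snd).
- under eq_fun do rewrite mx2E.
  exact: (cvg_comp _ _ c2 cvg_fst).
- under eq_fun do rewrite mx2E.
  exact: (cvg_comp _ _ c2 cvg_snd).
Qed.

Lemma mx4_mul_cvg p X i : (fun p => (mx4 p *m X) i 0) @ p --> (mx4 p *m X) i 0.
Proof.
rewrite mulmx2E; under eq_fun do rewrite mulmx2E.
by apply: cvgD; apply: cvgM; (exact: mx4_cvg || exact: cvg_cst).
Qed.

Lemma area_cvg (I : topologicalType) (X Y : I -> 'cV[R]_2) (p : I) :
  (forall i, (fun p => X p i 0) @ p --> X p i 0) ->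
  (forall i, (fun p => Y p i 0) @ p --> Y p i 0) ->
  (fun p => area (X p) (Y p)) @ p --> area (X p) (Y p).
Proof. by move=> cX cY; apply: cvgB; apply: cvgM. Qed.

Lemma mx4_nbhs p x (U : set (bdH R)) : \det (mx4 p) = 1 -> nbhs (bmob (mx4 p) x) U ->
  \forall p' \near p, \det (mx4 p') = 1 -> U (bmob (mx4 p') x).
Proof.
move=> dp Ux; have [e e0 He] := nbhs_rep Ux (rep_bmob dp (rep_hcoord x)).
have c0 := @mx4_mul_cvg p (hcoord x) 0; have c1 := @mx4_mul_cvg p (hcoord x) 1.
near=> p' => dp'; apply: (He _ _ (rep_bmob dp' (rep_hcoord x))).
apply: ord2P; near: p'; exact: cvgr_dist_lt.
Unshelve. all: by end_near. Qed.

Lemma mx4_positive3 p (X Y Z : (R * R) * (R * R) -> 'cV[R]_2) :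
  (forall i, (fun p => X p i 0) @ p --> X p i 0) ->
  (forall i, (fun p => Y p i 0) @ p --> Y p i 0) ->
  (forall i, (fun p => Z p i 0) @ p --> Z p i 0) ->
  0 < area (X p) (Y p) * area (Y p) (Z p) * area (Z p) (X p) ->
  \forall p' \near p, 0 < area (X p') (Y p') * area (Y p') (Z p') * area (Z p') (X p').
Proof.
move=> cX cY cZ p0.
have c : (fun p => area (X p) (Y p) * area (Y p) (Z p) * area (Z p) (X p)) @ p -->
    area (X p) (Y p) * area (Y p) (Z p) * area (Z p) (X p).
  by apply: cvgM; [apply: cvgM|]; exact: area_cvg.
exact: (cvgr_gt _ c).
Qed.

Lemma mx4_limit_set p x : \det (mx4 p) = 1 -> ~ limit_set S (bmob (mx4 p) x) ->
  \forall p' \near p, \det (mx4 p') = 1 -> ~ limit_set S (bmob (mx4 p') x).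
Proof.
move=> dp /limit_set_closed[g [dg pg Hg]].
have r p' (dp' : \det (mx4 p') = 1) := rep_bmob dp' (rep_hcoord x).
have r0 := rep_bmob0 dg; have ry := rep_bmoby dg.
have := @mx4_positive3 p (fun=> col 1 g) (fun p => mx4 p *m hcoord x) (fun=> col 0 g).
move=> /(_ (fun=> cvg_cst _) (@mx4_mul_cvg p _) (fun=> cvg_cst _)).
move/(positive3_rep r0 (r p dp) ry): pg => /[swap] /[apply].
apply: filterS => p' pp' dp'; apply: Hg.
exact/(positive3_rep r0 (r p' dp') ry).
Qed.

(** The relation [T] stands for the bound on five Lagrangians; only monotonicity, invariance and
    local boundedness matter. Triples are parametrized by matrices, the group brings any of them
    into a compact set of matrices, and there the local bounds become uniform. *)
Lemma uniform_gap (T : R -> bdH R -> bdH R -> bdH R -> bdH R -> bdH R -> Prop) :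
  (forall M N x z q y t, M <= N -> T M x z q y t -> T N x z q y t) ->
  (forall a M x z q y t, limit_set S x -> limit_set S z -> limit_set S q ->
    limit_set S y -> limit_set S t -> T M x z q y t ->
    T M (bmob (hol S a) x) (bmob (hol S a) z) (bmob (hol S a) q)
        (bmob (hol S a) y) (bmob (hol S a) t)) ->
  (forall x z q y t, limit_set S x -> limit_set S z -> limit_set S q ->
    limit_set S y -> limit_set S t -> positive3 x z q -> positive3 x t q ->
    positive3 q y z -> positive3 y t q ->
    exists M (U V W : set (bdH R)), [/\ nbhs x U, nbhs z V, nbhs q W &
      forall x' z' q', limit_set S x' -> limit_set S z' -> limit_set S q' ->
        U x' -> V z' -> W q' -> T M x' z' q' y t]) ->
  exists M, forall x z q, limit_set S x -> limit_set S z -> limit_set S q ->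
    positive3 x z q -> exists d, [/\ peripheral S d, positive3 x (fixm S d) q,
      positive3 q (fixp S d) z, positive3 (fixp S d) (fixm S d) q &
      T M x z q (fixp S d) (fixm S d)].
Proof.
move=> Tmono Tinv Tloc.
pose P M p := \det (mx4 p) = 1 -> forall x z q,
  x = bmob (mx4 p) (fin 0) -> z = bmob (mx4 p) (fin 1) ->
  q = bmob (mx4 p) (infty R) ->
  limit_set S x -> limit_set S z -> limit_set S q ->
  exists d, [/\ peripheral S d, positive3 x (fixm S d) q,
      positive3 q (fixp S d) z, positive3 (fixp S d) (fixm S d) q &
      T M x z q (fixp S d) (fixm S d)].
have Ploc p : \det (mx4 p) = 1 -> \forall p' \near p & M \near +oo, P M p'.
  move=> dp.
  suff [M0 HM] : exists M0, \forall p' \near p, P M0 p'.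
    exists ([set p' | P M0 p'], [set M | M0 <= M]).
      by split=> //=; apply: nbhs_pinfty_ge; exact: num_real.
    move=> [p' M] /= [PM0 MM] dp' x z q ex ez eq Lx Lz Lq.
    have [d [h1 h2 h3 h4 h5]] := PM0 dp' x z q ex ez eq Lx Lz Lq.
    by exists d; split=> //; exact: Tmono h5.
  set x0 := bmob (mx4 p) (fin 0); set z0 := bmob (mx4 p) (fin 1).
  set q0 := bmob (mx4 p) (infty R).
  (* Where one of the three points is not a limit point, closedness of the limit set makes the claim
     vacuous nearby. *)
  have [Lx|nLx] := pselect (limit_set S x0); last first.
    exists 0; have := mx4_limit_set dp nLx; apply: filterS => p' np dp' x z q -> _ _.
    by move=> /(np dp').
  have [Lz|nLz] := pselect (limit_set S z0); last first.
    exists 0; have := mx4_limit_set dp nLz; apply: filterS => p' np dp' x z q _ -> _ _.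
    by move=> /(np dp').
  have [Lq|nLq] := pselect (limit_set S q0); last first.
    exists 0; have := mx4_limit_set dp nLq; apply: filterS => p' np dp' x z q _ _ -> _ _.
    by move=> /(np dp').
  have xzq : positive3 x0 z0 q0.
    by rewrite positive3_bmob // /positive3 /= ltr01.
  have [d [pd d1 d2 d3]] := gap_exists Lx Lz Lq xzq.
  have [La Lb] := peripheral_limit_set pd.
  have [M [U [V [W [Ux Vz Wq HT]]]]] := Tloc _ _ _ _ _ Lx Lz Lq La Lb xzq d1 d2 d3.
  exists M.
  have r p' (dp' : \det (mx4 p') = 1) x := rep_bmob dp' (rep_hcoord x).
  have cX x i := @mx4_mul_cvg p (hcoord x) i.
  have cc X i : (fun=> X i 0) @ p --> X i 0 by exact: cvg_cst.
  have rb := rep_hcoord (fixm S d); have ra := rep_hcoord (fixp S d).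
  move/(positive3_rep (r p dp _) rb (r p dp _)): (d1) => n1.
  move/(positive3_rep (r p dp _) ra (r p dp _)): (d2) => n2.
  move/(positive3_rep ra rb (r p dp _)): (d3) => n3.
  have {}n1 := mx4_positive3 (cX _) (cc _) (cX _) n1.
  have {}n2 := mx4_positive3 (cX _) (cc _) (cX _) n2.
  have {}n3 := mx4_positive3 (cc _) (cc _) (cX _) n3.
  have nU := mx4_nbhs dp Ux; have nV := mx4_nbhs dp Vz; have nW := mx4_nbhs dp Wq.
  near=> p' => dp' x z q ex ez eq Lx' Lz' Lq'.
  exists d; split=> //.
  - rewrite ex eq; apply/(positive3_rep (r p' dp' _) rb (r p' dp' _)).
    by near: p'.
  - rewrite ez eq; apply/(positive3_rep (r p' dp' _) ra (r p' dp' _)).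
    by near: p'.
  - rewrite eq; apply/(positive3_rep ra rb (r p' dp' _)).
    by near: p'.
  - by apply: HT => //; rewrite ?ex ?ez ?eq; move: dp'; near: p'.
have [K [cK KC Kt]] := hol_cocompact S.
have [B B0 HB] := mob_bound cK (subset_trans KC (@ucov_upper _ _ S)).
pose I := `[- B, B]%classic : set R.
pose D := ((I `*` I) `*` (I `*` I)) `&` [set p | \det (mx4 p) = 1].
have cD : compact D.
  apply: compact_closedI.
    by apply: compact_setX; apply: compact_setX; exact: segment_compact.
  have -> : [set p | \det (mx4 p) = 1] = (fun p => \det (mx4 p)) @^-1` [set 1].
    by [].
  apply: closed_comp; last exact: closed_eq.
  move=> p _; rewrite /continuous_at det2E; under eq_fun do rewrite det2E.
  by apply: cvgB; apply: cvgM; exact: mx4_cvg.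
have [M [_ MP]] : \forall M \near +oo, D `<=` P M.
  by apply: (iffLR (compact_near_coveringP D) cD) => p [_ dp]; exact: Ploc.
have {}MP : D `<=` P (M + 1) by apply: MP; rewrite ltrDl.
exists (M + 1) => x z q Lx Lz Lq /[dup] xzq /positive3_exists[h [dh h0 h1 hy]].
have [|a Ka] := Kt (mob h (0, 1)).
  by apply: ucov_geodesic; rewrite ?h0 ?hy.
have da := det_hol S a.
have dah : \det (hol S a *m h) = 1 by rewrite det_mulmx da dh mulr1.
have u : upper ((0, 1) : R * R) by rewrite /upper /=.
have bh i j : I ((hol S a *m h) i j).
  by rewrite /I /= in_itv /= -ler_norml; apply: HB => //; rewrite mobM.
pose p := (((hol S a *m h) 0 0, (hol S a *m h) 0 1),
           ((hol S a *m h) 1 0, (hol S a *m h) 1 1)).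
have ep : mx4 p = hol S a *m h by apply: mx2P; rewrite mx2E.
have Dp : D p by split; [split; split; exact: bh|rewrite /= ep].
have [] := MP p Dp _ (bmob (hol S a) x) (bmob (hol S a) z) (bmob (hol S a) q).
- by rewrite ep.
- by rewrite ep bmobM // h0.
- by rewrite ep bmobM // h1.
- by rewrite ep bmobM // hy.
- exact: limit_set_hol.
- exact: limit_set_hol.
- exact: limit_set_hol.
move=> d [pd d1 d2 d3 Td]; have [La Lb] := peripheral_limit_set pd.
have [pd' ef em] := peripheral_conj a^-1%g pd.
exists (a^-1 * d * a^-1^-1)%g; rewrite ef em.
have dV := det_hol S a^-1%g.
have K1 y : y = bmob (hol S a^-1%g) (bmob (hol S a) y) by rewrite hol_bmobK.
split=> //.
- by rewrite (K1 x) (K1 q) positive3_bmob.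
- by rewrite (K1 z) (K1 q) positive3_bmob.
- by rewrite (K1 q) positive3_bmob.
- by rewrite (K1 x) (K1 z) (K1 q); apply: Tinv => //; exact: limit_set_hol.
Unshelve. all: by end_near. Qed.

End Gaps.

(** * Lagrangians in a symplectic chart *)

Section LagrangianAlgebra.
Variables (R : realType) (n : nat).
Local Notation V := 'cV[R]_(n + n).
Local Notation frame := 'M[R]_(n + n, n).
Implicit Types (M N : frame) (g s : 'M[R]_(n + n)) (X Y T : 'M[R]_n) (U W : {vspace V}).

Lemma memv_colspan M v : reflect (exists u, v = M *m u) (v \in colspan M).
Proof.
by rewrite /colspan; apply: (iffP memv_imgP) => [[u _ ->]|[u ->]]; exists u; rewrite ?memvf ?lfunE.
Qed.

Lemma act_colspan g M : act g (colspan M) = colspan (g *m M).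
Proof.
apply/vspaceP => v; apply/memv_imgP/memv_colspan => [[w /memv_colspan[u ->] ->]|[u ->]].
  by exists u; rewrite lfunE /= mulmxA.
by exists (M *m u); rewrite ?lfunE /= ?mulmxA //; apply/memv_colspan; exists u.
Qed.

Lemma colspan_mulmx M A : A \in unitmx -> colspan (M *m A) = colspan M.
Proof.
move=> uA; apply/vspaceP => v; apply/memv_colspan/memv_colspan => -[u ->].
  by exists (A *m u); rewrite mulmxA.
by exists (invmx A *m u); rewrite -!mulmxA mulKVmx.
Qed.

Lemma colspan_inj M N L : L *m N = 1%:M -> colspan M = colspan N ->
  exists2 A, A \in unitmx & M = N *m A.
Proof.
have sub M1 M2 : colspan M1 = colspan M2 -> exists A, M1 = M2 *m A.
  move=> e; have /choice[u Hu] : forall j, exists u, col j M1 = M2 *m u.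
    move=> j; apply/memv_colspan; rewrite -e; apply/memv_colspan.
    by exists (delta_mx j 0); rewrite colE.
  exists (\matrix_(i, j) u j i 0); apply/matrixP => i j.
  have /matrixP/(_ i 0) := Hu j; rewrite !mxE => ->.
  by apply: eq_bigr => k _; rewrite mxE.
move=> LN e; have [A eA] := sub _ _ e; have [B eB] := sub _ _ (esym e).
exists A => //; have : N *m (A *m B) = N by rewrite mulmxA -eA -eB.
move=> /(congr1 (mulmx L)); rewrite mulmxA LN mul1mx => AB.
by have [] := mulmx1_unit AB.
Qed.

Definition omega M N : 'M[R]_n := M^T *m Jmx R n *m N.

Definition frame_infty : frame := col_mx 1%:M 0.
Definition frame_mx X : frame := col_mx X 1%:M.

Lemma lag_inftyE : lag_infty R n = colspan frame_infty. Proof. by []. Qed.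
Lemma lag_mxE X : lag_mx X = colspan (frame_mx X). Proof. by []. Qed.

Lemma omega_symplectic g M N : symplectic g -> omega (g *m M) (g *m N) = omega M N.
Proof.
by move=> sg; rewrite /omega -[in RHS]sg trmx_mul !mulmxA.
Qed.

Lemma omega_mulmx M N A B : omega (M *m A) (N *m B) = A^T *m omega M N *m B.
Proof. by rewrite /omega trmx_mul !mulmxA. Qed.

Lemma omega_infty_mx X : omega frame_infty (frame_mx X) = 1%:M.
Proof.
rewrite /omega /Jmx tr_col_mx trmx1 trmx0 mul_row_block mul_row_col.
by rewrite !mul1mx !mul0mx !addr0 !mul0mx add0r mul1mx.
Qed.

Lemma omega_mx_mx X Y : omega (frame_mx X) (frame_mx Y) = X^T - Y.
Proof.
rewrite /omega /Jmx tr_col_mx trmx1 mul_row_block mul_row_col.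
by rewrite !mul1mx mulmx0 mulmx1 add0r addr0 mulmx1 mulNmx mul1mx addrC.
Qed.

Lemma Jmx_sq : Jmx R n *m Jmx R n = - 1%:M.
Proof.
rewrite /Jmx mulmx_block !mul0mx !mulmx0 !mul1mx !mulmx1 !addr0 !add0r.
by rewrite scalar_mx_block opp_block_mx oppr0.
Qed.

Lemma symplectic_left g : symplectic g -> (- (Jmx R n *m g^T *m Jmx R n)) *m g = 1%:M.
Proof. by move=> sg; rewrite mulNmx -!mulmxA (mulmxA g^T) sg Jmx_sq opprK. Qed.

Lemma symplectic_unit g : symplectic g -> g \in unitmx.
Proof. by move=> /symplectic_left /mulmx1_unit[]. Qed.

Lemma frame_left_infty g : symplectic g ->
  exists L, L *m (g *m frame_infty) = 1%:M.
Proof.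
move=> sg; exists (row_mx 1%:M 0 *m invmx g).
rewrite -mulmxA mulKmx ?symplectic_unit // /frame_infty mul_row_col.
by rewrite mul1mx mul0mx addr0.
Qed.

Lemma frame_left_mx g X : symplectic g -> exists L, L *m (g *m frame_mx X) = 1%:M.
Proof.
move=> sg; exists (row_mx 0 1%:M *m invmx g).
rewrite -mulmxA mulKmx ?symplectic_unit // /frame_mx mul_row_col.
by rewrite mul1mx mul0mx add0r.
Qed.

(** Equal spans make the frames of [g] those of [s] times invertible A and B. The two pairs of
    frames have the same Gram matrix, the identity, so [A^T *m B = 1]. *)
Lemma maximal3_frames s X g : symplectic s -> symplectic g ->
  act s (lag_infty R n) = act g (lag_infty R n) -> act s (lag_mx X) = act g (lag_mx 0) ->
  exists2 A, A \in unitmx & g *m frame_infty = s *m frame_infty *m A /\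
     g *m frame_mx 0 = s *m frame_mx X *m invmx A^T.
Proof.
move=> ss sg; rewrite !lag_inftyE !lag_mxE !act_colspan => e1 e2.
have [L1 LE1] := frame_left_infty ss; have [L2 LE2] := frame_left_mx X ss.
have [A uA eA] := colspan_inj LE1 (esym e1).
have [B uB eB] := colspan_inj LE2 (esym e2).
exists A => //; split=> //; rewrite eB; congr (_ *m _).
have := omega_infty_mx 0; rewrite -(omega_symplectic _ _ sg) eA eB omega_mulmx.
rewrite omega_symplectic // omega_infty_mx mulmx1 => AB.
have [uAT _] := mulmx1_unit AB.
by rewrite -[LHS](mulKmx uAT) AB mulmx1.
Qed.

Lemma trmx_unit (A : 'M[R]_n) : A \in unitmx -> A^T \in unitmx.
Proof. by rewrite unitmx_tr. Qed.

(** The frame of the identity is the sum of those of infinity and 0; [maximal3_frames] turns it into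
    the frame of [A *m A^T] up to an invertible factor on the right. *)
Lemma maximal3_lag_mx s l : symplectic s ->
  maximal3 (act s (lag_infty R n)) (act s (lag_mx 0)) l ->
  exists2 A, A \in unitmx & l = act s (lag_mx (A *m A^T)).
Proof.
move=> ss [g sg [e1 e2 ->]].
have [A uA [eA eB]] := maximal3_frames ss sg e1 e2.
exists A => //; rewrite !lag_mxE !act_colspan.
have uB : invmx A^T \in unitmx by rewrite unitmx_inv trmx_unit.
rewrite -[RHS](colspan_mulmx _ uB); congr colspan.
have -> : frame_mx 1%:M = frame_infty + frame_mx 0.
  by rewrite /frame_mx /frame_infty add_col_mx addr0 add0r.
rewrite mulmxDr eA eB -!mulmxA -mulmxDr; congr (_ *m _).
rewrite /frame_mx /frame_infty !mul_col_mx add_col_mx !mul0mx !mul1mx addr0 add0r.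
by rewrite mulmxK // trmx_unit.
Qed.

Lemma maximal3_sub s X Y : symplectic s -> X^T = X ->
  maximal3 (act s (lag_infty R n)) (act s (lag_mx X)) (act s (lag_mx Y)) ->
  exists2 A, A \in unitmx & Y - X = A *m A^T.
Proof.
move=> ss sX [g sg [e1 e2 e3]].
have [A uA [eA eB]] := maximal3_frames ss sg e1 e2.
have uAT := trmx_unit uA.
exists A => //.
have [L LE] := frame_left_mx Y ss.
move: e3; rewrite !lag_mxE !act_colspan => /esym e3.
have [C uC eC] := colspan_inj LE e3.
have := omega_infty_mx 1%:M; rewrite -(omega_symplectic _ _ sg) eA eC omega_mulmx.
rewrite omega_symplectic // omega_infty_mx mulmx1 => AC.
have {}AC : C = invmx A^T by rewrite -[LHS](mulKmx uAT) AC mulmx1.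
have := omega_mx_mx 0 1%:M; rewrite -(omega_symplectic _ _ sg) eB eC AC omega_mulmx.
rewrite omega_symplectic // omega_mx_mx trmx0 sub0r sX trmx_inv trmxK => e.
have {}e : X - Y = - (A *m A^T).
  have := congr1 (fun Z : 'M[R]_n => A *m Z *m A^T) e.
  by rewrite mulmxN mulmx1 mulNmx !mulmxA mulmxV // mul1mx mulmxKV.
by rewrite -[RHS]opprK -e opprB.
Qed.

Lemma lag_mx_inj s X Y : symplectic s -> act s (lag_mx X) = act s (lag_mx Y) -> X = Y.
Proof.
move=> ss; rewrite !lag_mxE !act_colspan => e.
have [L LE] := frame_left_mx Y ss.
have [A uA] := colspan_inj LE e; rewrite -mulmxA => /(can_inj (mulKmx (symplectic_unit ss))).
by rewrite /frame_mx mul_col_mx mul1mx => /eq_col_mx[-> <-]; rewrite mulmx1.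
Qed.

(** The dimension of the span is only provably equal to n, so a change of basis is a priori
    rectangular. *)
Lemma det_conj d (P : 'M[R]_(n, d)) (Q : 'M[R]_(d, n)) (N : 'M[R]_n) :
  P *m Q = 1%:M -> Q *m P = 1%:M -> \det (Q *m N *m P) = \det N.
Proof.
move=> PQ QP.
have e : n = d by apply/eqP; rewrite eqn_leq (mulmx1_min PQ) (mulmx1_min QP).
case: d / e P Q PQ QP => P Q PQ _.
by rewrite !det_mulmx mulrC mulrA -det_mulmx PQ det1 mul1r.
Qed.

Lemma det_on_frame M L (N : 'M[R]_n) (f : 'End(V)) : L *m M = 1%:M ->
  (forall u, f (M *m u) = M *m (N *m u)) -> det_on (colspan M) f = \det N.
Proof.
move=> LM fM; rewrite /det_on; set U := colspan M; set b := vbasis U.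
have bU i : b`_i \in U.
  by have [ib|ib] := ltnP i (\dim U); [rewrite vbasis_mem // mem_nth // size_tuple|
    rewrite nth_default ?mem0v // size_tuple].
(* [P] and [Q] convert between coordinates in [vbasis U] and coordinates in the columns of [M]. *)
pose P : 'M[R]_(n, \dim U) := \matrix_(k, i) (L *m b`_i) k 0.
pose Q : 'M[R]_(\dim U, n) := \matrix_(i, j) coord b i (col j M).
have MP i : M *m col i P = b`_i.
  have /memv_colspan[u eu] := bU i.
  have -> : col i P = L *m b`_i by apply/matrixP => k j; rewrite !ord1 !mxE.
  by rewrite eu (mulmxA L) LM mul1mx.
have colM j : col j M \in U by apply/memv_colspan; exists (delta_mx j 0); rewrite colE.
have coordM i (u : 'cV[R]_n) : coord b i (M *m u) = (Q *m u) i 0.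
  have -> : M *m u = \sum_j u j 0 *: col j M.
    apply/matrixP => k l; rewrite ord1 summxE mxE; apply: eq_bigr => j _.
    by rewrite !mxE mulrC.
  by rewrite linear_sum mxE; apply: eq_bigr => j _; rewrite linearZ /= !mxE mulrC.
have fb : free b := basis_free (vbasisP U).
have QP : Q *m P = 1%:M.
  apply/matrixP => i j; have -> : (Q *m P) i j = (Q *m col j P) i 0.
    by rewrite !mxE; apply: eq_bigr => k _; rewrite !mxE.
  by rewrite -coordM MP coord_free // mxE eq_sym.
have PQ : P *m Q = 1%:M.
  apply/matrixP => i j; have -> : (P *m Q) i j = (L *m (M *m (P *m col j Q))) i 0.
    rewrite mulmxA LM mul1mx !mxE; apply: eq_bigr => k _; by rewrite !mxE.
  have -> : M *m (P *m col j Q) = col j M.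
    rewrite [RHS](coord_vbasis (colM j)) -/b.
    have -> : P *m col j Q = \sum_k Q k j *: col k P.
      apply/matrixP => k l; rewrite ord1 summxE mxE; apply: eq_bigr => m _.
      by rewrite !mxE mulrC.
    rewrite linear_sum; apply: eq_bigr => k _.
    by rewrite linearZ /= MP mxE.
  by rewrite colE mulmxA LM mul1mx !mxE eqxx andbT.
rewrite -(det_conj N PQ QP) -det_tr; congr (\det _).
apply/matrixP => i j; rewrite !mxE -MP fM coordM !mulmxA.
by rewrite !mxE; apply: eq_bigr => k _; rewrite !mxE.
Qed.

Lemma daddv_pi0 U W v : (U :&: W)%VS = 0%VS -> v \in W -> daddv_pi U W v = 0.
Proof.
move=> UW vW; have WU : (W :&: U)%VS = 0%VS by rewrite capvC.
have vUW : v \in (U + W)%VS by rewrite -[v]add0r memv_add ?mem0v.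
have := daddv_pi_add UW vUW; rewrite (daddv_pi_id WU vW) => /eqP.
by rewrite -subr_eq0 addrK => /eqP.
Qed.

Lemma capv_colspan0 M N : (forall u w : 'cV[R]_n, M *m u = N *m w -> M *m u = 0) ->
  (colspan M :&: colspan N)%VS = 0%VS.
Proof.
move=> H; apply/eqP; rewrite -subv0; apply/subvP => v.
rewrite memv_cap memv0 => /andP[/memv_colspan[u ->] /memv_colspan[w e]].
by rewrite (H _ _ e).
Qed.

(** In the chart, (0, u) = (Y u, u) - (Y u, 0) projects to - (Y u, 0), which equals (0, w) - (T w,
    w) with w = T^-1 Y u and projects to (0, w). The endomorphism is thus T^-1 Y. *)
Lemma detR_lag s Y T : symplectic s -> T \in unitmx ->
  detR (act s (lag_mx 0)) (act s (lag_mx T)) (act s (lag_mx Y)) (act s (lag_infty R n)) =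
  \det Y / \det T.
Proof.
move=> ss uT; rewrite /detR lag_inftyE !lag_mxE !act_colspan.
have sinj (a b : V) : s *m a = s *m b -> a = b by exact/can_inj/mulKmx/symplectic_unit.
have [L LE] := frame_left_mx 0 ss.
rewrite (det_on_frame (N := invmx T *m Y) LE) ?det_mulmx ?det_inv 1?mulrC // => u.
have I1 : (colspan (s *m frame_mx 0) :&: colspan (s *m frame_mx T))%VS = 0%VS.
  apply: capv_colspan0 => v w; rewrite -!mulmxA => /sinj.
  rewrite /frame_mx !mul_col_mx !mul1mx mul0mx => /eq_col_mx[e0 ->].
  by rewrite -[w](mulKmx uT) -e0 mulmx0 col_mx0 mulmx0.
have I2 : (colspan (s *m frame_infty) :&: colspan (s *m frame_mx Y))%VS = 0%VS.
  apply: capv_colspan0 => v w; rewrite -!mulmxA => /sinj.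
  rewrite /frame_infty /frame_mx !mul_col_mx !mul1mx mul0mx => /eq_col_mx[-> <-].
  by rewrite mulmx0 col_mx0 mulmx0.
rewrite /Rmap comp_lfunE.
have -> : s *m frame_mx 0 *m u =
    s *m frame_mx Y *m u - s *m frame_infty *m (Y *m u).
  rewrite -!mulmxA -mulmxBr; congr (_ *m _).
  rewrite /frame_infty /frame_mx !mul_col_mx !mul1mx !mul0mx opp_col_mx add_col_mx.
  by rewrite subrr oppr0 addr0.
rewrite linearB /= (daddv_pi0 I2); last by apply/memv_colspan; exists u.
rewrite sub0r (daddv_pi_id I2); last by apply/memv_colspan; exists (Y *m u).
have -> : - (s *m frame_infty *m (Y *m u)) =
    s *m frame_mx 0 *m (invmx T *m Y *m u) - s *m frame_mx T *m (invmx T *m Y *m u).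
  rewrite -!mulmxA -mulmxBr -mulmxN; congr (_ *m _).
  rewrite /frame_infty /frame_mx !mul_col_mx !mul1mx !mul0mx !opp_col_mx add_col_mx.
  by rewrite subrr oppr0 sub0r mulKVmx.
have mem M (v : 'cV[R]_n) : M *m v \in colspan M by apply/memv_colspan; exists v.
by rewrite linearB /= (daddv_pi_id I1 (mem _ _)) (daddv_pi0 I1 (mem _ _)) subr0.
Qed.

End LagrangianAlgebra.

(** * Positive definite matrices *)

Section PositiveDefinite.
Variable R : realType.

(** Factored form, because this is how positivity comes out of maximal triples. *)
Definition psd n (X : 'M[R]_n) := exists A : 'M[R]_n, X = A *m A^T.
Definition pd n (X : 'M[R]_n) := exists2 A : 'M[R]_n, A \in unitmx & X = A *m A^T.

Lemma pd_psd n (X : 'M[R]_n) : pd X -> psd X.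
Proof. by case=> A _ ->; exists A. Qed.

Lemma pd_sym n (X : 'M[R]_n) : pd X -> X^T = X.
Proof. by case=> A _ ->; rewrite trmx_mul trmxK. Qed.

Lemma pd_unit n (X : 'M[R]_n) : pd X -> X \in unitmx.
Proof. by case=> A uA ->; rewrite unitmx_mul unitmx_tr uA. Qed.

Lemma pd_det_gt0 n (X : 'M[R]_n) : pd X -> 0 < \det X.
Proof.
case=> A; rewrite unitmxE unitfE => dA ->.
by rewrite det_mulmx det_tr -expr2 exprn_even_gt0.
Qed.

Lemma pd_invmx n (X : 'M[R]_n) : pd X -> pd (invmx X).
Proof.
case=> A uA ->; exists (invmx A)^T; first by rewrite unitmx_tr unitmx_inv.
have uAT : A^T \in unitmx by rewrite unitmx_tr.
rewrite trmxK trmx_inv; apply: (can_inj (mulKmx (_ : A *m A^T \in unitmx))).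
  by rewrite unitmx_mul uA.
rewrite mulmxV ?unitmx_mul ?uA // mulmxA mulmxK // mulmxV //.
Qed.

Lemma mxtrace_mul_tr m n (M : 'M[R]_(m, n)) :
  \tr (M *m M^T) = \sum_i \sum_j M i j ^+ 2.
Proof.
by apply: eq_bigr => i _; rewrite mxE; apply: eq_bigr => j _; rewrite mxE expr2.
Qed.

Lemma mxtrace_mul_tr_ge0 m n (M : 'M[R]_(m, n)) : 0 <= \tr (M *m M^T).
Proof. by rewrite mxtrace_mul_tr; do 2 apply: sumr_ge0 => ? _; rewrite sqr_ge0. Qed.

Lemma cauchy_schwarz (I : finType) (u v : I -> R) :
  (\sum_i u i * v i) ^+ 2 <= (\sum_i u i ^+ 2) * (\sum_i v i ^+ 2).
Proof.
have : 0 <= \sum_i \sum_j (u i * v j - u j * v i) ^+ 2.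
  by do 2 apply: sumr_ge0 => ? _; rewrite sqr_ge0.
have -> : \sum_i \sum_j (u i * v j - u j * v i) ^+ 2 =
    \sum_i \sum_j (u i ^+ 2 * v j ^+ 2) + \sum_i \sum_j (v i ^+ 2 * u j ^+ 2) -
    2 * \sum_i \sum_j (u i * v i * (u j * v j)).
  rewrite mulr_sumr -big_split -sumrB /=; apply: eq_bigr => i _.
  rewrite mulr_sumr -big_split -sumrB /=; apply: eq_bigr => j _; ring.
rewrite -!big_distrlr /= (mulrC (\sum_i v i ^+ 2)) -expr2; lra.
Qed.

Lemma mxtrace_mul_tr_mul m n p (M : 'M[R]_(m, n)) (N : 'M[R]_(n, p)) :
  \tr ((M *m N) *m (M *m N)^T) <= \tr (M *m M^T) * \tr (N *m N^T).
Proof.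
rewrite !mxtrace_mul_tr [X in _ * X]exchange_big /= mulr_suml.
apply: ler_sum => i _; rewrite mulr_sumr; apply: ler_sum => j _.
by rewrite mxE; exact: cauchy_schwarz.
Qed.

Lemma psd_mxtrace_ge0 n (P U : 'M[R]_n) : psd P -> psd U -> 0 <= \tr (P *m U).
Proof.
case=> A -> [B ->].
have -> : \tr (A *m A^T *m (B *m B^T)) = \tr ((A^T *m B) *m (A^T *m B)^T).
  by rewrite trmx_mul trmxK -!mulmxA mxtrace_mulC !mulmxA.
exact: mxtrace_mul_tr_ge0.
Qed.

(** With P = A A^T, U = B B^T, V = C C^T, this is submultiplicativity of the Frobenius norm for the
    product of A^T C and C^-1 B. *)
Lemma mxtrace_mul_le n (P U V : 'M[R]_n) : psd P -> psd U -> pd V ->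
  \tr (P *m U) <= \tr (P *m V) * \tr (invmx V *m U).
Proof.
case=> A -> [B ->] pV; have uV := pd_unit pV; case: pV uV => C uC -> uV.
pose W := invmx C *m B; have eB : B = C *m W by rewrite mulKVmx.
have h (D E : 'M[R]_n) : \tr (D *m D^T *m (E *m E^T)) = \tr ((D^T *m E) *m (D^T *m E)^T).
  by rewrite trmx_mul trmxK -!mulmxA mxtrace_mulC !mulmxA.
have -> : \tr (invmx (C *m C^T) *m (B *m B^T)) = \tr (W *m W^T).
  have -> : invmx (C *m C^T) *m (B *m B^T) = invmx C^T *m (W *m W^T) *m C^T.
    apply: (can_inj (mulKmx uV)); rewrite mulKVmx // eB trmx_mul !mulmxA.
    by rewrite mulmxK ?unitmx_tr.
  rewrite mxtrace_mulC mulKVmx ?unitmx_tr //.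
rewrite !h eB mulmxA; exact: mxtrace_mul_tr_mul.
Qed.

(** Induction on the Schur complement of the upper left entry, whose trace does not exceed that of
    the lower right block, together with ln t <= t - 1. Positivity is assumed of the quadratic form
    because in that shape it passes to the complement. *)
Lemma ln_det_le n (S : 'M[R]_n) : S^T = S ->
  (forall u : 'rV[R]_n, u != 0 -> 0 < (u *m S *m u^T) 0 0) ->
  0 < \det S /\ ln (\det S) <= \tr S - n%:R.
Proof.
elim: n S => [|n IH] S symS posS.
  by rewrite det_mx00 ln1 /mxtrace big_ord0 subrr.
rewrite -[n.+1]/(1 + n)%N in S symS posS *.
pose a := ulsubmx S; pose b := ursubmx S; pose c := dlsubmx S; pose D := drsubmx S.
have eS : S = block_mx a b c D by rewrite submxK.
have [ea eb] : a = (a 0 0)%:M /\ c = b^T.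
  split; first by rewrite [LHS]mx11_scalar.
  by move: symS; rewrite {1 2}eS tr_block_mx => /eq_block_mx[_ _ -> _].
set al := a 0 0 in ea.
have al0 : 0 < al.
  have := posS (row_mx 1 0); rewrite eS mul_row_block tr_row_mx mul_row_col.
  rewrite !mul0mx !addr0 trmx0 mulmx0 addr0 trmx1 mul1mx mulmx1; apply.
  by apply/eqP => /eqP; rewrite row_mx_eq0 oner_eq0.
have aln : al != 0 by rewrite gt_eqF.
pose D' := D - al^-1 *: (c *m b).
pose P := block_mx (1%:M : 'M[R]_1) 0 (- al^-1 *: c) (1%:M : 'M[R]_n).
have PS : P *m S = block_mx a b 0 D'.
  rewrite eS mulmx_block !mul1mx !mul0mx !addr0 ea; congr block_mx.
    by rewrite mul_mx_scalar scalerA mulrN mulfV // scaleN1r addNr.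
  by rewrite -scalemxAl scaleNr addrC.
have dS : \det S = al * \det D'.
  have := congr1 determinant PS; rewrite det_mulmx det_lblock !det1 !mul1r => ->.
  by rewrite det_ublock ea det_scalar1.
have symD : D'^T = D'.
  have eD : D^T = D by move: symS; rewrite {1 2}eS tr_block_mx => /eq_block_mx[_ _ _ ->].
  by rewrite /D' linearB linearZ /= eD eb trmx_mul trmxK.
have posD (v : 'rV[R]_n) : v != 0 -> 0 < (v *m D' *m v^T) 0 0.
  move=> v0; pose u := row_mx (0 : 'M[R]_1) v *m P.
  have uE : u = row_mx (v *m (- al^-1 *: c)) v.
    by rewrite /u /P mul_row_block !mul0mx !add0r mulmx1.
  have -> : v *m D' *m v^T = u *m S *m u^T.
    rewrite {1}/u -(mulmxA _ P) PS mul_row_block !mul0mx !add0r mulmx0 uE.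
    by rewrite tr_row_mx mul_row_col mul0mx add0r.
  apply: posS; rewrite uE; apply: contraNneq v0 => /eqP.
  by rewrite row_mx_eq0 => /andP[].
have [dD lnD] := IH D' symD posD.
rewrite dS; split; first exact: mulr_gt0.
rewrite lnM ?posrE //.
have l1 : ln al <= al - 1.
  have := @le_ln1Dx R (al - 1); rewrite addrCA subrr addr0; apply.
  by rewrite ltrBrDl subrr.
have trS : \tr S = al + \tr D by rewrite eS mxtrace_block ea mxtrace_scalar.
have : \tr D' = \tr D - al^-1 * \tr (b *m b^T).
  by rewrite /D' raddfB /= mxtraceZ mxtrace_mulC eb.
have : 0 <= al^-1 * \tr (b *m b^T).
  by rewrite mulr_ge0 ?mxtrace_mul_tr_ge0 // invr_ge0 ltW.
rewrite trS natrD; lra.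
Qed.

Lemma pd_ln_det n (X Y : 'M[R]_n) : pd X -> pd Y ->
  ln (\det Y) - ln (\det X) <= \tr (invmx X *m Y) - n%:R.
Proof.
move=> pX pY; have dX := pd_det_gt0 pX; have dY := pd_det_gt0 pY.
case: pX pY dX dY => A uA -> [B uB ->] dX dY.
pose M := invmx A *m B; have uM : M \in unitmx by rewrite unitmx_mul unitmx_inv uA.
have eB : B = A *m M by rewrite mulKVmx.
clearbody M.
have [||_ lnM] := @ln_det_le _ (M *m M^T).
- by rewrite trmx_mul trmxK.
- move=> u u0; rewrite mulmxA -mulmxA -trmx_mul.
  have : 0 <= \tr ((u *m M) *m (u *m M)^T) by exact: mxtrace_mul_tr_ge0.
  rewrite le_eqVlt => /orP[/eqP e|]; last by rewrite /mxtrace big_ord1.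
  case/eqP: u0; have : u *m M = 0.
    apply/matrixP => i j; rewrite ord1 [RHS]mxE; apply/eqP.
    move/esym/eqP: e; rewrite mxtrace_mul_tr big_ord1 psumr_eq0 => [/allP/(_ j)|k _].
      by rewrite mem_index_enum sqrf_eq0 => /(_ isT).
    by rewrite sqr_ge0.
  by move/(congr1 (mulmx^~ (invmx M))); rewrite mulmxK // mul0mx.
have -> : \tr (invmx (A *m A^T) *m (B *m B^T)) = \tr (M *m M^T).
  have -> : invmx (A *m A^T) *m (B *m B^T) = invmx A^T *m (M *m M^T) *m A^T.
    have uAA : A *m A^T \in unitmx by rewrite unitmx_mul unitmx_tr uA.
    apply: (can_inj (mulKmx uAA)); rewrite mulKVmx // eB trmx_mul !mulmxA.
    by rewrite mulmxK ?unitmx_tr.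
  rewrite mxtrace_mulC mulKVmx ?unitmx_tr //.
rewrite -ln_div ?posrE //; apply: le_trans lnM; rewrite le_eqVlt; apply/orP; left.
apply/eqP; congr ln; rewrite eB !(det_mulmx, det_tr).
have : \det A != 0 by rewrite -unitfE -unitmxE.
by move=> dA; field.
Qed.

(** The increment from x to z is at most tr (Xx^-1 (Xz - Xx)), hence at most C tr (Xx^-1 (Xb - Xa)).
    Replacing Xx^-1 by Xb^-1 in this trace costs tr (Xx^-1 Xb), at most n tr (Xy^-1 Xw) by
    monotonicity, and tr (Xb^-1 (Xb - Xa)) is at most the increment from a to b. *)
Lemma ln_det_porosity n (Xy Xx Xa Xb Xz Xw : 'M[R]_n) (C : R) :
  pd Xy -> pd Xx -> pd Xa -> pd Xb -> pd Xz -> pd Xw ->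
  psd (Xx - Xy) -> psd (Xw - Xb) -> pd (Xb - Xa) -> psd (Xz - Xx) ->
  \tr (invmx (Xb - Xa) *m (Xz - Xx)) <= C ->
  ln (\det Xz) - ln (\det Xx) <=
  C * (n%:R * \tr (invmx Xy *m Xw)) * (ln (\det Xb) - ln (\det Xa)).
Proof.
move=> py px pa pb pz pw pyx pbw pab pxz hC.
have iy := pd_psd (pd_invmx py); have ix := pd_psd (pd_invmx px).
have ib := pd_psd (pd_invmx pb).
have trI (X : 'M[R]_n) : pd X -> \tr (invmx X *m X) = n%:R.
  by move=> pX; rewrite mulVmx ?pd_unit // mxtrace1.
have h1 := pd_ln_det px pz; have h2 := pd_ln_det pb pa.
have h3 : \tr (invmx Xx *m (Xz - Xx)) = \tr (invmx Xx *m Xz) - n%:R.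
  by rewrite mulmxBr raddfB /= trI.
have h4 : \tr (invmx Xb *m (Xb - Xa)) = n%:R - \tr (invmx Xb *m Xa).
  by rewrite mulmxBr raddfB /= trI.
have h5 := mxtrace_mul_le ix pxz pab.
have h6 := mxtrace_mul_le (pd_psd pab) ix (pd_invmx pb).
rewrite invmxK in h6.
have h7 := psd_mxtrace_ge0 ix pbw; rewrite mulmxBr raddfB /= in h7.
have h8 := mxtrace_mul_le ix (pd_psd pw) py.
have h9 := psd_mxtrace_ge0 ix pyx; rewrite mulmxBr raddfB /= trI // in h9.
have g1 := psd_mxtrace_ge0 iy (pd_psd pw).
have g2 := psd_mxtrace_ge0 ib (pd_psd pab).
have g3 := psd_mxtrace_ge0 ix (pd_psd pab).
have g4 := psd_mxtrace_ge0 (pd_psd (pd_invmx pab)) pxz.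
rewrite (mxtrace_mulC (Xb - Xa) (invmx Xx)) (mxtrace_mulC (Xb - Xa) (invmx Xb)) in h6.
rewrite (mxtrace_mulC Xb) in h6.
have C0 : 0 <= C by apply: le_trans hC.
set t := \tr (invmx Xy *m Xw) in g1 h8 *.
set v := \tr (invmx Xx *m (Xb - Xa)) in h5 h6 g3.
set w := \tr (invmx Xb *m (Xb - Xa)) in h4 h6 g2.
have k1 : \tr (invmx Xx *m Xb) <= n%:R * t.
  by apply: le_trans (_ : _ <= \tr (invmx Xx *m Xy) * t) _; [lra|apply: ler_wpM2r => //; lra].
have k2 : v <= w * (n%:R * t) by apply: le_trans h6 _; exact: ler_wpM2l.
have k3 : \tr (invmx Xx *m (Xz - Xx)) <= C * v.
  by apply: le_trans h5 _; rewrite mulrC ler_wpM2r.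
have k4 : C * v <= C * (w * (n%:R * t)) by exact: ler_wpM2l.
have k5 : w <= ln (\det Xb) - ln (\det Xa) by lra.
have nt : 0 <= n%:R * t by rewrite mulr_ge0.
apply: le_trans (_ : _ <= C * (n%:R * t) * w) _; last by rewrite ler_wpM2l // mulr_ge0.
by rewrite -mulrA (mulrC _ w); lra.
Qed.

End PositiveDefinite.

(** * Continuity of the comparison of gaps *)

Section MatrixLimits.
Variables (R : realType) (T : topologicalType) (p : T).

Definition mx_cvg m n (f : T -> 'M[R]_(m, n)) :=
  forall i j, (fun t => f t i j) @ p --> f p i j.

Lemma cvg_sumr (I : Type) (r : seq I) (f : I -> T -> R) :
  (forall i, f i @ p --> f i p) ->
  (fun t => \sum_(i <- r) f i t) @ p --> \sum_(i <- r) f i p.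
Proof.
move=> cf; elim: r => [|i r IH].
  by rewrite big_nil; under eq_fun do rewrite big_nil; exact: cvg_cst.
rewrite big_cons; under eq_fun do rewrite big_cons.
by apply: cvgD.
Qed.

Lemma cvg_prodr (I : Type) (r : seq I) (f : I -> T -> R) :
  (forall i, f i @ p --> f i p) ->
  (fun t => \prod_(i <- r) f i t) @ p --> \prod_(i <- r) f i p.
Proof.
move=> cf; elim: r => [|i r IH].
  by rewrite big_nil; under eq_fun do rewrite big_nil; exact: cvg_cst.
rewrite big_cons; under eq_fun do rewrite big_cons.
by apply: cvgM.
Qed.

Lemma mx_cvg_cst m n (M : 'M[R]_(m, n)) : mx_cvg (fun=> M).
Proof. by move=> i j; exact: cvg_cst. Qed.

Lemma mx_cvg_tr m n (f : T -> 'M[R]_(m, n)) : mx_cvg f -> mx_cvg (fun t => (f t)^T).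
Proof.
by move=> cf i j; rewrite mxE; under eq_fun do rewrite mxE; exact: cf.
Qed.

Lemma mx_cvg_mul m n k (f : T -> 'M[R]_(m, n)) (g : T -> 'M[R]_(n, k)) :
  mx_cvg f -> mx_cvg g -> mx_cvg (fun t => f t *m g t).
Proof.
move=> cf cg i j; rewrite mxE; under eq_fun do rewrite mxE.
by apply: cvg_sumr => l; apply: cvgM; [exact: cf|exact: cg].
Qed.

Lemma cvg_det n (f : T -> 'M[R]_n) : mx_cvg f ->
  (fun t => \det (f t)) @ p --> \det (f p).
Proof.
move=> cf; apply: cvg_sumr => s; apply: cvgM; first exact: cvg_cst.
by apply: cvg_prodr => i; exact: cf.
Qed.

(** A single formula whose entries are continuous at every unit, unlike [invmx], which is defined by
    cases. *)
Definition adj_inv n (M : 'M[R]_n) : 'M[R]_n := (\det M)^-1 *: \adj M.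

Lemma adj_invE n (M : 'M[R]_n) : M \in unitmx -> adj_inv M = invmx M.
Proof. by move=> uM; rewrite /invmx uM. Qed.

Lemma mx_cvg_inv n (f : T -> 'M[R]_n) : f p \in unitmx -> mx_cvg f ->
  mx_cvg (fun t => adj_inv (f t)).
Proof.
rewrite unitmxE unitfE => dp cf i j; rewrite !mxE.
under eq_fun do rewrite !mxE.
apply: cvgM; first by apply: cvgV => //; exact: cvg_det.
apply: cvgM; first exact: cvg_cst.
apply: cvg_det => k l; rewrite !mxE; under eq_fun do rewrite !mxE; exact: cf.
Qed.

Lemma cvg_trace n (f : T -> 'M[R]_n) : mx_cvg f ->
  (fun t => \tr (f t)) @ p --> \tr (f p).
Proof. by move=> cf; apply: cvg_sumr => i; exact: cf. Qed.

End MatrixLimits.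

(** * Comparison of five Lagrangians through their frames *)

Section Quintuples.
Variables (R : realType) (n : nat).
Local Notation V := 'cV[R]_(n + n).
Local Notation frame := 'M[R]_(n + n, n).
Implicit Types (M N Q : frame) (g s : 'M[R]_(n + n)) (X Y : 'M[R]_n) (U W : {vspace V}).

Lemma unitmxN m (X : 'M[R]_m) : (- X \in unitmx) = (X \in unitmx).
Proof. by rewrite -scaleN1r unitmxZ // unitrN1. Qed.

(* In the chart sending the span of [Q] to infinity, in which the spans of [M]
   and [N] are symmetric matrices [X] and [Y], this is [X - Y] up to congruence. *)
Definition chart_diff Q M N :=
  (adj_inv (omega Q M))^T *m omega M N *m adj_inv (omega Q N).

(** The trace to be bounded uniformly, written with the symplectic form alone: invariance and
    continuity are visible without choosing a chart. *)
Definition chart_ratio Q M1 M2 N1 N2 :=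
  \tr (adj_inv (chart_diff Q N1 N2) *m chart_diff Q M1 M2).

Lemma chart_ratio_symplectic g Q M1 M2 N1 N2 : symplectic g ->
  chart_ratio (g *m Q) (g *m M1) (g *m M2) (g *m N1) (g *m N2) =
  chart_ratio Q M1 M2 N1 N2.
Proof. by move=> sg; rewrite /chart_ratio /chart_diff !omega_symplectic. Qed.

Lemma maximal3_omega l1 l2 l3 M1 M2 M3 : maximal3 l1 l2 l3 ->
  colspan M1 = l1 -> colspan M2 = l2 -> colspan M3 = l3 ->
  [/\ omega M1 M2 \in unitmx, omega M1 M3 \in unitmx & omega M2 M3 \in unitmx].
Proof.
move=> [g sg [-> -> ->]]; rewrite lag_inftyE !lag_mxE !act_colspan => e1 e2 e3.
have [L1 LE1] := frame_left_infty sg; have [L2 LE2] := frame_left_mx 0 sg.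
have [L3 LE3] := frame_left_mx 1%:M sg.
have [A uA ->] := colspan_inj LE1 e1; have [B uB ->] := colspan_inj LE2 e2.
have [C uC ->] := colspan_inj LE3 e3.
rewrite !omega_mulmx !omega_symplectic // !omega_infty_mx omega_mx_mx trmx0 sub0r.
by rewrite !mulmx1 mulmxN mulmx1 mulNmx unitmxN !unitmx_mul !unitmx_tr uA uB uC.
Qed.

Lemma chart_diff_unit Q M N : omega Q M \in unitmx -> omega Q N \in unitmx ->
  omega M N \in unitmx -> chart_diff Q M N \in unitmx.
Proof.
move=> u1 u2 u3; rewrite /chart_diff !adj_invE // !unitmx_mul unitmx_tr !unitmx_inv.
by rewrite u1 u2 u3.
Qed.

Lemma chart_diffE s A B C X Y : symplectic s -> A \in unitmx -> B \in unitmx ->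
  C \in unitmx -> X^T = X ->
  chart_diff (s *m frame_infty R n *m A) (s *m frame_mx X *m B) (s *m frame_mx Y *m C) =
  invmx A *m (X - Y) *m (invmx A)^T.
Proof.
move=> ss uA uB uC sX; rewrite /chart_diff !omega_mulmx !omega_symplectic //.
rewrite !omega_infty_mx omega_mx_mx sX !mulmx1.
have uAB : A^T *m B \in unitmx by rewrite unitmx_mul unitmx_tr uA.
have uAC : A^T *m C \in unitmx by rewrite unitmx_mul unitmx_tr uA.
rewrite !adj_invE //.
have -> : (invmx (A^T *m B))^T *m (B^T *m (X - Y) *m C) =
    invmx A *m (X - Y) *m C.
  rewrite trmx_inv trmx_mul trmxK !mulmxA; do 2 congr (_ *m _).
  have uBA : B^T *m A \in unitmx by rewrite unitmx_mul unitmx_tr uB.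
  by apply: (can_inj (mulKmx uBA)); rewrite mulKVmx // -mulmxA mulmxV // mulmx1.
rewrite -(mulmxA (invmx A *m (X - Y))); congr (_ *m _).
apply: (can_inj (mulmxK uAC)); rewrite mulmxKV // mulmxA trmx_inv.
by rewrite mulVmx ?unitmx_tr // mul1mx.
Qed.

(** The frames of the four finite Lagrangians cancel inside [chart_diff]; the frame of the one at
    infinity leaves a congruence, which becomes a conjugation in the product and disappears in the
    trace. *)
Lemma chart_ratioE s X1 X2 Y1 Y2 Q M1 M2 N1 N2 : symplectic s ->
  colspan Q = act s (lag_infty R n) -> colspan M1 = act s (lag_mx X1) ->
  colspan M2 = act s (lag_mx X2) -> colspan N1 = act s (lag_mx Y1) ->
  colspan N2 = act s (lag_mx Y2) -> X1^T = X1 -> Y1^T = Y1 -> pd (Y2 - Y1) ->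
  chart_ratio Q M1 M2 N1 N2 = \tr (invmx (Y2 - Y1) *m (X2 - X1)).
Proof.
move=> ss; rewrite lag_inftyE !lag_mxE !act_colspan => eQ e1 e2 e3 e4 sX sY pY.
have [LQ LEQ] := frame_left_infty ss; have L Z := frame_left_mx Z ss.
have [A uA ->] := colspan_inj LEQ eQ.
have [LX1 LE1] := L X1; have [B1 uB1 ->] := colspan_inj LE1 e1.
have [LX2 LE2] := L X2; have [B2 uB2 ->] := colspan_inj LE2 e2.
have [LY1 LE3] := L Y1; have [C1 uC1 ->] := colspan_inj LE3 e3.
have [LY2 LE4] := L Y2; have [C2 uC2 ->] := colspan_inj LE4 e4.
rewrite /chart_ratio !chart_diffE //.
have uY := pd_unit pY.
have uY' : Y1 - Y2 \in unitmx by rewrite -opprB unitmxN.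
have uA' : (invmx A)^T \in unitmx by rewrite unitmx_tr unitmx_inv.
have uD : invmx A *m (Y1 - Y2) *m (invmx A)^T \in unitmx.
  by rewrite !unitmx_mul uA' uY' unitmx_inv uA.
rewrite adj_invE //.
have -> : invmx (invmx A *m (Y1 - Y2) *m (invmx A)^T) *m
    (invmx A *m (X1 - X2) *m (invmx A)^T) =
    invmx (invmx A)^T *m (invmx (Y2 - Y1) *m (X2 - X1)) *m (invmx A)^T.
  apply: (can_inj (mulKmx uD)); rewrite mulKVmx // -!mulmxA; congr (_ *m _).
  rewrite (mulKVmx uA') -(opprB Y2) mulNmx (mulmxA (Y2 - Y1)) mulmxV // mul1mx.
  by rewrite -mulNmx opprB.
by rewrite mxtrace_mulC mulKVmx.
Qed.

End Quintuples.

(** * Uniform comparison for the boundary map *)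

Section BoundaryMap.
Variables (R : realType) (G : groupType) (S : surface R G) (n : nat).
Variables (rho : G -> 'M[R]_(n + n)) (phi : bdH R -> {vspace 'cV[R]_(n + n)}).
Hypotheses (sp_rho : forall a, symplectic (rho a)) (phi_bd : boundary_map S rho phi).
Local Notation frame := 'M[R]_(n + n, n).
Implicit Types (x y z q t : bdH R).

(** Some frames suffice: continuity of [phi] only yields one nearby frame for each nearby
    Lagrangian. *)
Definition gap_ratio_le (C : R) x z q y t := exists Q M1 M2 N1 N2 : frame,
  [/\ colspan Q = phi q, colspan M1 = phi x, colspan M2 = phi z,
      colspan N1 = phi y & colspan N2 = phi t] /\
  chart_ratio Q M1 M2 N1 N2 <= C.

Lemma phi_maximal x y z : limit_set S x -> limit_set S y -> limit_set S z ->
  positive3 x y z -> maximal3 (phi x) (phi y) (phi z).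
Proof. by case: phi_bd => _ _ _ H _; exact: H. Qed.

Lemma maximal3_colspan (l1 l2 l3 : {vspace 'cV[R]_(n + n)}) : maximal3 l1 l2 l3 ->
  exists M1 M2 M3 : frame, [/\ colspan M1 = l1, colspan M2 = l2 & colspan M3 = l3].
Proof.
move=> [g _ [-> -> ->]]; exists (g *m frame_infty R n), (g *m frame_mx 0), (g *m frame_mx 1%:M).
by rewrite lag_inftyE !lag_mxE !act_colspan.
Qed.

Lemma phi_frame_nbhs x (M : frame) (A : set frame) : limit_set S x ->
  colspan M = phi x -> nbhs M A ->
  exists2 U : set (bdH R), nbhs x U &
    forall y, limit_set S y -> U y -> exists2 N, A N & colspan N = phi y.
Proof.
move=> Lx eM nA; have [_ cphi _ _ _] := phi_bd.
have /(cphi x Lx) H : lag_nbhs (phi x) [set l | exists2 N, A N & colspan N = l].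
  by exists M => //; apply: filterS nA => N AN; exists N.
exists [set y | limit_set S y -> exists2 N, A N & colspan N = phi y] => //.
by move=> y Ly; apply.
Qed.

(** [uniform_gap] applies: equivariance of [phi] gives invariance, and continuity of [chart_ratio]
    in the frames of the triple, with those of the gap fixed, gives the local bound. *)
Lemma gap_ratio_uniform : exists C, forall x z q, limit_set S x -> limit_set S z ->
  limit_set S q -> positive3 x z q -> exists d, [/\ peripheral S d,
    positive3 x (fixm S d) q, positive3 q (fixp S d) z,
    positive3 (fixp S d) (fixm S d) q & gap_ratio_le C x z q (fixp S d) (fixm S d)].
Proof.
apply: uniform_gap.
- move=> M N x z q y t MN [Q [M1 [M2 [N1 [N2 [e le]]]]]].
  by exists Q, M1, M2, N1, N2; split=> //; exact: le_trans MN.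
- move=> a M x z q y t Lx Lz Lq Ly Lt [Q [M1 [M2 [N1 [N2 [[e1 e2 e3 e4 e5] le]]]]]].
  have [_ _ eq_phi _ _] := phi_bd.
  exists (rho a *m Q), (rho a *m M1), (rho a *m M2), (rho a *m N1), (rho a *m N2).
  split; last by rewrite chart_ratio_symplectic.
  by rewrite -!act_colspan e1 e2 e3 e4 e5 !eq_phi.
move=> x z q y t Lx Lz Lq Ly Lt xzq _ _ ytq.
have mx := phi_maximal Lq Lx Lz (positive3_rot (positive3_rot xzq)).
have my := phi_maximal Lq Ly Lt (positive3_rot (positive3_rot ytq)).
have [Q [M1 [M2 [eQ e1 e2]]]] := maximal3_colspan mx.
have [_ [N1 [N2 [_ e3 e4]]]] := maximal3_colspan my.
have [u1 u2 u3] := maximal3_omega mx eQ e1 e2.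
have [w1 w2 w3] := maximal3_omega my eQ e3 e4.
pose F (p : (frame * frame) * frame) := chart_ratio p.1.1 p.1.2 p.2 N1 N2.
pose p0 := ((Q, M1), M2).
have cF : F @ p0 --> F p0.
  have cQ : mx_cvg p0 (fun p : (frame * frame) * frame => p.1.1).
    move=> i j; apply: (@cvg_comp _ _ _ (fun p : (frame * frame) * frame => p.1.1)
      (fun M : frame => M i j) (nbhs p0) (nbhs Q)); last exact: coord_continuous.
    exact: (cvg_comp _ _ cvg_fst cvg_fst).
  have cM1 : mx_cvg p0 (fun p : (frame * frame) * frame => p.1.2).
    move=> i j; apply: (@cvg_comp _ _ _ (fun p : (frame * frame) * frame => p.1.2)
      (fun M : frame => M i j) (nbhs p0) (nbhs M1)); last exact: coord_continuous.
    exact: (cvg_comp _ _ cvg_fst cvg_snd).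
  have cM2 : mx_cvg p0 (fun p : (frame * frame) * frame => p.2).
    move=> i j; apply: (@cvg_comp _ _ _ (fun p : (frame * frame) * frame => p.2)
      (fun M : frame => M i j) (nbhs p0) (nbhs M2)); last exact: coord_continuous.
    exact: cvg_snd.
  have cN N : mx_cvg p0 (fun _ : (frame * frame) * frame => N) by exact: mx_cvg_cst.
  have cJ : mx_cvg p0 (fun _ : (frame * frame) * frame => Jmx R n) by exact: mx_cvg_cst.
  have cO f g : mx_cvg p0 f -> mx_cvg p0 g -> mx_cvg p0 (fun p => omega (f p) (g p)).
    move=> cf cg; apply: mx_cvg_mul => //; apply: mx_cvg_mul => //.
    exact: mx_cvg_tr.
  have cD f1 f2 f3 : mx_cvg p0 f1 -> mx_cvg p0 f2 -> mx_cvg p0 f3 ->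
      omega (f1 p0) (f2 p0) \in unitmx -> omega (f1 p0) (f3 p0) \in unitmx ->
      mx_cvg p0 (fun p => chart_diff (f1 p) (f2 p) (f3 p)).
    move=> c1 c2 c3 v1 v2; apply: mx_cvg_mul; first apply: mx_cvg_mul.
    - by apply: mx_cvg_tr; apply: mx_cvg_inv => //; exact: cO.
    - exact: cO.
    - by apply: mx_cvg_inv => //; exact: cO.
  apply: cvg_trace; apply: mx_cvg_mul; last exact: cD.
  by apply: mx_cvg_inv; [exact: chart_diff_unit|exact: cD].
have : \forall p \near p0, F p < F p0 + 1.
  by apply: (cvgr_lt _ cF); rewrite ltrDl.
move=> [[A C] [[[A1 A2] [nA1 nA2] sA] nC] /= sF].
have [U nU HU] := phi_frame_nbhs Lq eQ nA1.
have [V nV HV] := phi_frame_nbhs Lx e1 nA2.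
have [W nW HW] := phi_frame_nbhs Lz e2 nC.
exists (F p0 + 1), V, W, U; split=> // x' z' q' Lx' Lz' Lq' Vx' Wz' Uq'.
have [Q' AQ' eQ'] := HU _ Lq' Uq'; have [M1' AM1' eM1'] := HV _ Lx' Vx'.
have [M2' AM2' eM2'] := HW _ Lz' Wz'.
exists Q', M1', M2', N1, N2; split=> //; apply: ltW.
by apply: (sF ((Q', M1'), M2')); split=> //; apply: sA.
Qed.

End BoundaryMap.

(** * Sums over the gaps of a subset of the line *)

Section GapSums.
Variables (R : realType) (I : eqType) (L : set R) (gap : I -> Prop) (a b : I -> R)
  (F : R -> R).
Hypotheses (gap_lt : forall i, gap i -> a i < b i)
  (gap_left : forall i, gap i -> L (a i)) (gap_right : forall i, gap i -> L (b i))
  (gap_empty : forall i x, gap i -> L x -> a i < x < b i -> False)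
  (gap_inj : forall i j, gap i -> gap j -> a i = a j -> b i = b j -> i = j)
  (F_homo : forall x z, L x -> L z -> x <= z -> F x <= F z).
Implicit Types (x z : R) (s t : seq I).

Definition gaps_in x z s := forall i, i \in s -> [/\ gap i, x <= a i & b i <= z].

(** The ends of a gap belong to [L], so none is interior to another gap; overlapping gaps would
    share both ends. *)
Lemma gap_disjoint i j : gap i -> gap j -> i != j -> b i <= a j \/ b j <= a i.
Proof.
move=> gi gj ij; have [|h1] := leP (b i) (a j); first by left.
have [|h2] := leP (b j) (a i); first by right.
exfalso; move/eqP: ij; apply; apply: gap_inj => //; apply/eqP; rewrite eq_le.
  apply/andP; split; rewrite leNgt; apply/negP => h.
    by apply: (gap_empty gj (gap_left gi)); rewrite h h2.
  by apply: (gap_empty gi (gap_left gj)); rewrite h h1.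
apply/andP; split; rewrite leNgt; apply/negP => h.
  by apply: (gap_empty gi (gap_right gj)); rewrite h h2.
by apply: (gap_empty gj (gap_right gi)); rewrite h h1.
Qed.

(** One gap is removed and the others are split into those on its left and those on its right, where
    induction on the number of gaps applies. *)
Lemma gap_sum_le x z s : L x -> L z -> x <= z -> uniq s -> gaps_in x z s ->
  \sum_(i <- s) (F (b i) - F (a i)) <= F z - F x.
Proof.
have [N] := ubnP (size s); elim: N s x z => // N IH [|i s] x z /= sN Lx Lz xz.
  by move=> _ _; rewrite big_nil subr_ge0 F_homo.
move=> /andP[is_ us] gs; have [gi xa bz] := gs i (mem_head _ _).
have ab := ltW (gap_lt gi).
rewrite big_cons (bigID (fun j => b j <= a i)) /=.
rewrite -(big_filter _ (fun j => b j <= a i)) -(big_filter _ (fun j => ~~ (b j <= a i))).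
have sub (P : pred I) : {subset [seq j <- s | P j] <= s}.
  by move=> j; rewrite mem_filter => /andP[].
have h1 : \sum_(j <- [seq j <- s | b j <= a i]) (F (b j) - F (a j)) <= F (a i) - F x.
  apply: IH => //; [|exact: gap_left|exact: filter_uniq|].
    by apply: (leq_ltn_trans _ (sN : (size s < N)%N)); rewrite size_filter count_size.
  move=> j js; have [gj xj _] := gs j (mem_behead (s := i :: s) (sub _ _ js)).
  by split=> //; move: js; rewrite mem_filter => /andP[].
have h2 : \sum_(j <- [seq j <- s | ~~ (b j <= a i)]) (F (b j) - F (a j)) <=
    F z - F (b i).
  apply: IH => //; [|exact: gap_right|exact: filter_uniq|].
    by apply: (leq_ltn_trans _ (sN : (size s < N)%N)); rewrite size_filter count_size.
  move=> j js; have [gj _ jz] := gs j (mem_behead (s := i :: s) (sub _ _ js)).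
  split=> //; have ij : i != j by apply: contraNneq is_ => ->; exact: sub js.
  have [//|] := gap_disjoint gi gj ij.
  by move: js; rewrite mem_filter => /andP[/negP].
lra.
Qed.

Lemma gap_sum_subset s t : uniq s -> uniq t -> {subset s <= t} ->
  (forall i, i \in t -> gap i) ->
  \sum_(i <- s) (F (b i) - F (a i)) <= \sum_(i <- t) (F (b i) - F (a i)).
Proof.
move=> us ut st gt; rewrite [X in _ <= X](bigID (mem s)) /=.
have -> : \sum_(i <- t | i \in s) (F (b i) - F (a i)) = \sum_(i <- s) (F (b i) - F (a i)).
  rewrite -big_filter; apply: perm_big; apply: uniq_perm => //.
    exact: filter_uniq.
  by move=> i; rewrite mem_filter; case: (boolP (i \in s)) => //= /st.
rewrite lerDl big_seq_cond; apply: sumr_ge0 => i /andP[/gt gi _].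
by rewrite subr_ge0 F_homo ?(ltW (gap_lt _)) //; [exact: gap_left|exact: gap_right].
Qed.

(* Each step removes a definite proportion of what is left. *)
Lemma gap_sum_ge (k u v : R) : 0 < k -> k <= 1 ->
  (forall x z, L x -> L z -> u <= x -> x < z -> z <= v -> exists i,
    [/\ gap i, x <= a i, b i <= z & k * (F z - F x) <= F (b i) - F (a i)]) ->
  forall m x z, L x -> L z -> u <= x -> x <= z -> z <= v ->
  exists s, [/\ uniq s, gaps_in x z s &
    (1 - (1 - k) ^+ m) * (F z - F x) <= \sum_(i <- s) (F (b i) - F (a i))].
Proof.
move=> k0 k1 por; elim=> [|m IH] x z Lx Lz ux xz zv.
  by exists [::]; split=> //; rewrite big_nil expr0 subrr mul0r.
move: xz; rewrite le_eqVlt => /predU1P[<-|xz].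
  by exists [::]; split=> //; rewrite big_nil subrr mulr0.
have [i [gi xa bz hi]] := por x z Lx Lz ux xz zv.
have ab := gap_lt gi; have La := gap_left gi; have Lb := gap_right gi.
have [s1 [us1 gs1 h1]] := IH x (a i) Lx La ux xa (le_trans (ltW ab) (le_trans bz zv)).
have [s2 [us2 gs2 h2]] := IH (b i) z Lb Lz (le_trans ux (le_trans xa (ltW ab))) bz zv.
exists (i :: s1 ++ s2); split.
- rewrite /= cat_uniq us1 us2 mem_cat negb_or andbT -!andbA; apply/and3P; split.
  + by apply/negP => /gs1[_ _]; rewrite leNgt ab.
  + by apply/negP => /gs2[_]; rewrite leNgt ab.
  + apply/hasPn => j /gs2[gj bj _]; apply/negP => /gs1[_ _ ja].
    by have := gap_lt gj; rewrite ltNge (le_trans ja) // (le_trans (ltW ab)).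
- move=> j; rewrite inE mem_cat => /or3P[/eqP -> //|/gs1[gj xj ja]|/gs2[gj bj jz]].
    by split=> //; apply: le_trans ja (le_trans (ltW ab) bz).
  by split=> //; apply: le_trans xa (le_trans (ltW ab) bj).
rewrite big_cons big_cat /= exprS.
set r := (1 - k) ^+ m in h1 h2 *.
have r0 : 0 <= r by rewrite exprn_ge0 // subr_ge0.
have : r * (k * (F z - F x)) <= r * (F (b i) - F (a i)) by exact: ler_wpM2l.
lra.
Qed.

End GapSums.

(** * The chart of a peripheral element *)

Section Conjugates.
Variables (G : groupType) (c : G).
Implicit Types (b d e : G).

Lemma power_classP d e : power_class c d e <->
  exists k : nat, e = (c ^+ k * d * (c ^+ k)^-1)%g \/ e = ((c ^+ k)^-1 * d * c ^+ k)%g.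
Proof.
by split=> -[k [] ->]; exists k; rewrite conjgE ?invgK mulgA; [right|left|right|left];
  rewrite ?conjgE ?invgK ?mulgA.
Qed.

Lemma power_class_refl d : power_class c d d.
Proof. by apply/power_classP; exists 0; left; rewrite expg0 invg1 mulg1 mul1g. Qed.

Lemma power_class_step d e : power_class c d e ->
  power_class c d (c * e * c^-1)%g /\ power_class c d (c^-1 * e * c)%g.
Proof.
move=> /power_classP[k [] ->]; split; apply/power_classP.
- by exists k.+1; left; rewrite expgS invgM !mulgA.
- case: k => [|k]; first by exists 1; right; rewrite expg0 expg1 invg1 mulg1 mul1g.
  by exists k; left; rewrite expgS invgM !mulgA mulVg mul1g mulgVK.
- case: k => [|k]; first by exists 1; left; rewrite expg0 expg1 invg1 mulg1 mul1g.
  by exists k; right; rewrite expgSr invgM !mulgA mulgV mul1g mulgK.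
- by exists k.+1; right; rewrite expgSr invgM !mulgA.
Qed.

Lemma power_class_trans d e b : power_class c d e -> power_class c e b ->
  power_class c d b.
Proof.
move=> de /power_classP[k [] ->]; elim: k => [|k IH].
- by rewrite expg0 invg1 mulg1 mul1g.
- by have [+ _] := power_class_step IH; rewrite expgS invgM !mulgA.
- by rewrite expg0 invg1 mulg1 mul1g.
- by have [_ +] := power_class_step IH; rewrite expgSr invgM !mulgA.
Qed.

Lemma power_class_sym d e : power_class c d e -> power_class c e d.
Proof.
move=> /power_classP[k [] ->]; apply/power_classP; exists k; [right|left].
  by rewrite !mulgA mulVg mul1g mulgVK.
by rewrite !mulgA mulgV mul1g mulgK.
Qed.

Lemma power_class_eq d e : power_class c d e -> power_class c d = power_class c e.
Proof.
move=> de; apply/seteqP; split=> b; last exact: power_class_trans.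
exact/power_class_trans/power_class_sym.
Qed.

End Conjugates.

Section Chart.
Variables (R : realType) (G : groupType) (S : surface R G) (c : G).
Variables (g : 'M[R]_2) (T : R).
Hypotheses (bg : boundary_geodesic (ucov S) g) (em : fixm S c = bmob g (fin 0))
  (ep : fixp S c = bmob g (infty R)) (T1 : 1 < T) (tc : translation S g c T)
  (c_per : peripheral S c).
Implicit Types (x y : bdH R) (u v : R) (d e : G).

Let dg : \det g = 1. Proof. by case: bg. Qed.

Definition chart_limit u := 0 < u /\ limit_set S (bmob g (fin u)).

Lemma chart_limit_exists x : limit_set S x -> x <> fixp S c -> x <> fixm S c ->
  exists2 u, chart_limit u & x = bmob g (fin u).
Proof.
move=> Lx; rewrite em ep -(bmobVK x dg) => np nm.
have := limit_set_side bg Lx (rep_hcoord x).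
have [a a0 ->] := rep_bmob (etrans (det_inv2 g) dg) (rep_hcoord x).
move: np nm; case ex : (bmob (inv2 g) x) => [u|] np nm; last by case: np.
rewrite ![(_ *: hcoord _) _ _]mxE !hcoordE mulr1 mulrAC -expr2 pmulr_rge0 ?exprn_even_gt0 //.
rewrite le_eqVlt => /predU1P[u0|u0]; first by case: nm; rewrite -u0.
by exists u => //; split=> //; rewrite /fin -ex bmobVK.
Qed.

Lemma chart_positive3 u v w : u < v -> v < w ->
  positive3 (bmob g (fin u)) (bmob g (fin v)) (bmob g (fin w)).
Proof. by move=> uv vw; rewrite positive3_bmob // /positive3 /= uv vw. Qed.

Lemma chart_positive3_infty u v : positive3 (bmob g (fin u)) (bmob g (fin v))
  (bmob g (infty R)) <-> u < v.
Proof. by rewrite positive3_bmob // /positive3 /= ?andbT ?andbF ?orbF. Qed.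

Lemma chart_translation d U u : translation S g d U ->
  bmob (hol S d) (bmob g (fin u)) = bmob g (fin (U ^+ 2 * u)).
Proof.
move=> [U0 eU]; have Un0 := lt0r_neq0 U0.
rewrite -bmobM ?det_hol //.
have -> : bmob (hol S d *m g) (fin u) = bmob (g *m diag2 U) (fin u).
  by case: eU => ->; rewrite ?bmob_opp.
rewrite bmobM ?det_diag2 //; congr bmob.
apply: (rep_inj (rep_bmob (det_diag2 Un0) (rep_hcoord _))).
exists U^-1; rewrite ?invr_eq0 //; apply: cV2P; rewrite !mulmx2E !mx2E !mxE /=; field=> //.
Qed.

Lemma chart_limit_translation d U u : translation S g d U ->
  chart_limit u -> chart_limit (U ^+ 2 * u).
Proof.
move=> td [u0 Lu]; have [U0 _] := td; split; first by rewrite mulr_gt0 ?exprn_gt0.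
by rewrite -(chart_translation _ td); exact: limit_set_hol.
Qed.

Definition coordinate x : R := if bmob (inv2 g) x is Some u then u else 0.
(** With the surface on the right, the limit set fills part of the arc from [fixm] to [fixp], so the
    complementary gap begins at [fixp]. *)
Definition gap_left d := coordinate (fixp S d).
Definition gap_right d := coordinate (fixm S d).
Definition is_gap d := peripheral S d /\ d <> c.

Lemma coordinateK u : coordinate (bmob g (fin u)) = u.
Proof. by rewrite /coordinate bmobK. Qed.

Variable y0 : R.
Hypothesis Ly0 : chart_limit y0.

Let T2 : 1 < T ^+ 2. Proof. by rewrite expr_gt1 // ltW // (lt_trans ltr01). Qed.

Lemma chart_limit_pow u k : chart_limit u ->
  chart_limit ((T ^+ 2) ^+ k * u) /\ chart_limit (u / (T ^+ 2) ^+ k).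
Proof.
move=> Lu; have tk := translationX k tc; rewrite -exprM mulnC exprM.
split; first exact: chart_limit_translation tk Lu.
rewrite mulrC -exprVn; exact: chart_limit_translation (translationV tk) Lu.
Qed.

Lemma pow_unbounded u v : 0 < u -> exists k, v < (T ^+ 2) ^+ k * u.
Proof.
move=> u0; have [k Hk] := exprn_unbounded (v / u) T2.
by exists k; rewrite -ltr_pdivrMr.
Qed.

(** The point is that no gap ends at 0 or infinity. The limit points [y0] times powers of [T ^+ 2]
    accumulate at both, and 0 and infinity are limit points themselves; a gap sharing one end with
    [c] would contain one of these, and a gap sharing both is that of [c]. *)
Lemma gapP d : is_gap d -> [/\ chart_limit (gap_left d), chart_limit (gap_right d),
  gap_left d < gap_right d, fixp S d = bmob g (fin (gap_left d)) &
  fixm S d = bmob g (fin (gap_right d))].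
Proof.
move=> [pd dc]; have [Lp Lm] := peripheral_limit_set pd.
have gapd x : limit_set S x -> ~ positive3 (fixp S d) x (fixm S d) by exact: peripheral_gap.
have [Lcp Lcm] := peripheral_limit_set c_per; rewrite ep in Lcp; rewrite em in Lcm.
have [y00 Ly] := Ly0.
have neq : fixp S d <> fixm S d.
  have [_ [h [bh -> ->]]] := pd; have [dh _ _] := bh.
  by move=> /(congr1 (bmob (inv2 h))); rewrite !bmobK.
have [e1|n1] := pselect (fixp S d = fixp S c).
  exfalso; rewrite e1 ep in gapd neq.
  have [e2|n2] := pselect (fixm S d = fixm S c).
    by apply: dc; apply: (peripheral_uniq bg) => //; rewrite ?e1 ?e2.
  have [|v [v0 _] ev] := chart_limit_exists Lm _ n2; first by rewrite ep => /esym.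
  by apply: (gapd _ Lcm); rewrite ev positive3_bmob // /positive3 /= v0.
have [e2|n2] := pselect (fixp S d = fixm S c).
  exfalso; rewrite e2 em in gapd neq.
  have [e3|n3] := pselect (fixm S d = fixp S c).
    by apply: (gapd _ Ly); rewrite e3 ep positive3_bmob // /positive3 /= y00.
  have [|v [v0 _] ev] := chart_limit_exists Lm n3; first by rewrite em => /esym.
  have [k Hk] := pow_unbounded y0 v0.
  have [_ Lk] := chart_limit_pow k Ly0; have [k0 Lk'] := Lk.
  apply: (gapd _ Lk'); rewrite ev; apply: chart_positive3 => //.
  by rewrite ltr_pdivrMr ?exprn_gt0 ?(lt_trans ltr01) // mulrC.
have [u Lu eu] := chart_limit_exists Lp n1 n2.
have [e3|n3] := pselect (fixm S d = fixp S c).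
  exfalso; have [u0 _] := Lu; have [k Hk] := pow_unbounded u y00.
  have [[_ Lk] _] := chart_limit_pow k Ly0.
  by apply: (gapd _ Lk); rewrite e3 ep eu; apply/chart_positive3_infty.
have [e4|n4] := pselect (fixm S d = fixm S c).
  exfalso; apply: (gapd _ Lcp); rewrite e4 em eu positive3_bmob // /positive3 /=.
  by case: Lu => ->.
have [v Lv ev] := chart_limit_exists Lm n3 n4.
rewrite /gap_left /gap_right eu ev !coordinateK; split=> //.
rewrite ltNge le_eqVlt; apply/negP => /predU1P[e|vu].
  by apply: neq; rewrite eu ev e.
by apply: (gapd _ Lcp); rewrite eu ev positive3_bmob // /positive3 /= vu.
Qed.

Lemma gap_empty d u : is_gap d -> chart_limit u -> gap_left d < u < gap_right d -> False.
Proof.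
move=> gd [_ Lu] /andP[h1 h2]; have [_ _ _ eu ev] := gapP gd; have [pd _] := gd.
by apply: (peripheral_gap pd Lu); rewrite eu ev; exact: chart_positive3.
Qed.

Lemma gap_inj d e : is_gap d -> is_gap e -> gap_left d = gap_left e ->
  gap_right d = gap_right e -> d = e.
Proof.
move=> gd ge e1 e2; have [_ _ _ ed1 ed2] := gapP gd; have [_ _ _ ee1 ee2] := gapP ge.
have [pd _] := gd; have [pe _] := ge; have [_ [h [bh hm hp]]] := pd.
by apply: (peripheral_uniq bh) => //; rewrite ?ee1 ?ee2 -?e1 -?e2 -?ed1 -?ed2.
Qed.

Lemma gap_conj d (b : G) U : is_gap d -> translation S g b U -> commute b c ->
  [/\ is_gap (b * d * b^-1)%g, gap_left (b * d * b^-1)%g = U ^+ 2 * gap_left d &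
      gap_right (b * d * b^-1)%g = U ^+ 2 * gap_right d].
Proof.
move=> gd tb bc; have [_ _ _ e1 e2] := gapP gd; have [pd dc] := gd.
have [pb eb1 eb2] := peripheral_conj b pd.
split.
- split=> // e; apply: dc; apply: (mulgI b); apply: (mulIg b^-1%g).
  by rewrite e (bc : (b * c = c * b)%g) mulgK.
- by rewrite /gap_left eb1 e1 (chart_translation _ tb) !coordinateK.
- by rewrite /gap_right eb2 e2 (chart_translation _ tb) !coordinateK.
Qed.

Lemma commute_pow k : commute (c ^+ k)%g c.
Proof. by rewrite /commute -expgSr -expgS. Qed.

Lemma gap_pow d k : is_gap d ->
  [/\ is_gap (c ^+ k * d * (c ^+ k)^-1)%g,
    gap_left (c ^+ k * d * (c ^+ k)^-1)%g = (T ^+ 2) ^+ k * gap_left d &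
    gap_right (c ^+ k * d * (c ^+ k)^-1)%g = (T ^+ 2) ^+ k * gap_right d].
Proof.
move=> gd; have [] := gap_conj gd (translationX k tc) (commute_pow k).
by rewrite -exprM mulnC exprM.
Qed.

Lemma gap_powV d k : is_gap d ->
  [/\ is_gap ((c ^+ k)^-1 * d * c ^+ k)%g,
    gap_left ((c ^+ k)^-1 * d * c ^+ k)%g = gap_left d / (T ^+ 2) ^+ k &
    gap_right ((c ^+ k)^-1 * d * c ^+ k)%g = gap_right d / (T ^+ 2) ^+ k].
Proof.
move=> gd; have bc : commute (c ^+ k)^-1%g c.
  apply: (mulgI (c ^+ k)%g); rewrite mulVKg mulgA.
  by rewrite (commute_pow k : (c ^+ k * c = c * c ^+ k)%g) mulgK.
have [] := gap_conj gd (translationV (translationX k tc)) bc.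
by rewrite invgK exprVn -exprM mulnC exprM !(mulrC _^-1).
Qed.

Definition in_window d := y0 <= gap_left d /\ gap_right d <= T ^+ 2 * y0.

(** Since [T ^+ 2 * y0] and its translates are limit points, no gap straddles the border between two
    translates of the window. *)
Lemma window_exists d : is_gap d -> exists e, [/\ power_class c d e, is_gap e & in_window e].
Proof.
move=> gd; have [[a0 _] _ _ _ _] := gapP gd; have [y00 _] := Ly0.
have [m Hm] := pow_unbounded y0 a0.
(* A preliminary move beyond [y0], after which the translation back into the window has a natural
   exponent. *)
have [gd' a' b'] := gap_pow m gd; set d' := (_ * d * _)%g in gd' a' b'.
have ex : exists k, gap_left d' < (T ^+ 2) ^+ k * y0 by exact: pow_unbounded.
case: (ex_minnP ex) => -[|k] Hk mk.
  by move: Hk; rewrite expr0 mul1r a' ltNge (ltW Hm).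
have [gd'' a'' b''] := gap_powV k gd'; set d'' := (_ * d' * _)%g in gd'' a'' b''.
have qk : 0 < (T ^+ 2) ^+ k by rewrite exprn_gt0 // (lt_trans ltr01).
exists d''; split=> //.
  apply: (@power_class_trans _ _ _ d'); apply/power_classP; [exists m|exists k].
    by left.
  by right.
split; rewrite ?a'' ?b''.
  rewrite ler_pdivlMr // mulrC leNgt; apply/negP => h.
  by have := mk k h; rewrite ltnn.
rewrite ler_pdivrMr // leNgt; apply/negP => h.
have [Lk _] := chart_limit_pow k.+1 Ly0.
apply: (gap_empty gd' Lk); rewrite Hk /=; apply: le_lt_trans h.
by rewrite exprS mulrAC.
Qed.

(** A translate by a positive power starts at or beyond the right end of the window. *)
Lemma window_uniq d e : is_gap d -> in_window d -> is_gap e -> in_window e ->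
  power_class c d e -> d = e.
Proof.
move=> gd wd ge we.
suff H d' e' k : is_gap d' -> in_window d' -> is_gap e' -> in_window e' ->
    e' = (c ^+ k * d' * (c ^+ k)^-1)%g -> d' = e'.
  move=> /power_classP[k [e1|e1]]; first exact: (H d e k).
  symmetry; apply: (H e d k) => //; rewrite e1.
  by rewrite !mulgA mulgV mul1g mulgK.
move=> gd' [w1 w2] ge' [w3 w4] ee; case: k ee => [|k] ee.
  by rewrite ee expg0 invg1 mulg1 mul1g.
have [_ ea eb] := gap_pow k.+1 gd'; rewrite -ee in ea eb.
have [_ _ ab' _ _] := gapP ge'; have [[a0 _] _ _ _ _] := gapP gd'.
have : T ^+ 2 * y0 <= gap_left e'.
  rewrite ea (exprS (T ^+ 2) k) -mulrA ler_pM2l ?(lt_trans ltr01 T2) //.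
  by rewrite (le_trans w1) // ler_peMl ?(ltW a0) // exprn_ege1 // ltW.
by move=> h; have := lt_le_trans ab' w4; rewrite ltNge h.
Qed.

End Chart.

(** * The determinant function in the chart *)

Section Values.
Variables (R : realType) (G : groupType) (S : surface R G) (c : G).
Variables (g : 'M[R]_2) (T : R).
Hypotheses (bg : boundary_geodesic (ucov S) g) (em : fixm S c = bmob g (fin 0))
  (ep : fixp S c = bmob g (infty R)) (T1 : 1 < T) (tc : translation S g c T)
  (c_per : peripheral S c).
Variable y0 : R.
Hypothesis Ly0 : chart_limit S g y0.
Variables (n : nat) (rho : G -> 'M[R]_(n + n)) (phi : bdH R -> {vspace 'cV[R]_(n + n)}).
Hypotheses (sp_rho : forall a, symplectic (rho a)) (phi_bd : boundary_map S rho phi).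
Implicit Types (x y : bdH R) (u v : R) (d e : G).

Let dg : \det g = 1. Proof. by case: bg. Qed.

Lemma chart_matrices : exists s (X : R -> 'M[R]_n), [/\ symplectic s,
  phi (fixp S c) = act s (lag_infty R n), phi (fixm S c) = act s (lag_mx 0) &
  forall u, chart_limit S g u ->
    pd (X u) /\ phi (bmob g (fin u)) = act s (lag_mx (X u))].
Proof.
have [Lcp Lcm] := peripheral_limit_set c_per.
have mx u : chart_limit S g u -> maximal3 (phi (fixp S c)) (phi (fixm S c)) (phi (bmob g (fin u))).
  move=> [u0 Lu]; apply: (phi_maximal phi_bd) => //.
  by rewrite em ep positive3_bmob // /positive3 /= u0.
have [s ss [e1 e2 _]] := mx _ Ly0.
have /choice[X HX] : forall u, exists X, chart_limit S g u ->
    pd X /\ phi (bmob g (fin u)) = act s (lag_mx X).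
  move=> u; have [Lu|nL] := pselect (chart_limit S g u); last by exists 0.
  have := mx u Lu; rewrite e1 e2 => /(maximal3_lag_mx ss)[A uA eA].
  by exists (A *m A^T) => _; split=> //; exists A.
by exists s, X.
Qed.

Variables (s : 'M[R]_(n + n)) (X : R -> 'M[R]_n).
Hypotheses (ss : symplectic s) (phi_p : phi (fixp S c) = act s (lag_infty R n))
  (phi_m : phi (fixm S c) = act s (lag_mx 0))
  (HX : forall u, chart_limit S g u ->
    pd (X u) /\ phi (bmob g (fin u)) = act s (lag_mx (X u))).
Local Notation chart := (chart_limit S g).

Lemma chart_pd u : chart u -> pd (X u).
Proof. by case/HX. Qed.

Lemma chart_phi u : chart u -> phi (bmob g (fin u)) = act s (lag_mx (X u)).
Proof. by case/HX. Qed.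

Lemma chart_matrix_lt u v : chart u -> chart v -> u < v -> pd (X v - X u).
Proof.
move=> Lu Lv uv; have [Lcp _] := peripheral_limit_set c_per.
have : maximal3 (phi (fixp S c)) (phi (bmob g (fin u))) (phi (bmob g (fin v))).
  apply: (phi_maximal phi_bd) => //; [by case: Lu|by case: Lv|].
  by rewrite ep positive3_bmob // /positive3 /= uv.
rewrite phi_p !chart_phi // => /(maximal3_sub ss (pd_sym (chart_pd Lu)))[A uA eA].
by exists A.
Qed.

Lemma chart_matrix_le u v : chart u -> chart v -> u <= v -> psd (X v - X u).
Proof.
move=> Lu Lv; rewrite le_eqVlt => /predU1P[<-|uv]; last exact/pd_psd/chart_matrix_lt.
by exists 0; rewrite subrr mul0mx.
Qed.

Definition log_det u := ln (\det (X u)).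

Lemma log_det_homo u v : chart u -> chart v -> u <= v -> log_det u <= log_det v.
Proof.
move=> Lu Lv uv; have pu := chart_pd Lu; have pv := chart_pd Lv.
have := pd_ln_det pv pu.
have := psd_mxtrace_ge0 (pd_psd (pd_invmx pv)) (chart_matrix_le Lu Lv uv).
rewrite mulmxBr raddfB /= mulVmx ?pd_unit // mxtrace1 /log_det; lra.
Qed.

Lemma cross_ratioE u v : chart u -> chart v ->
  cross_ratio phi (fixm S c) (bmob g (fin u)) (fixp S c) (bmob g (fin v)) =
  \det (X u) / \det (X v).
Proof.
move=> Lu Lv; rewrite /cross_ratio phi_m phi_p !chart_phi //.
by rewrite detR_lag // pd_unit //; exact: chart_pd.
Qed.

(** As [c] fixes both 0 and infinity, [rho c] acts on the chart by a congruence X -> A X A^T, which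
    adds ln (det A ^ 2). Increments over gaps are therefore constant on conjugation classes. *)
Lemma log_det_translation : exists k, forall u, chart u ->
  log_det (T ^+ 2 * u) = log_det u + k.
Proof.
have [_ _ eq_phi _ _] := phi_bd; have [Lcp Lcm] := peripheral_limit_set c_per.
have sr : symplectic (rho c *m s).
  by rewrite /symplectic -[RHS]ss -[in RHS](sp_rho c) trmx_mul !mulmxA.
have act_mul U : act (rho c *m s) U = act (rho c) (act s U).
  apply/vspaceP => v; apply/memv_imgP/memv_imgP.
    by move=> [w wU ->]; exists (s *m w); rewrite ?lfunE /= ?mulmxA //;
      apply/memv_imgP; exists w; rewrite ?lfunE.
  by move=> [w' /memv_imgP[w wU ->] ->]; exists w; rewrite ?lfunE //= ?lfunE /= ?mulmxA.
have inf_fix : bmob (hol S c) (bmob g (infty R)) = bmob g (infty R).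
  have [T0 eT] := tc; rewrite -bmobM ?det_hol //.
  have -> : bmob (hol S c *m g) (infty R) = bmob (g *m diag2 T) (infty R).
    by case: eT => ->; rewrite ?bmob_opp.
  have tn0 : T != 0 by rewrite gt_eqF.
  rewrite bmobM ?det_diag2 //; congr bmob.
  by rewrite /bmob mx2E eqxx.
have e1 : act s (lag_infty R n) = act (rho c *m s) (lag_infty R n).
  by rewrite act_mul -phi_p -eq_phi // ep inf_fix.
have e2 : act s (lag_mx 0) = act (rho c *m s) (lag_mx 0).
  by rewrite act_mul -phi_m -eq_phi // em (chart_translation bg _ tc) mulr0.
have [A uA [eA eB]] := maximal3_frames ss sr e1 e2.
have dA : \det A != 0 by rewrite -unitfE -unitmxE.
exists (ln (\det A ^+ 2)) => u Lu.
have LT := chart_limit_translation bg tc Lu.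
rewrite /log_det; have -> : X (T ^+ 2 * u) = A *m X u *m A^T.
  apply: (lag_mx_inj ss); rewrite -(chart_phi LT) -(chart_translation bg _ tc).
  rewrite eq_phi ?(chart_phi Lu) -?act_mul; last by case: Lu.
  have uAT := trmx_unit uA.
  rewrite !lag_mxE !act_colspan.
  have uB : invmx A^T \in unitmx by rewrite unitmx_inv.
  rewrite -[RHS](colspan_mulmx _ uB); congr colspan.
  have fE Y : frame_mx Y = frame_infty R n *m Y + frame_mx 0.
    by rewrite /frame_mx /frame_infty mul_col_mx mul1mx mul0mx add_col_mx addr0 add0r.
  rewrite fE mulmxDr mulmxA eA eB [in RHS]fE mulmxDr mulmxDl; congr (_ + _).
  by rewrite -!mulmxA mulmxV // mulmx1.
rewrite !det_mulmx det_tr mulrAC mulrC -expr2 lnM ?posrE ?exprn_even_gt0 //.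
exact/pd_det_gt0/chart_pd.
Qed.

Definition jump d := log_det (gap_right S g d) - log_det (gap_left S g d).

Local Notation gap := (is_gap S c).

Lemma jump_ge0 d : gap d -> 0 <= jump d.
Proof.
move=> gd; have [L1 L2 lt _ _] := gapP bg em ep T1 tc c_per Ly0 gd.
by rewrite subr_ge0 log_det_homo // ltW.
Qed.

Lemma jump_power_class d e : gap d -> power_class c d e -> gap e /\ jump e = jump d.
Proof.
have [k Hk] := log_det_translation.
have step b : gap b -> gap (c * b * c^-1)%g /\ jump (c * b * c^-1)%g = jump b.
  move=> gb; have [L1 L2 _ _ _] := gapP bg em ep T1 tc c_per Ly0 gb.
  have := gap_pow bg em ep T1 tc c_per Ly0 1 gb; rewrite expg1 expr1 => -[gb' e1 e2].
  by split=> //; rewrite /jump e1 e2 !Hk //; ring.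
have stepV b : gap b -> gap (c^-1 * b * c)%g /\ jump (c^-1 * b * c)%g = jump b.
  move=> gb; have [gb' _ _] := gap_powV bg em ep T1 tc c_per Ly0 1 gb.
  rewrite expg1 in gb'; split=> //; have [_ <-] := step _ gb'.
  by rewrite !mulgA mulgV mul1g mulgK.
move=> gd /power_classP[m [] ->].
  elim: m => [|m [g1 j1]]; first by rewrite expg0 invg1 mulg1 mul1g.
  have [g2 j2] := step _ g1; rewrite expgS invgM !mulgA in g2 j2 *.
  by rewrite j2 j1.
elim: m => [|m [g1 j1]]; first by rewrite expg0 invg1 mulg1 mul1g.
have [g2 j2] := stepV _ g1; rewrite expgSr invgM !mulgA in g2 j2 *.
by rewrite j2 j1.
Qed.

(** [ln_det_porosity] with [X y0] and [X v] as outer matrices gives one proportion for all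
    subintervals of [y0, v]. *)
Lemma chart_porosity v : chart v -> exists k : R, [/\ 0 < k, k <= 2^-1 &
  forall x z : R, chart x -> chart z -> y0 <= x -> x < z -> z <= v -> exists d,
    [/\ gap d, x <= gap_left S g d, gap_right S g d <= z &
        k * (log_det z - log_det x) <= jump d]].
Proof.
move=> Lv; have [C HC] := gap_ratio_uniform sp_rho phi_bd.
(* The 2 keeps the proportion at most 1/2, so that 1 - k is positive. *)
pose C' := Num.max 2 (C * (n%:R * \tr (invmx (X y0) *m X v))).
have C2 : 2 <= C' by rewrite le_max lexx.
have C0 : 0 < C' by apply: lt_le_trans C2.
exists C'^-1; split; [by rewrite invr_gt0|by rewrite lef_pV2 ?posrE|].
move=> x z Lx Lz yx xz zv; have [Lcp Lcm] := peripheral_limit_set c_per.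
have := Lx => -[x0 Lx']; have := Lz => -[z0 Lz'].
have [|d [pd d1 d2 d3 [Q [M1 [M2 [N1 [N2 [[f1 f2 f3 f4 f5] le]]]]]]]] :=
    HC (bmob g (fin x)) (bmob g (fin z)) (fixp S c) Lx' Lz' Lcp.
  by rewrite ep; apply/(chart_positive3_infty bg).
have gd : gap d.
  by split=> // e; apply: (positive3_neq (positive3_rot (positive3_rot d3))); rewrite e.
have [La Lb ab eu ev] := gapP bg em ep T1 tc c_per Ly0 gd.
set a := gap_left S g d in La ab eu *; set b := gap_right S g d in Lb ab ev *.
have xb : x < b by apply/(chart_positive3_infty bg); rewrite -ep -ev.
have az : a < z.
  by apply/(chart_positive3_infty bg); rewrite -ep -eu; exact: positive3_rot.
(* The gap meets the interval and contains neither [x] nor [z], which are limit points, so it lies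
   inside. *)
have xa : x <= a.
  rewrite leNgt; apply/negP => ax.
  by apply: (gap_empty bg em ep T1 tc c_per Ly0 gd Lx); rewrite ax.
have bz : b <= z.
  rewrite leNgt; apply/negP => zb.
  by apply: (gap_empty bg em ep T1 tc c_per Ly0 gd Lz); rewrite az.
exists d; split=> //.
have pab := chart_matrix_lt La Lb ab.
rewrite (@chart_ratioE _ _ s (X x) (X z) (X a) (X b)) // in le; first last.
- exact/pd_sym/chart_pd.
- exact/pd_sym/chart_pd.
- by rewrite f5 ev chart_phi.
- by rewrite f4 eu chart_phi.
- by rewrite f3 chart_phi.
- by rewrite f2 chart_phi.
- by rewrite f1.
have := @ln_det_porosity _ _ (X y0) (X x) (X a) (X b) (X z) (X v) C.
move=> /(_ (chart_pd Ly0) (chart_pd Lx) (chart_pd La) (chart_pd Lb) (chart_pd Lz) (chart_pd Lv)).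
move=> /(_ (chart_matrix_le Ly0 Lx yx) (chart_matrix_le Lb Lv (le_trans bz zv)) pab
  (chart_matrix_le Lx Lz (ltW xz)) le) => H.
rewrite mulrC ler_pdivrMr // mulrC; apply: le_trans H _.
rewrite ler_wpM2r //; first by have := jump_ge0 gd.
by rewrite le_max lexx orbT.
Qed.

End Values.

(** * The identity for the period *)

Theorem theorem2 (R : realType) (G : groupType) (S : surface R G)
  (X : finite_area_structure S) (n : nat) (n_gt0 : (0 < n)%N)
  (rho : G -> 'M[R]_(n + n)) (rho_max : maximal_rep X rho)
  (rho_shilov : forall d, peripheral S d -> shilov_hyperbolic (rho d))
  (phi : bdH R -> {vspace 'cV[R]_(n + n)}) (phi_bd : boundary_map S rho phi)
  (c : G) (c_per : peripheral S c)
  (d : set G -> G) (d_rep : forall al, orthotubes S c al -> al (d al))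
  (y : bdH R) (y_lim : limit_set S y)
  (y_fixp : y <> fixp S c) (y_fixm : y <> fixm S c) :
  let B al := cross_ratio phi (fixm S c) (fixm S (d al))
                              (fixp S c) (fixp S (d al)) in
  [/\ period_arg S phi c y != 0,
      forall al, orthotubes S c al -> 0 < B al &
      has_sum (orthotubes S c) (fun al => ln (B al)) (period S phi c y)].
Proof.
have [[sp_rho _] _] := rho_max => B.
have [_ [g [bg em ep]]] := c_per; have [dg _ _] := bg.
have [T T1 tc] := fix_translation bg em ep.
have [y0 Ly0 ey] := chart_limit_exists bg em ep y_lim y_fixp y_fixm.
have [s [M [ss phi_p phi_m HM]]] := chart_matrices bg em ep c_per Ly0 phi_bd.
have gapP' := gapP bg em ep T1 tc c_per Ly0.
have crE := cross_ratioE ss phi_p phi_m HM.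
have Ly1 := chart_limit_translation bg tc Ly0; set y1 := T ^+ 2 * y0 in Ly1.
have y01 : y0 <= y1.
  have [/ltW y00 _] := Ly0; rewrite ler_peMl // exprn_ege1 // ltW //.
have dpos u : chart_limit S g u -> 0 < \det (M u).
  by move=> /HM[/pd_det_gt0].
have pE : period_arg S phi c y = \det (M y1) / \det (M y0).
  by rewrite /period_arg ey (chart_translation bg _ tc) crE.
have pgt0 : 0 < period_arg S phi c y by rewrite pE divr_gt0 ?dpos.
have perE : period S phi c y = log_det M y1 - log_det M y0.
  by rewrite /period gtr0_norm // pE ln_div ?posrE ?dpos.
have gapD al : orthotubes S c al -> is_gap S c (d al) /\ al = power_class c (d al).
  move=> Dal; have := d_rep _ Dal; have [b [pb bc ->]] := Dal => cbd.
  have gb : is_gap S c b by [].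
  by have [] := jump_power_class bg em ep T1 tc c_per Ly0 sp_rho phi_bd ss phi_p phi_m HM
    gb cbd; split=> //; exact: power_class_eq.
have BE al : orthotubes S c al -> 0 < B al /\ ln (B al) = jump S g M (d al).
  move=> /gapD[gd _]; have [L1 L2 _ e1 e2] := gapP' _ gd.
  rewrite /B e1 e2 crE // ln_div ?posrE ?dpos //; split=> //.
  by rewrite divr_gt0 ?dpos.
split; [by rewrite gt_eqF|by move=> al /BE[]|].
(* The increment being constant on a class, each class can be represented by its gap in the window;
   distinct classes then give disjoint gaps of one interval. *)
have /choice[w Hw] : forall al, exists e, orthotubes S c al -> [/\ is_gap S c e,
    in_window S g T y0 e, al = power_class c e & jump S g M e = ln (B al)].
  move=> al; have [Dal|nD] := pselect (orthotubes S c al); last by exists c.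
  have [gd eal] := gapD _ Dal.
  have [e [de ge we]] := window_exists bg em ep T1 tc c_per Ly0 gd.
  exists e => _; split=> //; first by rewrite eal; exact: power_class_eq.
  have [_ ->] := jump_power_class bg em ep T1 tc c_per Ly0 sp_rho phi_bd ss phi_p phi_m HM
    gd de.
  by have [_ ->] := BE _ Dal.
have winU := window_uniq bg em ep T1 tc c_per Ly0.
have g_lt i : is_gap S c i -> gap_left S g i < gap_right S g i by case/gapP'.
have g_left i : is_gap S c i -> chart_limit S g (gap_left S g i) by case/gapP'.
have g_right i : is_gap S c i -> chart_limit S g (gap_right S g i) by case/gapP'.
have F_homo := log_det_homo bg ep c_per phi_bd ss phi_p HM.
have g_empty := gap_empty bg em ep T1 tc c_per Ly0.
have g_inj := gap_inj bg em ep T1 tc c_per Ly0.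
move=> eps eps0; rewrite perE; set P := log_det M y1 - log_det M y0.
have P0 : 0 <= P by rewrite subr_ge0 F_homo.
have [k [k0 k2 por]] := chart_porosity bg em ep T1 tc c_per Ly0 sp_rho phi_bd ss phi_p HM Ly1.
have r0 : 0 < 1 - k by lra.
have k1 : k <= 1 by lra.
(* After m rounds of extracting gaps, less than eps of the increment [P] is missing. *)
have [|m Hm] := @exprn_unbounded R (1 - k)^-1 (P / eps).
  by rewrite invf_gt1 //; lra.
have {}Hm : (1 - k) ^+ m * P < eps.
  by move: Hm; rewrite exprVn ltr_pdivrMr // ltr_pdivlMl ?exprn_gt0.
have [t [ut gt ht]] :=
  gap_sum_ge g_lt g_left g_right k0 k1 por m Ly0 Ly1 (lexx _) y01 (lexx _).
have Dt i : i \in t -> orthotubes S c (power_class c i).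
  by move=> /gt[[pi ic] _ _]; exists i; split.
exists [set power_class c i | i in [set` t]]; split.
- exact/finite_image/finite_seq.
- by move=> _ [i it <-]; exact: Dt.
move=> A /finite_seqP[r' Ar'].
have [r [ur Ar]] : exists r, uniq r /\ A = [set` r].
  exists (undup r'); split; first exact: undup_uniq.
  by rewrite Ar'; apply/seteqP; split=> al /=; rewrite mem_undup.
move=> tA AD; rewrite Ar -fsbig_seq //=.
have Dr al : al \in r -> orthotubes S c al by move=> alr; apply: AD; rewrite Ar.
have -> : \sum_(al <- r) ln (B al) = \sum_(i <- map w r) jump S g M i.
  by rewrite big_map; apply: eq_big_seq => al /Dr /Hw[_ _ _ ->].
have uw : uniq (map w r).
  rewrite map_inj_in_uniq // => a b /Dr /Hw[_ _ ea _] /Dr /Hw[_ _ eb _] e.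
  by rewrite ea eb e.
have gw i : i \in map w r -> [/\ is_gap S c i, y0 <= gap_left S g i &
    gap_right S g i <= y1].
  by move=> /mapP[al /Dr /Hw[gi [wi1 wi2] _ _] ->]; split.
(* Any finite set of classes gives at most [P] by disjointness; one containing the classes of [t]
   gives at least the sum over [t], since the summands are nonnegative. *)
have up := gap_sum_le g_lt g_left g_right g_empty g_inj F_homo Ly0 Ly1 y01 uw gw.
have lo := gap_sum_subset g_lt g_left g_right F_homo ut uw.
have {}lo : \sum_(i <- t) jump S g M i <= \sum_(i <- map w r) jump S g M i.
  apply: lo => [i it|i /gw[]//].
  have Ai : A (power_class c i) by apply: tA; exists i.
  have [ge we ei _] := Hw _ (AD _ Ai); have [gi wi1 wi2] := gt i it.
  apply/mapP; exists (power_class c i); first by rewrite Ar in Ai.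
  apply: (winU i) => //.
  by have := power_class_refl c (w (power_class c i)); rewrite -ei.
have {}up : \sum_(i <- map w r) jump S g M i <= P by [].
have {}ht : (1 - (1 - k) ^+ m) * P <= \sum_(i <- t) jump S g M i by [].
rewrite ler0_norm; lra.
Qed.
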